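(* Let $f(x)=\int_0^\infty (1-e^{-xs})\,\overline{\nu}(ds)$, $x>0$, be a Bernstein function whose Lévy measure $\overline{\nu}$ on $(0,\infty)$ satisfies $\int_0^\infty (s\wedge 1)\,\overline{\nu}(ds)<\infty$. Assume that $\overline{\nu}(0,\infty)=\infty$ and that the tail $\nu(s)=\overline{\nu}(s,\infty)$, $s>0$, is absolutely continuous. Let $Y^f$ be the inverse of a subordinator $H^f$ with Laplace exponent $f$, and let $N$ be a homogeneous Poisson process with intensity $\lambda>0$, independent of $Y^f$. Put $p_x^f(t)=\mathsf{P}\{N(Y^f(t))=x\}$ for $x=0,1,2,\dots$ and $p_{-1}^f\equiv 0$. Then for every $x=0,1,2,\dots$ and $t>0$, $${}^f\mathcal{D}_t\, p_x^f(t)=-\lambda\left[p_x^f(t)-p_{x-1}^f(t)\right],$$ with initial condition $p_x^f(0)=1$ if $x=0$ and $p_x^f(0)=0$ if $x\ge1$.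
   Context: Subordinator and inverse: $H^f(t)$, $t\ge0$, is the subordinator with $\mathsf{E}e^{-xH^f(t)}=e^{-tf(x)}$ for $x>0$, and $Y^f(t)=\inf\{s\ge 0: H^f(s)>t\}$. Under the stated conditions on $\overline{\nu}$, for $t>0$ the random variable $Y^f(t)$ has a density $u\mapsto l^f(t,u)$ on $(0,\infty)$, and $\int_0^\infty e^{-rt}l^f(t,u)\,dt=\frac{f(r)}{r}e^{-uf(r)}$, $r>0$ (known fact). Absolute continuity of the tail is understood on $(0,\infty)$, i.e. on compact subintervals. Convolution-type derivative: the generalized Caputo-Djrbashian derivative with respect to $f$ is defined on absolutely continuous functions $w$ by $${}^f\mathcal{D}_t w(t)=\int_0^t \frac{\partial}{\partial t}w(t-s)\,\nu(s)\,ds,\qquad \nu(s)=\overline{\nu}(s,\infty).$$ *)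

(* Defs.v *)
From HB Require Import structures.
From mathcomp Require Export all_boot all_order all_algebra.
From mathcomp Require Export all_classical all_reals all_analysis.
Set Implicit Arguments.
Unset Strict Implicit.
Unset Printing Implicit Defensive.
Import Order.TTheory GRing.Theory Num.Theory.
Import numFieldNormedType.Exports.
Local Open Scope classical_set_scope.
Local Open Scope ring_scope.

Definition abs_cont {R : realType} (a b : R) (g : R -> R) : Prop :=
  forall e : R, 0 < e ->
  exists2 delta : R, 0 < delta &
    forall (n : nat) (u v : 'I_n -> R),
      (forall i, a <= u i /\ u i <= v i /\ v i <= b) ->
      trivIset [set: 'I_n] (fun i => `]u i, v i[%classic) ->
      \sum_(i < n) (v i - u i) < delta ->
      \sum_(i < n) `|g (v i) - g (u i)| < e.

(* A measure on (0, oo) is represented by a measure on R of which only the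
   restriction to (0, oo) is ever used. *)
Section levy_measures.
Context {R : realType}.
Variable nubar : {measure set (measurableTypeR R) -> \bar R}.

Definition is_levy_measure : Prop :=
  (\int[nubar]_(s in `]0%R, +oo[) (Num.min s 1)%:E < +oo)%E.

Definition bernstein_fun (x : R) : R :=
  \int[nubar]_(s in `]0%R, +oo[) (1 - expR (- (x * s))).

(* For a Levy measure this is finite at every s > 0. *)
Definition levy_tail (s : R) : R := fine (nubar `]s, +oo[%classic).

End levy_measures.

(* Processes are indexed by R, and only their values at times t >= 0 matter. *)
Section processes.
Context {R : realType} {d : measure_display} {Omega : measurableType d}.
Variable P : probability Omega R.

Definition independent_increments (X : R -> Omega -> R) : Prop :=
  forall (n : nat) (t : nat -> R) (B : nat -> set R),
    0 <= t 0%N ->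
    (forall i j, (i <= j)%N -> t i <= t j) ->
    (forall i, measurable (B i)) ->
    P (\bigcap_(i < n) [set w | B i (X (t i.+1) w - X (t i) w)%R]) =
    (\prod_(i < n) P [set w | B i (X (t i.+1) w - X (t i) w)%R])%E.

Definition stationary_increments (X : R -> Omega -> R) : Prop :=
  forall (s t : R) (B : set R), 0 <= s -> s <= t -> measurable B ->
    P [set w | B (X t w - X s w)%R] = P [set w | B (X (t - s) w - X 0 w)%R].

(* Left limits exist automatically for nondecreasing paths. *)
Definition increasing_cadlag_path (x : R -> R) : Prop :=
  [/\ x 0 = 0,
      (forall s t, 0 <= s -> s <= t -> x s <= x t) &
      (forall t, 0 <= t -> x u @[u --> t^'+] --> x t)].

Record is_subordinator (f : R -> R) (H : R -> Omega -> R) : Prop := {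
  subordinator_measurable : forall t, 0 <= t -> measurable_fun setT (H t) ;
  subordinator_paths : forall w, increasing_cadlag_path (H ^~ w) ;
  subordinator_indep : independent_increments H ;
  subordinator_stationary : stationary_increments H ;
  subordinator_laplace : forall t x, 0 <= t -> 0 < x ->
    ('E_P[fun w => expR (- (x * H t w))] = (expR (- (t * f x)))%:E)%E }.

(* If H never exceeds t, which for a nonzero exponent only happens on a
   P-null set, the real infimum of the empty set is 0. *)
Definition inverse_process (H : R -> Omega -> R) (t : R) (w : Omega) : R :=
  inf [set s | 0 <= s /\ t < H s w].

Record is_poisson_process (lambda : R) (N : R -> Omega -> nat) : Prop := {
  poisson_measurable : forall t, 0 <= t -> measurable_fun setT (N t) ;
  poisson_paths : forall w, increasing_cadlag_path (fun t => (N t w)%:R) ;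
  poisson_indep : independent_increments (fun t w => (N t w)%:R) ;
  poisson_law : forall (s t : R) (k : nat), 0 <= s -> s < t ->
    P [set w | (N t w - N s w)%N = k] =
    (poisson_pmf (lambda * (t - s)) k)%:E }.

Definition process_sigma_algebra {d'} {S : measurableType d'}
    (X : R -> Omega -> S) : set (set Omega) :=
  <<s [set A | exists2 t : R, 0 <= t &
               exists2 B : set S, measurable B & A = X t @^-1` B] >>.

Definition independent_processes {d1 d2}
    {S1 : measurableType d1} {S2 : measurableType d2}
    (X : R -> Omega -> S1) (Y : R -> Omega -> S2) : Prop :=
  forall A B : set Omega,
    process_sigma_algebra X A -> process_sigma_algebra Y B ->
    P (A `&` B) = (P A * P B)%E.

(* Indexed by int so that the state -1 makes sense, with probability 0. *)
Definition state_prob (N : R -> Omega -> nat) (Y : R -> Omega -> R)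
    (x : int) (t : R) : R :=
  match x with
  | Posz k => fine (P [set w | N (Y t w) w = k])
  | Negz _ => 0
  end.

End processes.

Section caputo_djrbashian.
Context {R : realType}.
Variables (nu w : R -> R).

Definition caputo_djrbashian_integrand (t s : R) : R :=
  derive1 (fun u => w (u - s)) t * nu s.

Definition caputo_djrbashian (t : R) : R :=
  \int[lebesgue_measure]_(s in `]0%R, t[) caputo_djrbashian_integrand t s.

(* The derivative of an absolutely continuous w exists only almost everywhere;
   derive1 has an arbitrary value elsewhere, which the integral ignores. *)
Definition caputo_djrbashian_dom : Prop :=
  (forall T, 0 < T -> abs_cont 0 T w) /\
  (forall t, 0 < t ->
     (@lebesgue_measure R).-integrable `]0%R, t[
       (fun s => (caputo_djrbashian_integrand t s)%:E)).

End caputo_djrbashian.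

(* Main.v *)
(* Write g_n(u) = e^(-lambda u) (lambda u)^n / n! and let W_n(E) be the integral of
   g_n(u) P(H(u) in E) over u > 0, a finite measure with Laplace transform
   lambda^n / (lambda + f)^(n+1). Integrating g_n up to Y(t) and using u < Y(t) iff
   H(u) <= t (up to null sets) gives
   p_n(t) = delta_{n0} + lambda (W_{n-1} ]-oo, t] - W_n ]-oo, t]).
   An exponential tilt of W_0 makes the jump intensity finite, and shows that W_0, hence
   every W_n, is absolutely continuous, and that the renewal identity: the integral of
   lambda + nu(t - y) over y < t against W_0(dy) is 1, holds for every t > 0 and not only
   almost everywhere. Convolving it with W_{n-1} gives nu * w_n = p_n for the density w_n
   of W_n, so that p_n, which has density lambda (w_{n-1} - w_n), has Caputo-Djrbashian
   derivative lambda (p_{n-1} - p_n). *)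

(* The measures [W n] replace a density of the inverse process: their Laplace transforms come
   directly from that of H, and uniqueness of Laplace transforms yields the convolution identities.
   Uniqueness only identifies measures, hence functions almost everywhere, whereas the equation is
   claimed at each t > 0; this obstacle shapes the renewal part. The bound <= 1 holds at every t
   because the tail is monotone and right-continuous. The bound >= 1 comes from V = U + U * V *
   beta, where V is W_0, U is V tilted by e^(-r x) and beta has density 1 - e^(-r s) with respect to
   the Lévy measure: a path is followed up to its first removed jump, then restarted. Convolving
   with the absolutely continuous beta makes the renewal identity exact at each point, and the
   remainder (lambda + f(r)) e^(-r t) V(R) vanishes as r grows. The same decomposition gives
   absolute continuity: V charges a null set only through U, whose mass 1 / (lambda + f(r)) tends to
   0 because the Lévy measure is infinite and so f is unbounded. Absolute continuity of the tail is
   what makes beta absolutely continuous. *)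
Require Import Defs.
From HB Require Import structures.
From mathcomp Require Import all_boot all_order all_algebra.
From mathcomp Require Import all_classical all_reals all_analysis.
From mathcomp Require Import measurable_realfun ring lra.
Import Order.TTheory GRing.Theory Num.Theory.
Import numFieldNormedType.Exports.
Local Open Scope classical_set_scope.
Local Open Scope ring_scope.
Set Implicit Arguments.
Unset Strict Implicit.
Unset Printing Implicit Defensive.

(** * Measures with a density and image measures *)

Section weighted_image.
Context {d d' : measure_display} {X : measurableType d} {Y : measurableType d'}.
Context {R : realType} (m : {measure set X -> \bar R}) (w : X -> R) (T : X -> Y).
Hypothesis (mw : measurable_fun setT w) (w0 : forall z, 0 <= w z).
Hypothesis mT : measurable_fun setT T.
Local Open Scope ereal_scope.

(** The image under [T] of the measure with density [w] with respect to [m]. The proofs are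
    arguments of the definition because the measure instance below depends on them and must be
    inferable from the term alone. *)
Definition weighted_image of measurable_fun setT w & (forall z, 0 <= w z)%R &
  measurable_fun setT T := fun E => \int[m]_(z in T @^-1` E) (w z)%:E.

Local Notation M := (weighted_image mw w0 mT).

Let mTE E : measurable E -> measurable (T @^-1` E).
Proof. by move=> mE; rewrite -[X in measurable X]setTI; exact: mT. Qed.

Let wi0 : M set0 = 0.
Proof. by rewrite /weighted_image preimage_set0 integral_set0. Qed.

Let wi_ge0 E : 0 <= M E.
Proof. by apply: integral_ge0 => z _; rewrite lee_fin. Qed.

Let wi_sigma_additive : semi_sigma_additive M.
Proof.
move=> F mF tF mUF; rewrite /weighted_image preimage_bigcup.
apply: (@semi_sigma_additive_nng_induced _ _ _ m (EFin \o w)).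
- exact/measurable_EFinP.
- by move=> x; rewrite lee_fin.
- by move=> n; exact: mTE.
- apply/trivIsetP => /= i j _ _ ij; rewrite -preimage_setI.
  by move/trivIsetP : tF => /(_ _ _ _ _ ij) ->//; rewrite preimage_set0.
- by rewrite -preimage_bigcup; exact: mTE.
Qed.

HB.instance Definition _ := isMeasure.Build _ _ _ M wi0 wi_ge0 wi_sigma_additive.

Import HBNNSimple.

Lemma weighted_image_nnsfun (h : {nnsfun Y >-> R}) :
  \int[M]_y (h y)%:E = \int[m]_z ((h (T z))%:E * (w z)%:E).
Proof.
rewrite integralT_nnsfun sintegralE.
under [RHS]eq_integral => z _.
  rewrite fimfunE -fsumEFin// ge0_mule_fsuml; last first.
    by move=> r; exact: nnfun_muleindic_ge0.
  over.
have mi r : measurable_fun setT (fun z => (r * \1_(h @^-1` [set r]) (T z))%:E).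
  apply/measurable_EFinP; apply: measurable_funM => //.
  by apply: measurableT_comp => //; exact: measurable_indic.
rewrite ge0_integral_fsum//; last 2 first.
- by move=> r; apply: emeasurable_funM; [exact: mi|exact/measurable_EFinP].
- by move=> r z _; rewrite mule_ge0 ?lee_fin//; exact: nnfun_muleindic_ge0.
apply: eq_fsbigr => r /set_mem[y _ <-].
under eq_integral do rewrite EFinM -muleA.
rewrite ge0_integralZl//; last 3 first.
- apply: emeasurable_funM; last exact/measurable_EFinP.
  by apply/measurable_EFinP/measurableT_comp => //; exact: measurable_indic.
- by move=> z _; rewrite mule_ge0 ?lee_fin.
- by rewrite lee_fin.
congr (_ * _).
transitivity (\int[m]_(z in T @^-1` (h @^-1` [set h y])) (w z)%:E) => //.
rewrite integral_mkcond; apply: eq_integral => z _.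
rewrite patchE indicE; case: ifPn => [/set_mem zA|/negP zA].
  by rewrite mem_set// mul1e.
by rewrite memNset ?mul0e// => zB; apply: zA; exact: mem_set.
Qed.

(** Monotone convergence on both sides, along simple functions increasing to [phi]. *)
Lemma ge0_integral_weighted_image (phi : Y -> \bar R) :
  measurable_fun setT phi -> (forall y, 0 <= phi y) ->
  \int[M]_y phi y = \int[m]_z (phi (T z) * (w z)%:E).
Proof.
move=> mphi phi0; pose h := nnsfun_approx measurableT mphi.
have hphi y : (h n y)%:E @[n --> \oo] --> phi y by exact: cvg_nnsfun_approx.
transitivity (\int[M]_y limn (fun n => (h n y)%:E)).
  by apply: eq_integral => y _; apply/esym/cvg_lim => //; exact: hphi.
rewrite monotone_convergence//; last 3 first.
- by move=> n; apply/measurable_EFinP; exact: measurable_funP.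
- by move=> n y _; rewrite lee_fin.
- by move=> y _ a b ab; rewrite lee_fin; exact/lefP/nd_nnsfun_approx.
transitivity (\int[m]_z limn (fun n => (h n (T z))%:E * (w z)%:E)); last first.
  by apply: eq_integral => z _; apply/cvg_lim => //; apply: cvgeZr => //; exact: hphi.
rewrite [RHS]monotone_convergence//; last 3 first.
- move=> n; apply: emeasurable_funM; last exact/measurable_EFinP.
  by apply/measurable_EFinP/measurableT_comp => //; exact: measurable_funP.
- by move=> n z _; rewrite mule_ge0 ?lee_fin.
- move=> z _ a b ab; rewrite lee_wpmul2r ?lee_fin//.
  exact/lefP/nd_nnsfun_approx.
by apply: congr_lim; apply/funext => n; exact: weighted_image_nnsfun.
Qed.

End weighted_image.

(** * Laplace transforms *)

Section laplace_uniqueness.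
Context {R : realType}.

(* These combinations of exponentials tend to the indicator of ]-oo, t[ because
   (1 - e^(-n x))^K behaves as exp (- K e^(-n x)), with K of order e^(n t) / n. *)
Definition laplace_test (t : R) (n : nat) (x : R) : R :=
  1 - (1 - expR (- (n.+1%:R * x))) ^+ (Num.truncn (expR (n.+1%:R * t) / n.+1%:R)).+1.

Lemma onem_expRN_itv (r x : R) : 0 <= r -> 0 <= x ->
  0 <= 1 - expR (- (r * x)) <= 1.
Proof.
move=> r0 x0; by rewrite subr_ge0 expR_le1 oppr_le0 mulr_ge0//= gerBl expR_ge0.
Qed.

Lemma laplace_test_itv (t : R) n x : 0 <= x -> 0 <= laplace_test t n x <= 1.
Proof.
move=> x0; have /andP[p0 p1] := onem_expRN_itv (ler0n R n.+1) x0.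
by rewrite subr_ge0 exprn_ile1//= gerBl exprn_ge0.
Qed.

(** Bernoulli's inequality 1 - (1 - a)^K <= K a, with a = e^(-(n + 1) x). *)
Lemma laplace_test_le (t : R) n x : 0 <= x -> laplace_test t n x <=
  (Num.truncn (expR (n.+1%:R * t) / n.+1%:R)).+1%:R * expR (- (n.+1%:R * x)).
Proof.
move=> x0; rewrite /laplace_test; move: (Num.truncn _) => K.
have /andP[] := onem_expRN_itv (ler0n R n.+1) x0.
set p := expR _ => p0 p1; rewrite lerBlDr -lerBlDl.
elim: K.+1 => [|k IH]; first by rewrite mul0r subr0 expr0.
rewrite exprS; have /(ler_wpM2l p0) := IH; apply: le_trans.
have : 0 <= k%:R * p ^+ 2 by rewrite mulr_ge0// sqr_ge0.
by rewrite -natr1; nra.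
Qed.

Lemma cvg_laplace_test_gt (t x : R) : 0 <= x -> x < t ->
  laplace_test t n x @[n --> \oo] --> (1 : R).
Proof.
move=> x0 xt; pose y := t - x; have y0 : 0 < y by rewrite subr_gt0.
(* Write N = n + 1 and a = e^(-N x). Then (1 - a)^K <= e^(-K a), and K a >= e^(N y) / N >= N y^2 /
   2; finally e^(-q) <= 1 / q gives the bound c / N. *)
pose c : R := 2 / y ^+ 2.
apply: (@squeeze_cvgr _ _ _ _ (fun n => 1 - c * n.+1%:R^-1) (cst 1)); last 2 first.
- rewrite -[X in _ --> X]subr0 -[X in _ - X](mulr0 c).
  by apply: cvgB; [exact: cvg_cst|apply: cvgMl_tmp; exact: cvg_harmonic].
- exact: cvg_cst.
apply: nearW => n; have /andP[_ ->] := laplace_test_itv t n x0; rewrite andbT.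
rewrite /laplace_test lerD2l lerN2.
have /andP[p0 p1] := onem_expRN_itv (ler0n R n.+1) x0.
set K := (Num.truncn _).+1.
have KE : expR (n.+1%:R * t) / n.+1%:R <= K%:R by exact/ltW/truncnS_gt.
have n0 : 0 < n.+1%:R :> R by rewrite ltr0n.
have H1 : n.+1%:R * y ^+ 2 / 2 <= K%:R * expR (- (n.+1%:R * x)).
  apply: (@le_trans _ _ (expR (n.+1%:R * y) / n.+1%:R)).
    rewrite ler_pdivlMr//.
    have /(expR_ge1Dxn 1) : 0 <= n.+1%:R * y by rewrite mulr_ge0// ltW.
    apply: le_trans; rewrite (_ : 2`! = 2%N)// exprMn.
    by rewrite ler_wpDl// le_eqVlt; apply/orP; left; apply/eqP; field.
  rewrite mulrBr expRD mulrAC; apply: ler_wpM2r => //; exact: expR_ge0.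
apply: (@le_trans _ _ (expR (- (K%:R * expR (- (n.+1%:R * x)))))).
  rewrite -[X in _ <= expR X]mulrN expRM_natl; apply: lerXn2r => //; rewrite ?nnegrE ?expR_ge0//.
  by have := expR_ge1Dx (- expR (- (n.+1%:R * x))).
apply: (@le_trans _ _ (expR (- (n.+1%:R * y ^+ 2 / 2)))).
  by rewrite ler_expR lerN2.
have q0 : 0 < n.+1%:R * y ^+ 2 / 2 by rewrite divr_gt0// mulr_gt0// exprn_gt0.
have -> : c / n.+1%:R = (n.+1%:R * y ^+ 2 / 2)^-1.
  by rewrite /c; field; rewrite gt_eqF//= addrC natr1 gt_eqF.
rewrite expRN lef_pV2 ?posrE ?expR_gt0//.
by have := expR_ge1Dx (n.+1%:R * y ^+ 2 / 2); apply: le_trans; rewrite lerDr.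
Qed.

(** The division by N = n + 1 in the exponent of [laplace_test] settles the endpoint x = t: there K
    e^(-N x) is of order 1 / N, so the limit is the indicator of an open half-line. *)
Lemma cvg_laplace_test_le (t x : R) : 0 < t -> t <= x ->
  laplace_test t n x @[n --> \oo] --> (0 : R).
Proof.
move=> t0 tx; have x0 : 0 < x by exact: lt_le_trans tx.
(* The two terms of c bound (e^(N t) / N) e^(-N x) <= 1 / N and the rounding error e^(-N x) <= 1 /
   (N t), with N = n + 1. *)
pose c : R := 1 + t^-1.
apply: (@squeeze_cvgr _ _ _ _ (cst 0) (fun n => c * n.+1%:R^-1)); last 2 first.
- exact: cvg_cst.
- by rewrite -(mulr0 c); apply: cvgMl_tmp; exact: cvg_harmonic.
apply: nearW => n; have /andP[-> _] /= := laplace_test_itv t n (ltW x0).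
rewrite (le_trans (laplace_test_le _ _ (ltW x0)))//.
have n0 : 0 < n.+1%:R :> R by rewrite ltr0n.
have KE : (Num.truncn (expR (n.+1%:R * t) / n.+1%:R)).+1%:R <= expR (n.+1%:R * t) / n.+1%:R + 1.
  by rewrite -natr1 lerD2r truncn_le// divr_ge0// expR_ge0.
apply: (@le_trans _ _ ((expR (n.+1%:R * t) / n.+1%:R + 1) * expR (- (n.+1%:R * x)))).
  by rewrite ler_wpM2r// expR_ge0.
rewrite mulrDl mul1r mulrAC -expRD -mulrBr mulrDl mul1r lerD//.
  rewrite ler_piMl ?invr_ge0 ?ler0n// expR_le1 mulr_ge0_le0// subr_le0//.
rewrite expRN -invfM lef_pV2 ?posrE ?expR_gt0 ?mulr_gt0//.
have := expR_ge1Dx (n.+1%:R * x); apply: le_trans.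
by rewrite ler_wpDl// mulrC ler_wpM2l// ltW.
Qed.

(** A bound uniform in n that decays in x: the measures compared below may be infinite, and then the
    trivial bound 1 is not integrable. *)
Lemma laplace_test_dominated (t : R) n x : 0 < t -> 0 <= x ->
  laplace_test t n x <= 2 * expR t * expR (- x).
Proof.
move=> t0 x0; have [xt|tx] := leP x t.
  have /andP[_] := laplace_test_itv t n x0; move=> /le_trans; apply.
  rewrite -mulrA -expRD (@le_trans _ _ 2)// ?ler1n// ler_peMr// -expR0 ler_expR subr_ge0//.
rewrite (le_trans (laplace_test_le _ _ x0))//.
have n0 : 0 < n.+1%:R :> R by rewrite ltr0n.
have n1 : 1 <= n.+1%:R :> R by rewrite ler1n.
have KE : (Num.truncn (expR (n.+1%:R * t) / n.+1%:R)).+1%:R <= 2 * expR (n.+1%:R * t).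
  rewrite -natr1 (_ : 2 = 1 + 1)// mulrDl mul1r lerD//.
    apply: (@le_trans _ _ (expR (n.+1%:R * t) / n.+1%:R)).
      by rewrite Num.Theory.truncn_le divr_ge0 ?expR_ge0.
    by rewrite ler_pdivrMr// ler_peMr// expR_ge0.
  by rewrite -expR0 ler_expR mulr_ge0// ltW.
rewrite (le_trans (ler_wpM2r (expR_ge0 _) KE))// -!mulrA ler_wpM2l// -!expRD ler_expR.
by nra.
Qed.

End laplace_uniqueness.

Section laplace_uniqueness_measure.
Context {R : realType}.
Variables A B : {measure set (measurableTypeR R) -> \bar R}.
Hypothesis A0 : A `]-oo, 0[%classic = 0%E.
Hypothesis B0 : B `]-oo, 0[%classic = 0%E.
Hypothesis Afin : forall k : nat,
  (\int[A]_(x in `[0%R, +oo[) (expR (- (k.+1%:R * x)))%:E < +oo)%E.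
Hypothesis AB : forall k : nat,
  (\int[A]_(x in `[0%R, +oo[) (expR (- (k.+1%:R * x)))%:E =
   \int[B]_(x in `[0%R, +oo[) (expR (- (k.+1%:R * x)))%:E)%E.

Let D : set (measurableTypeR R) := `[0%R, +oo[%classic.
Let mD : measurable D. Proof. exact: measurable_itv. Qed.

Let measurable_expRN (r : R) E : measurable_fun (E : set (measurableTypeR R))
  (fun x : R => expR (- (r * x))).
Proof.
apply: measurable_funTS; apply: measurableT_comp => //.
by apply: measurableT_comp => //; exact: mulrl_measurable.
Qed.

Let same (g : R -> R) : Prop :=
  [/\ A.-integrable D (EFin \o g), B.-integrable D (EFin \o g) &
      \int[A]_(x in D) g x = \int[B]_(x in D) g x].

Let same_expR k : same (fun x => expR (- (k.+1%:R * x))).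
Proof.
have intA (M : {measure set (measurableTypeR R) -> \bar R}) :
    (\int[M]_(x in D) (expR (- (k.+1%:R * x)))%:E < +oo)%E ->
    M.-integrable D (EFin \o (fun x => expR (- (k.+1%:R * x)))).
  move=> Mfin; apply/integrableP; split; first exact/measurable_EFinP.
  by under eq_integral do rewrite /= ger0_norm ?expR_ge0//.
split; [exact: intA (Afin k)|by apply: intA; rewrite -AB|].
by rewrite /Rintegral AB.
Qed.

Let sameB g h : same g -> same h -> same (fun x => g x - h x).
Proof.
move=> [Ag Bg ABg] [Ah Bh ABh]; split.
- have -> : EFin \o (fun x => g x - h x) = ((EFin \o g) \- (EFin \o h))%E by [].
  exact: integrableB.
- have -> : EFin \o (fun x => g x - h x) = ((EFin \o g) \- (EFin \o h))%E by [].
  exact: integrableB.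
- by rewrite !RintegralB// ABg ABh.
Qed.

Let sameD g h : same g -> same h -> same (fun x => g x + h x).
Proof.
move=> [Ag Bg ABg] [Ah Bh ABh]; split.
- have -> : EFin \o (fun x => g x + h x) = ((EFin \o g) \+ (EFin \o h))%E by [].
  exact: integrableD.
- have -> : EFin \o (fun x => g x + h x) = ((EFin \o g) \+ (EFin \o h))%E by [].
  exact: integrableD.
- by rewrite !RintegralD// ABg ABh.
Qed.

(** The factor e^(-(j + 1) x) keeps every term integrable, since constants need not be. The
    statement is general in j because each further factor 1 - e^(-(n + 1) x) raises j to j + n + 1
    in one of the two terms. *)
Let same_expR_onemX n K j :
  same (fun x => expR (- (j.+1%:R * x)) * (1 - expR (- (n.+1%:R * x))) ^+ K).
Proof.
elim: K j => [|K IH] j.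
  by under eq_fun do rewrite expr0 mulr1; exact: same_expR.
rewrite (_ : (fun x => _) = (fun x =>
  expR (- (j.+1%:R * x)) * (1 - expR (- (n.+1%:R * x))) ^+ K -
  expR (- ((j + n).+1.+1%:R * x)) * (1 - expR (- (n.+1%:R * x))) ^+ K)).
  exact: sameB.
apply/funext => x; rewrite -mulrBl exprS mulrA mulrBr mulr1 -expRD -opprD -mulrDl.
by rewrite -natrD addnS addSn.
Qed.

(** Telescoping 1 - (1 - p)^(K + 1) = (1 - (1 - p)^K) + p (1 - p)^K writes the test function as a
    sum of integrable terms. *)
Let same_laplace_test t n : same (laplace_test t n).
Proof.
rewrite /laplace_test; move: (Num.truncn _).+1 => K; elim: K => [|K IH].
  rewrite (_ : (fun x => _) = (cst 0)); last by apply/funext => x; rewrite expr0 subrr.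
  by split; [exact: integrable0|exact: integrable0|rewrite /Rintegral !integral0].
rewrite (_ : (fun x => _) = (fun x =>
  (1 - (1 - expR (- (n.+1%:R * x))) ^+ K) +
  expR (- (n.+1%:R * x)) * (1 - expR (- (n.+1%:R * x))) ^+ K)).
  exact: sameD.
by apply/funext => x; rewrite exprS; ring.
Qed.

Let cvg_int_laplace_test (M : {measure set (measurableTypeR R) -> \bar R}) t :
  0 < t -> M `]-oo, 0[%classic = 0%E ->
  (\int[M]_(x in D) (expR (- (1%:R * x)))%:E < +oo)%E ->
  (\int[M]_(x in D) (laplace_test t n x)%:E)%E @[n --> \oo] --> M `]-oo, t[%classic.
Proof.
move=> t0 M0 Mfin.
have mE : measurable (`]-oo, t[%classic : set (measurableTypeR R)) by exact: measurable_itv.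
have mlt n : measurable_fun D (EFin \o laplace_test t n).
  apply/measurable_EFinP; apply: measurable_funB => //.
  by apply: measurable_funX; apply: measurable_funB.
have [] := @dominated_convergence _ _ _ M D mD (fun n x => (laplace_test t n x)%:E)
  (fun x => (\1_(`]-oo, t[%classic : set (measurableTypeR R)) x)%:E)
  (fun x => (2 * expR t)%:E * (expR (- (1%:R * x)))%:E)%E mlt.
- by apply/measurable_EFinP/measurable_funTS; exact: measurable_indic.
- apply: aeW => x; rewrite /D/= in_itv/= andbT => x0; apply/cvg_EFin; first exact: nearW.
  rewrite indicE; have [xt|tx] := ltP x t.
    by rewrite mem_set//= ?in_itv//=; exact: cvg_laplace_test_gt.
  by rewrite memNset//= ?in_itv/= ?ltNge ?tx//=; exact: cvg_laplace_test_le.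
- apply: integrableZl => //; apply/integrableP; split.
    by apply/measurable_EFinP.
  by under eq_integral do rewrite /= ger0_norm ?expR_ge0//.
- apply: aeW => x n; rewrite /D/= in_itv/= andbT => x0.
  have /andP[l0 _] := laplace_test_itv t n x0.
  by rewrite ger0_norm// -EFinM lee_fin mul1r; exact: laplace_test_dominated.
move=> _ _; rewrite integral_indic//.
suff -> : M (`]-oo, t[%classic `&` D) = M `]-oo, t[%classic by [].
rewrite -[in RHS](setUIDK `]-oo, t[%classic D) measureU//.
- rewrite [X in (_ + X)%E](_ : _ = 0%E) ?adde0//.
  apply: (subset_measure0 _ _ _ M0) => //; first exact: measurableD.
  move=> x; rewrite /D/= !in_itv/= andbT => -[xt /negP].
  by rewrite -ltNge.
- exact: measurableI.
- exact: measurableD.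
- by rewrite setDE setIACA setICr setI0.
Qed.

(** The integrals of [laplace_test t n] agree and converge to the masses of []-oo, t[], which are
    finite by the dominating bound. These half-lines are stable under intersection, exhaust the line
    and generate the Borel sets. The transforms are compared at positive integers only. *)
Lemma laplace_unique E : measurable E -> A E = B E.
Proof.
have AtBt t : A `]-oo, t[%classic = B `]-oo, t[%classic /\ (A `]-oo, t[%classic < +oo)%E.
  have [t0|t0] := ltP 0 t; last first.
    have sub (M : {measure set (measurableTypeR R) -> \bar R}) :
        M `]-oo, 0[%classic = 0%E -> M `]-oo, t[%classic = 0%E.
      move=> M0; apply: (subset_measure0 _ _ _ M0) => //.
      by apply: subset_itvl; rewrite bnd_simp.
    by rewrite !sub.
  have cA := cvg_int_laplace_test t0 A0 (Afin 0).
  have Bfin0 : (\int[B]_(x in D) (expR (- (1%:R * x)))%:E < +oo)%E.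
    by rewrite -(AB 0).
  have cB := cvg_int_laplace_test t0 B0 Bfin0.
  split.
    rewrite -(cvg_lim _ cA)// -(cvg_lim _ cB)//; apply: congr_lim.
    apply/funext => n.
    have [iA iB iAB] := same_laplace_test t n.
    by rewrite -[LHS]fineK ?integrable_fin_num// -[RHS]fineK ?integrable_fin_num//; congr EFin.
  apply: (@le_lt_trans _ _ ((2 * expR t)%:E * \int[A]_(x in D) (expR (- (1%:R * x)))%:E)%E).
    rewrite -(cvg_lim _ cA)//; apply: lime_le.
      by apply/cvg_ex; exists (A `]-oo, t[%classic).
    apply: nearW => n; rewrite -ge0_integralZl_EFin//; last exact/measurable_EFinP.
    apply: ge0_le_integral => //.
    - by move=> x; rewrite /D/= in_itv/= andbT => /(laplace_test_itv t n)/andP[].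
    - by have [/integrableP[]] := same_laplace_test t n.
    - by apply: emeasurable_funM => //; exact/measurable_EFinP.
    - move=> x; rewrite /D/= in_itv/= andbT => x0.
      by rewrite -EFinM lee_fin mul1r; exact: laplace_test_dominated.
  by rewrite lte_mul_pinfty// lee_fin mulr_ge0// expR_ge0.
move=> mE.
apply: (@measure_unique _ R (measurableTypeR R)
  [set I | exists x : R, I = `]-oo, x[%classic]
  (fun k => `]-oo, k%:R[%classic) _ _ _ _ A B _ _ E mE).
- exact: RGenInftyO.measurableE.
- move=> _ _ [x ->] [y ->]; exists (Num.min x y).
  by apply/seteqP; split => z /=; rewrite !in_itv/= lt_min => /andP.
- by move=> k; exists k%:R.
- apply/seteqP; split => // x _; exists (Num.truncn `|x|).+1 => //=.
  by rewrite in_itv/= (le_lt_trans (ler_norm x))// truncnS_gt.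
- by move=> _ [x ->]; have [] := AtBt x.
- by move=> k; have [] := AtBt k%:R.
Qed.

End laplace_uniqueness_measure.

(** * Finite images of measures, convolution, and reflection of Lebesgue measure *)

Lemma finite_weighted_image {d d' : measure_display} {X : measurableType d}
    {Y : measurableType d'} {R : realType} (m : {measure set X -> \bar R})
    (w : X -> R) (T : X -> Y) :
  measurable_fun setT w -> (forall z, 0 <= w z) -> measurable_fun setT T ->
  (\int[m]_z (w z)%:E < +oo)%E ->
  exists M : {finite_measure set Y -> \bar R},
    forall phi : Y -> \bar R, measurable_fun setT phi ->
      (forall y, 0 <= phi y)%E ->
    (\int[M]_y phi y = \int[m]_z (phi (T z) * (w z)%:E))%E.
Proof.
move=> mw w0 mT wfin.
have mTE E : measurable E -> measurable (T @^-1` E).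
  by move=> mE; rewrite -[X in measurable X]setTI; exact: mT.
have fM : fin_num_fun (weighted_image m mw w0 mT).
  move=> E mE; rewrite ge0_fin_numE; last exact: measure_ge0.
  apply: le_lt_trans wfin; rewrite /weighted_image.
  apply: ge0_subset_integral => //.
  - exact: mTE.
  - exact/measurable_EFinP.
  - by move=> z _; rewrite lee_fin.
pose fin := Measure_isFinite.Build _ _ _ (weighted_image m mw w0 mT) fM.
pose M : {finite_measure set Y -> \bar R} := HB.pack (weighted_image m mw w0 mT) fin.
exists M => phi mphi phi0.
exact: (ge0_integral_weighted_image m mw w0 mT mphi phi0).
Qed.

Lemma finite_convolution {R : realType}
    (A B : {finite_measure set (measurableTypeR R) -> \bar R}) :
  exists C : {finite_measure set (measurableTypeR R) -> \bar R},
    forall phi : R -> \bar R, measurable_fun setT phi ->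
      (forall y, 0 <= phi y)%E ->
    (\int[C]_y phi y = \int[A]_x \int[B]_y phi (x + y)%R)%E.
Proof.
have mD : measurable_fun setT
  (fun z : measurableTypeR R * measurableTypeR R => z.1 + z.2 : measurableTypeR R).
  exact: measurable_funD.
have [|C HC] := @finite_weighted_image _ _ _ (measurableTypeR R) R (A \x B)%E (cst 1)
   (fun z : measurableTypeR R * measurableTypeR R => z.1 + z.2)
   (measurable_cst _) (fun=> ler01) mD.
  rewrite [X in (X < _)%E](integral_cst (A \x B)%E measurableT 1%E) mul1e.
  rewrite [X in (X < _)%E](_ : _ = (A setT * B setT)%E); last first.
    by rewrite -product_measure1E// setXTT.
  apply: lte_mul_pinfty => //;
    by [exact: fin_num_measure|rewrite ltey_eq fin_num_measure].
exists C => phi mphi phi0; rewrite HC//.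
under eq_integral do rewrite mule1.
rewrite (@fubini_tonelli1 _ _ (measurableTypeR R) (measurableTypeR R) R A B
  (fun z => phi (z.1 + z.2)%R))//.
exact: measurableT_comp.
Qed.

Lemma measure_eq_integral {d : measure_display} {T : measurableType d} {R : realType}
    (A B : {measure set T -> \bar R}) :
  (forall E, measurable E -> A E = B E) ->
  forall phi : T -> \bar R, (\int[A]_x phi x = \int[B]_x phi x)%E.
Proof. by move=> AB phi; apply: eq_measure_integral => E mE _; exact: AB. Qed.

Lemma integral_indicE {d : measure_display} {T : measurableType d} {R : realType}
    (A : {measure set T -> \bar R}) E : measurable E ->
  (\int[A]_x (\1_E x)%:E = A E)%E.
Proof. by move=> mE; rewrite integral_indic// setIT. Qed.

(** The reflection pulls ]a, b] back to [t - b, t - a[, of equal length, so the image of Lebesgue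
    measure is Lebesgue measure by uniqueness. *)
Lemma ge0_integral_lebesgue_reflect {R : realType} (t : R) (f : R -> \bar R) :
  measurable_fun setT f -> (forall x, 0 <= f x)%E ->
  (\int[lebesgue_measure]_s f (t - s)%R = \int[lebesgue_measure]_s f s)%E.
Proof.
move=> mf f0.
have mr : measurable_fun setT (fun s : measurableTypeR R => t - s : measurableTypeR R).
  exact: measurable_funB.
have mr1 := isMeasurableFun.Build _ _ _ _ _ mr.
pose r : {mfun measurableTypeR R >-> measurableTypeR R} := HB.pack (fun s : R => t - s) mr1.
transitivity (\int[pushforward lebesgue_measure r]_s f s)%E.
  by rewrite ge0_integral_pushforward// preimage_setT.
apply: eq_measure_integral => E mE _; apply/esym.
apply: (@lebesgue_measure_unique R (pushforward lebesgue_measure r)) => //.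
move=> _ [[a b] _ <-]; rewrite lebesgue_measure_itv/=.
rewrite /pushforward (_ : _ @^-1` _ = `[t - b, t - a[%classic); last first.
  apply/seteqP; split => x /=; rewrite !in_itv/=; lra.
rewrite [RHS]lebesgue_measure_itv/= !lte_fin ltrD2l ltrN2; case: ifPn => // ab.
by rewrite -!EFinB; congr EFin; lra.
Qed.

Section expR_integrals.
Context {R : realType}.

Lemma measurable_expRNM (r : R) E : measurable_fun (E : set (measurableTypeR R))
  (fun x : R => expR (- (r * x))).
Proof.
apply: measurable_funTS; apply: measurableT_comp => //.
by apply: measurableT_comp => //; exact: mulrl_measurable.
Qed.

Lemma integral_expRNM_itv0o (r y : R) : 0 < r -> 0 < y ->
  (\int[lebesgue_measure]_(s in `]0%R, y[) (expR (- (r * s)))%:E =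
   ((1 - expR (- (r * y))) / r)%:E)%E.
Proof.
move=> r0 y0; rewrite -(@integral_itv_bndoo _ _ _ _ true false); last first.
  by apply/measurable_EFinP; exact: measurable_expRNM.
have := exponential_prob_itv0c r y0; rewrite /exponential_prob.
rewrite (eq_integral (fun s : measurableTypeR R => r%:E * (expR (- (r * s)))%:E)%E); last first.
  by move=> s /[!inE]/=; rewrite in_itv/= => /andP[s0 _]; rewrite exponential_pdfE// -EFinM mulNr.
rewrite ge0_integralZl_EFin//; last 2 first.
- by apply/measurable_EFinP; exact: measurable_expRNM.
- exact: ltW.
move=> H.
have -> : ((1 - expR (- (r * y))) / r)%:E = (r^-1%:E * (1 - (expR (- r * y))%:E))%E.
  by rewrite -EFinB -EFinM mulrC mulNr.
by rewrite -H muleA -EFinM mulVf ?gt_eqF// mul1e.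
Qed.

Lemma integral_expRNM_itv0y (r : R) : 0 < r ->
  (\int[lebesgue_measure]_(s in `]0%R, +oo[) (expR (- (r * s)))%:E = (r^-1)%:E)%E.
Proof.
move=> r0; rewrite integral_itv_obnd_cbnd; last first.
  by apply/measurable_EFinP; exact: measurable_expRNM.
have := integral_exponential_pdf r0.
rewrite (_ : (fun x => _) = (EFin \o exponential_pdf r))//.
rewrite /exponential_pdf -restrict_EFin -integral_mkcond/=.
under eq_integral do rewrite EFinM mulNr.
rewrite ge0_integralZl_EFin//; last 2 first.
- by apply/measurable_EFinP; exact: measurable_expRNM.
- exact: ltW.
by move=> H; rewrite -[RHS]mule1 -H muleA -EFinM mulVf ?gt_eqF// mul1e.
Qed.

End expR_integrals.

(** * Laplace transforms and convolutions of measures on the half-line *)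

Section laplace_transform.
Context {R : realType}.
Implicit Types (A B C : {measure set (measurableTypeR R) -> \bar R}) (r : R).
Local Open Scope ereal_scope.

Definition laplace A r := \int[A]_x (expR (- (r * x)))%:E.

Lemma ge0_integral_null_setC A (D : set (measurableTypeR R)) (phi : R -> \bar R) :
  measurable D -> A (~` D) = 0 -> measurable_fun setT phi ->
  (forall x, 0 <= phi x) -> \int[A]_x phi x = \int[A]_(x in D) phi x.
Proof.
move=> mD A0 mphi phi0; rewrite (ge0_negligible_integral (measurableC mD))//.
by rewrite setTD setCK.
Qed.

Lemma setC_itv0y : ~` `[0%R, +oo[%classic = `]-oo, (0%R : R)[%classic.
Proof. by rewrite setCitvr. Qed.

Lemma integral_itv0y A (phi : R -> \bar R) : A `]-oo, 0%R[%classic = 0 ->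
  measurable_fun setT phi -> (forall x, 0 <= phi x) ->
  \int[A]_x phi x = \int[A]_(x in `[0%R, +oo[) phi x.
Proof.
move=> A0 mphi phi0; apply: ge0_integral_null_setC => //.
by rewrite setC_itv0y.
Qed.

Lemma measurable_EFin_expRNM r : measurable_fun setT
  (fun x : measurableTypeR R => (expR (- (r * x)))%:E).
Proof. by apply/measurable_EFinP; exact: measurable_expRNM. Qed.

Lemma laplaceE A r : A `]-oo, 0%R[%classic = 0 ->
  laplace A r = \int[A]_(x in `[0%R, +oo[) (expR (- (r * x)))%:E.
Proof.
move=> A0; apply: integral_itv0y => //.
exact: measurable_EFin_expRNM.
Qed.

Lemma laplace_inj A B : A `]-oo, 0%R[%classic = 0 -> B `]-oo, 0%R[%classic = 0 ->
  (forall r, (0 < r)%R -> laplace A r < +oo) ->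
  (forall r, (0 < r)%R -> laplace A r = laplace B r) ->
  forall E, measurable E -> A E = B E.
Proof.
move=> A0 B0 Afin AB; apply: laplace_unique => // k.
  by rewrite -laplaceE//; exact: Afin.
by rewrite -!laplaceE//; exact: AB.
Qed.

Lemma laplace_conv A B C r :
  (forall phi : R -> \bar R, measurable_fun setT phi -> (forall y, 0 <= phi y) ->
    \int[C]_y phi y = \int[A]_x \int[B]_y phi (x + y)%R) ->
  laplace B r < +oo ->
  laplace C r = laplace A r * laplace B r.
Proof.
move=> CE Bfin; rewrite /laplace CE//; last exact: measurable_EFin_expRNM.
have B0 : 0 <= laplace B r by apply: integral_ge0 => x _; rewrite lee_fin expR_ge0.
under eq_integral => x _.
  under eq_integral do rewrite mulrDr opprD expRD EFinM.
  rewrite ge0_integralZl_EFin ?expR_ge0//; last exact: measurable_EFin_expRNM.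
  over.
by rewrite ge0_integralZr//; exact: measurable_EFin_expRNM.
Qed.

Lemma measurable_fun_integral_pair (B : {sigma_finite_measure set (measurableTypeR R) -> \bar R})
    (F : measurableTypeR R * measurableTypeR R -> \bar R) :
  measurable_fun setT F -> (forall z, 0 <= F z) ->
  measurable_fun setT (fun x => \int[B]_y F (x, y)).
Proof.
move=> mF F0.
exact: (@measurable_fun_fubini_tonelli_F _ _ (measurableTypeR R) (measurableTypeR R) R B F).
Qed.

Lemma conv_null A (B : {sigma_finite_measure set (measurableTypeR R) -> \bar R}) C :
  (forall phi : R -> \bar R, measurable_fun setT phi -> (forall y, 0 <= phi y) ->
    \int[C]_y phi y = \int[A]_x \int[B]_y phi (x + y)%R) ->
  A `]-oo, 0%R[%classic = 0 -> B `]-oo, 0%R[%classic = 0 ->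
  C `]-oo, 0%R[%classic = 0.
Proof.
move=> CE A0 B0.
have mneg : measurable (`]-oo, 0%R[%classic : set (measurableTypeR R)) by [].
rewrite -integral_indicE// (CE (fun x => (\1_(`]-oo, 0%R[%classic : set R) x)%:E))//; last first.
  by apply/measurable_EFinP; exact: measurable_indic.
rewrite (integral_itv0y A0); last 2 first.
- apply: (@measurable_fun_integral_pair B
    (fun z => (\1_(`]-oo, 0%R[%classic : set R) (z.1 + z.2)%R)%:E)) => //.
  apply/measurable_EFinP; apply: measurableT_comp; first exact: measurable_indic.
  exact: measurable_funD.
- by move=> x; apply: integral_ge0 => y _; rewrite lee_fin.
rewrite integral0_eq// => x; rewrite /= in_itv/= andbT => x0.
rewrite integral_itv0y//; last first.
  apply/measurable_EFinP; apply: measurableT_comp; first exact: measurable_indic.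
  exact: measurable_funD.
rewrite integral0_eq// => y; rewrite /= in_itv/= andbT => y0.
by rewrite indicE memNset//= in_itv/= ltNge addr_ge0.
Qed.

End laplace_transform.

Lemma integral_indicM {d : measure_display} {T : measurableType d} {R : realType}
    (A : {measure set T -> \bar R}) (E : set T) (g : T -> \bar R) :
  (\int[A]_x ((\1_E x)%:E * g x) = \int[A]_(x in E) g x)%E.
Proof.
rewrite [RHS]integral_mkcond; apply: eq_integral => x _.
by rewrite patchE indicE; case: ifPn => _; rewrite ?mul1e ?mul0e.
Qed.

Section lebesgue_translate.
Context {R : realType}.

Lemma measurable_indic_EFin (E : set (measurableTypeR R)) : measurable E ->
  measurable_fun setT (fun x : measurableTypeR R => (\1_E x : R)%:E).
Proof. by move=> mE; apply/measurable_EFinP; exact: measurable_indic. Qed.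

(** The translation by c is a composite of two reflections: c + s = c - (0 - s). *)
Lemma lebesgue_translate0 (E : set (measurableTypeR R)) (c : R) : measurable E ->
  lebesgue_measure E = 0%E ->
  lebesgue_measure ((fun s : measurableTypeR R => c + s : measurableTypeR R) @^-1` E) = 0%E.
Proof.
move=> mE E0.
have mp (g : measurableTypeR R -> measurableTypeR R) : measurable_fun setT g ->
    measurable (g @^-1` E).
  by move=> mg; rewrite -[X in measurable X]setTI; exact: mg.
rewrite -integral_indicE; last by apply: mp; exact: measurable_funD.
rewrite (_ : (fun x => _) = (fun s => (\1_E (c - (0 - s)) : R)%:E)); last first.
  by apply/funext => s; rewrite !indicE sub0r opprK.
have m1 : measurable_fun setT (fun s : measurableTypeR R => (\1_E (c - s) : R)%:E).
  apply: (@measurableT_comp _ _ _ _ _ _ (fun x : measurableTypeR R => (\1_E x : R)%:E)).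
    exact: measurable_indic_EFin.
  exact: measurable_funB.
rewrite (ge0_integral_lebesgue_reflect 0 (f := fun s => (\1_E (c - s) : R)%:E))//.
rewrite (ge0_integral_lebesgue_reflect c (f := fun s => (\1_E s : R)%:E))//; last first.
  exact: measurable_indic_EFin.
by rewrite integral_indicE.
Qed.

End lebesgue_translate.

(** * Potential measures of a killed subordinator *)

Section levy_exponent.
Context {R : realType}.
Variables (nu0 : {sigma_finite_measure set (measurableTypeR R) -> \bar R}).
Variable f : R -> R.
Hypothesis nu0_pos : nu0 `]-oo, 0%R]%classic = 0%E.
Hypothesis fE : forall r, 0 < r ->
  (\int[nu0]_s (1 - expR (- (r * Num.max s 0)))%:E = (f r)%:E)%E.

(** Truncating x at 0 keeps the factor bounded by 1 on the whole line for r >= 0, so that integrals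
    need no restriction of the domain; the measures that are tilted do not charge the negative
    axis. *)
Definition tilt (r x : R) : R := expR (- (r * Num.max x 0)).

Lemma tilt_ge0 r x : 0 <= tilt r x. Proof. exact: expR_ge0. Qed.

Lemma tilt_le1 r x : 0 <= r -> tilt r x <= 1.
Proof. by move=> r0; rewrite expR_le1 oppr_le0 mulr_ge0// le_max lexx orbT. Qed.

Lemma tilt_pos r x : 0 <= x -> tilt r x = expR (- (r * x)).
Proof. by move=> x0; rewrite /tilt max_l. Qed.

Lemma measurable_tilt r : measurable_fun setT (tilt r : measurableTypeR R -> _).
Proof.
apply: (@measurableT_comp _ _ _ _ _ _ (fun y : measurableTypeR R => expR (- (r * y)))).
  exact: measurable_expRNM.
exact: measurable_maxr.
Qed.

Lemma measurable_onem_tilt r :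
  measurable_fun setT (fun x : measurableTypeR R => 1 - tilt r x).
Proof. by apply: measurable_funB => //; exact: measurable_tilt. Qed.

Lemma levy_exponent_ge0 r : 0 < r -> 0 <= f r.
Proof.
move=> r0; rewrite -lee_fin -fE//; apply: integral_ge0 => s _.
by rewrite lee_fin subr_ge0; apply: tilt_le1; exact: ltW.
Qed.

(** For s > 0, e^(-r s) (1 - e^(-t s)) = (1 - e^(-(r + t) s)) - (1 - e^(-r s)). Hence f(r + t) -
    f(r) is the Laplace transform of the finite measure of the jumps removed by the tilt. *)
Lemma levy_exponentD r t : 0 < r -> 0 < t ->
  ((f r)%:E + \int[nu0]_s ((expR (- (r * s)))%:E * (1 - tilt t s)%:E) = (f (r + t)%R)%:E)%E.
Proof.
move=> r0 t0; rewrite -!fE ?addr_gt0//.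
have pos (g : R -> \bar R) : measurable_fun setT g -> (forall x, 0 <= g x)%E ->
    (\int[nu0]_x g x = \int[nu0]_(x in `]0%R, +oo[) g x)%E.
  move=> mg g0; apply: ge0_integral_null_setC => //.
  by rewrite setCitvr.
rewrite pos; last 2 first.
- by apply/measurable_EFinP; exact: measurable_onem_tilt.
- by move=> x; rewrite lee_fin subr_ge0 tilt_le1// ltW.
rewrite pos; last 2 first.
- apply: emeasurable_funM; first exact: measurable_EFin_expRNM.
  by apply/measurable_EFinP; exact: measurable_onem_tilt.
- by move=> x; rewrite mule_ge0// lee_fin ?expR_ge0// subr_ge0 tilt_le1// ltW.
rewrite [RHS]pos; last 2 first.
- by apply/measurable_EFinP; exact: measurable_onem_tilt.
- by move=> x; rewrite lee_fin subr_ge0 tilt_le1// ltW// addr_gt0.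
rewrite -ge0_integralD//; last 4 first.
- by move=> x _; rewrite lee_fin subr_ge0; apply: tilt_le1; exact: ltW.
- apply: measurable_funTS.
  by apply/measurable_EFinP; exact: measurable_onem_tilt.
- by move=> x _; rewrite mule_ge0// lee_fin ?expR_ge0// subr_ge0 tilt_le1// ltW.
- apply: measurable_funTS; apply: emeasurable_funM; first exact: measurable_EFin_expRNM.
  by apply/measurable_EFinP; exact: measurable_onem_tilt.
apply: eq_integral => x; rewrite inE/= in_itv/= andbT => x0.
rewrite -EFinM -EFinD; congr EFin; rewrite -!/(tilt _ _) !tilt_pos ?ltW//.
by rewrite mulrDl opprD expRD; ring.
Qed.

(** Bernoulli's inequality under the integral. This linear growth of f is what a factor e^(-r t) has
    to beat in the lower renewal bound. *)
Lemma levy_exponent_nat n : f n.+1%:R <= n.+1%:R * f 1.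
Proof.
rewrite -lee_fin -fE// EFinM -fE// -ge0_integralZl_EFin//; last 2 first.
- by move=> s _; rewrite lee_fin subr_ge0; exact: tilt_le1.
- by apply/measurable_EFinP; exact: measurable_onem_tilt.
apply: ge0_le_integral => //.
- by move=> s _; rewrite lee_fin subr_ge0; exact: tilt_le1.
- by apply/measurable_EFinP; exact: measurable_onem_tilt.
- by apply: emeasurable_funM => //; apply/measurable_EFinP; exact: measurable_onem_tilt.
- move=> s _; rewrite -EFinM lee_fin -mulrN expRM_natl mul1r.
  set p := expR _; have p0 : 0 <= p by exact: expR_ge0.
  elim: n => [|n IH]; first by rewrite expr1 mul1r.
  rewrite exprS -[n.+2]addn1 natrD.
  have := ler_wpM2l p0 IH.
  have : 0 <= (1 - p) ^+ 2 * n.+1%:R by rewrite mulr_ge0// sqr_ge0.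
  by move: (p ^+ n.+1) => q; nra.
Qed.

(** Monotone convergence: 1 - e^(-(n + 1) s) increases to 1 at each s > 0. Infinite Lévy mass enters
    the absolute continuity of the potential here. *)
Lemma cvg_levy_exponent : nu0 setT = +oo%E -> (f n.+1%:R)%:E @[n --> \oo] --> +oo%E.
Proof.
move=> nu0y.
have pos : (\int[nu0]_(s in `]0%R, +oo[) 1 = +oo)%E.
  rewrite integral_cst// mul1e -nu0y -[in RHS](setvU `]-oo, 0%R]%classic) measureU//.
  - by rewrite setCitvl [X in (_ + X)%E](_ : _ = 0%E) ?adde0//; exact: nu0_pos.
  - exact: measurableC.
  - by rewrite setICl.
have -> : (fun n => (f n.+1%:R)%:E) =
    (fun n => \int[nu0]_(s in `]0%R, +oo[) (1 - tilt n.+1%:R s)%:E)%E.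
  apply/funext => n; rewrite -fE// (@ge0_integral_null_setC _ _ `]0%R, +oo[%classic)//.
  - by rewrite setCitvr.
  - by apply/measurable_EFinP; exact: measurable_onem_tilt.
  - by move=> s; rewrite lee_fin subr_ge0; exact: tilt_le1.
rewrite -pos.
have -> : (\int[nu0]_(s in `]0%R, +oo[) 1 =
    \int[nu0]_(s in `]0%R, +oo[) limn (fun n => (1 - tilt n.+1%:R s)%:E))%E.
  apply: eq_integral => s; rewrite inE/= in_itv/= andbT => s0.
  apply/esym/cvg_lim => //; apply/cvg_EFin; first exact: nearW.
  rewrite -[X in _ --> X]subr0; apply: cvgB; first exact: cvg_cst.
  apply: (@squeeze_cvgr _ _ _ _ (cst 0) (fun n => s^-1 * n.+1%:R^-1)); last 2 first.
  - exact: cvg_cst.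
  - by rewrite -(mulr0 s^-1); apply: cvgMl_tmp; exact: cvg_harmonic.
  apply: nearW => n; rewrite tilt_ge0 /= (tilt_pos _ (ltW s0)) expRN -invfM.
  rewrite lef_pV2 ?posrE ?expR_gt0 ?mulr_gt0//.
  by have := expR_ge1Dx (n.+1%:R * s); apply: le_trans; rewrite mulrC lerDr.
apply: cvg_monotone_convergence => //.
- move=> n; apply: measurable_funTS.
  by apply/measurable_EFinP; exact: measurable_onem_tilt.
- by move=> n s _; rewrite lee_fin subr_ge0; exact: tilt_le1.
- move=> s; rewrite /= in_itv/= andbT => s0 m n mn.
  rewrite lee_fin lerD2l lerN2 !(tilt_pos _ (ltW s0)) ler_expR lerN2.
  by rewrite (ler_wpM2r (ltW s0))// ler_nat ltnS.
Qed.

End levy_exponent.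

Section potential.
Context {R : realType}.
Variables (nu0 : {sigma_finite_measure set (measurableTypeR R) -> \bar R}).
Variables (f : R -> R) (lambda : R).
Hypothesis nu0_pos : nu0 `]-oo, 0%R]%classic = 0%E.
Hypothesis fE : forall r, 0 < r ->
  (\int[nu0]_s (1 - expR (- (r * Num.max s 0)))%:E = (f r)%:E)%E.
Hypothesis nu0_infty : nu0 setT = +oo%E.
Hypothesis nu0_ac : forall E : set (measurableTypeR R), measurable E ->
  lebesgue_measure E = 0%E -> nu0 E = 0%E.
Hypothesis lambda_gt0 : 0 < lambda.
Variable V : {finite_measure set (measurableTypeR R) -> \bar R}.
Hypothesis V_pos : V `]-oo, 0%R[%classic = 0%E.
Hypothesis VE : forall r, 0 < r -> laplace V r = ((lambda + f r)^-1)%:E.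

Lemma killed_exponent_gt0 r : 0 < r -> 0 < lambda + f r.
Proof. by move=> r0; rewrite ltr_wpDr// (levy_exponent_ge0 fE). Qed.

Lemma integral_tiltE (phi : R -> \bar R) t : measurable_fun setT phi ->
  (forall x, 0 <= phi x)%E ->
  (\int[V]_x (phi x * (tilt t x)%:E) =
   \int[V]_x (phi x * (expR (- (t * x)))%:E))%E.
Proof.
move=> mphi phi0.
rewrite (integral_itv0y V_pos); last 2 first.
- by apply: emeasurable_funM => //; apply/measurable_EFinP; exact: measurable_tilt.
- by move=> x; rewrite mule_ge0// lee_fin tilt_ge0.
rewrite [RHS](integral_itv0y V_pos); last 2 first.
- by apply: emeasurable_funM => //; apply/measurable_EFinP; exact: measurable_expRNM.
- by move=> x; rewrite mule_ge0// lee_fin expR_ge0.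
apply: eq_integral => x; rewrite inE/= in_itv/= andbT => x0.
by rewrite tilt_pos.
Qed.

(* Tilting [V] by [expR (- t x)] turns [f] into [f (. + t)], which amounts to
   thinning the jumps: the jumps removed have the finite intensity
   [(1 - expR (- t s)) nu0(ds)], of total mass [f t]. *)
Lemma tilted_decomposition t : 0 < t ->
  exists U beta : {finite_measure set (measurableTypeR R) -> \bar R},
  [/\ forall phi : R -> \bar R, measurable_fun setT phi ->
        (forall x, 0 <= phi x)%E ->
        (\int[U]_x phi x = \int[V]_x (phi x * (expR (- (t * x)))%:E))%E,
      forall phi : R -> \bar R, measurable_fun setT phi ->
        (forall x, 0 <= phi x)%E ->
        (\int[beta]_s phi s = \int[nu0]_s (phi s * (1 - tilt t s)%:E))%E &
      forall phi : R -> \bar R, measurable_fun setT phi ->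
        (forall x, 0 <= phi x)%E ->
        (\int[V]_x phi x = \int[U]_x phi x +
          \int[U]_x \int[V]_y \int[beta]_s phi (x + (y + s))%R)%E].
Proof.
move=> t0.
have [|U UE] := @finite_weighted_image _ _ _ (measurableTypeR R) R V (tilt t) idfun
    (measurable_tilt t) (tilt_ge0 t) (@measurable_id _ _ _).
  apply: (@le_lt_trans _ _ (\int[V]_x 1)%E); last first.
    by rewrite integral_cst// mul1e ltey_eq fin_num_measure.
  apply: ge0_le_integral => //.
  - by move=> x _; rewrite lee_fin tilt_ge0.
  - by apply/measurable_EFinP; exact: measurable_tilt.
  - by move=> x _; rewrite lee_fin; apply: tilt_le1; exact: ltW.
have [|||beta betaE] := @finite_weighted_image _ _ _ (measurableTypeR R) R nu0
    (fun s => 1 - tilt t s) idfun _ _ (@measurable_id _ _ _).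
- exact: measurable_onem_tilt.
- by move=> s; rewrite subr_ge0; apply: tilt_le1; exact: ltW.
- by rewrite fE// ltry.
have betaN : beta `]-oo, 0%R[%classic = 0%E.
  rewrite -integral_indicE// (betaE (fun x => (\1_(`]-oo, 0%R[%classic : set R) x)%:E))//; last first.
    by apply/measurable_EFinP; exact: measurable_indic.
  rewrite integral0_eq// => s _; have [s0|s0] := leP 0 s.
    by rewrite indicE memNset ?mul0e//= in_itv/= ltNge s0.
  by rewrite /tilt max_r ?ltW// mulr0 oppr0 expR0 subrr mule0.
have UN : U `]-oo, 0%R[%classic = 0%E.
  rewrite -integral_indicE// (UE (fun x => (\1_(`]-oo, 0%R[%classic : set R) x)%:E))//; last first.
    by apply/measurable_EFinP; exact: measurable_indic.
  rewrite (integral_itv0y V_pos); last 2 first.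
  - apply: emeasurable_funM; last by apply/measurable_EFinP; exact: measurable_tilt.
    by apply/measurable_EFinP; exact: measurable_indic.
  - by move=> x; rewrite mule_ge0// lee_fin tilt_ge0.
  rewrite integral0_eq// => s; rewrite /= in_itv/= andbT => s0.
  by rewrite indicE memNset ?mul0e//= in_itv/= ltNge s0.
have Ulap r : 0 < r -> laplace U r = ((lambda + f (r + t))^-1)%:E.
  move=> r0; rewrite /laplace UE//; last exact: measurable_EFin_expRNM.
  rewrite integral_tiltE//; last exact: measurable_EFin_expRNM.
  rewrite -VE ?addr_gt0// /laplace; apply: eq_integral => x _.
  by rewrite -EFinM -expRD mulrDl opprD.
have betalap r : 0 < r -> laplace beta r = (f (r + t) - f r)%:E.
  move=> r0; rewrite EFinB -(levy_exponentD nu0_pos fE r0 t0) addeAC subee// add0e.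
  by rewrite /laplace betaE//; exact: measurable_EFin_expRNM.
have [C1 C1E] := finite_convolution V beta.
have [C2 C2E] := finite_convolution U C1.
have C1N : C1 `]-oo, 0%R[%classic = 0%E.
  exact: (conv_null C1E).
have C2N : C2 `]-oo, 0%R[%classic = 0%E.
  exact: (conv_null C2E).
have C1lap r : 0 < r -> laplace C1 r = ((lambda + f r)^-1 * (f (r + t) - f r))%:E.
  by move=> r0; rewrite (laplace_conv C1E) ?betalap ?ltry// VE// EFinM.
have C2lap r : 0 < r -> laplace C2 r =
    ((lambda + f (r + t))^-1 * ((lambda + f r)^-1 * (f (r + t) - f r)))%:E.
  by move=> r0; rewrite (laplace_conv C2E) ?C1lap ?ltry// Ulap// EFinM.
(* Both sides have the same transform, by the identity 1 / (lambda + f(r)) = (1 / (lambda + f(r +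
   t))) (1 + (f(r + t) - f(r)) / (lambda + f(r))). *)
have VUC E : measurable E -> V E = measure_add U C2 E.
  apply: laplace_inj => //.
  - transitivity (measure_add U C2 `]-oo, 0%R[%classic) => //.
    by rewrite measure_addE -[RHS]adde0; congr (_ + _)%E; [exact: UN|exact: C2N].
  - by move=> r r0; rewrite VE// ltry.
  - move=> r r0; transitivity (laplace U r + laplace C2 r)%E; last first.
      apply/esym/ge0_integral_measure_add => //; exact: measurable_EFin_expRNM.
    rewrite VE// Ulap// C2lap// -EFinD; congr EFin.
    have := killed_exponent_gt0 r0.
    have := killed_exponent_gt0 (addr_gt0 r0 t0).
    move: (f (r + t)) (f r) => a b a0 b0.
    by field; rewrite !gt_eqF.
exists U, beta; split.
- by move=> phi mphi phi0; rewrite (UE phi mphi phi0); exact: integral_tiltE.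
- by move=> phi mphi phi0; exact: betaE.
- move=> phi mphi phi0; rewrite (measure_eq_integral VUC).
  rewrite (ge0_integral_measure_add _ _ measurableT)//.
  congr (_ + _)%E; rewrite C2E//; apply: eq_integral => x _.
  rewrite (C1E (fun z => phi (x + z)%R))//.
  by apply: measurableT_comp => //; exact: measurable_funD.
Qed.


(** In the decomposition by the tilt at [t], [beta] has a density with respect to [nu0], so it
    vanishes on [E] and on its translates. Only the mass of [E] under [U] remains, at most U(R) = 1
    / (lambda + f(t)). *)
Lemma potential_le_exponent (E : set (measurableTypeR R)) t : measurable E ->
  lebesgue_measure E = 0%E -> 0 < t -> (V E <= ((lambda + f t)^-1)%:E)%E.
Proof.
move=> mE E0 t0; have [U [beta [UE betaE decomp]]] := tilted_decomposition t0.
rewrite -integral_indicE// decomp//; last exact: measurable_indic_EFin.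
rewrite [X in (_ + X)%E]integral0_eq ?adde0; last first.
  move=> x _; rewrite integral0_eq// => y _.
  have mxy : measurable_fun setT (fun s : measurableTypeR R => x + (y + s) : measurableTypeR R).
    by apply: measurable_funD => //; exact: measurable_funD.
  rewrite betaE//; last first.
    apply: (@measurableT_comp _ _ _ _ _ _ (fun x : measurableTypeR R => (\1_E x : R)%:E)) => //.
    exact: measurable_indic_EFin.
  pose E' : set (measurableTypeR R) := [set s | E (x + (y + s))].
  have mE' : measurable E' by rewrite -[X in measurable X]setTI; exact: mxy.
  have nE' : nu0 E' = 0%E.
    apply: nu0_ac => //.
    rewrite (_ : E' = (fun s => (x + y) + s) @^-1` E) ?lebesgue_translate0//.
    by apply/funext => s; rewrite /E'/= addrA.
  transitivity (\int[nu0]_(s in E') (1 - tilt t s)%:E)%E; last first.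
    apply: null_set_integral => //.
    by apply: measurable_funTS; apply/measurable_EFinP; exact: measurable_onem_tilt.
  by rewrite -[RHS]integral_indicM; apply: eq_integral => s _; rewrite !indicE.
rewrite UE//; last exact: measurable_indic_EFin.
rewrite -VE//; apply: ge0_le_integral => //.
- apply: emeasurable_funM; first exact: measurable_indic_EFin.
  exact: measurable_EFin_expRNM.
- exact: measurable_EFin_expRNM.
- move=> x _; rewrite -EFinM lee_fin ler_piMl ?expR_ge0//.
Qed.

Lemma potential_ac (E : set (measurableTypeR R)) : measurable E ->
  lebesgue_measure E = 0%E -> V E = 0%E.
Proof.
move=> mE E0; have Vfin : V E \is a fin_num by exact: fin_num_measure.
apply/eqP; rewrite eq_le measure_ge0 andbT -(fineK Vfin) lee_fin leNgt.
apply/negP => VE0.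
(* Some n satisfies f(n + 1) >= 1 / V(E), which contradicts the bound on V(E) at t = n + 1. *)
have /cvgeyPge/(_ (fine (V E))^-1)[n _ /(_ n (leqnn n))/=] :=
  cvg_levy_exponent nu0_pos fE nu0_infty.
rewrite lee_fin => fge.
have := potential_le_exponent mE E0 (ltr0Sn R n).
rewrite -(fineK Vfin) lee_fin leNgt => /negP; apply.
rewrite invf_plt ?posrE ?killed_exponent_gt0//.
by rewrite (le_lt_trans fge)// ltrDr.
Qed.

(** On s > 0 this is the density with Laplace transform (lambda + f(r)) / r, the reciprocal of that
    of [V] up to the factor 1 / r. The value 0 for s <= 0 turns an integral over y < t of
    [killed_tail (t - y)] into one over the whole line. *)
Definition killed_tail (s : R) : R :=
  if 0 < s then lambda + fine (nu0 `]s, +oo[%classic) else 0.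

(** Markov's inequality: 1 - e^(-y) is at least 1 - e^(-s) for y > s, and its integral is f(1). *)
Lemma levy_tail_lty s : 0 < s -> (nu0 `]s, +oo[%classic < +oo)%E.
Proof.
move=> s0; have c0 : 0 < 1 - expR (- s) by rewrite subr_gt0 -expR0 ltr_expR oppr_lt0.
suff : ((1 - expR (- s))%:E * nu0 `]s, +oo[%classic <= (f 1)%:E)%E.
  move=> H; rewrite ltey; apply/eqP => nuy; move: H; rewrite nuy.
  by rewrite mulry gtr0_sg// mul1e leye_eq.
rewrite -fE// -integral_cst//; apply: (@le_trans _ _
  (\int[nu0]_(y in `]s, +oo[) (1 - tilt 1 y)%:E)%E).
  apply: ge0_le_integral => //.
  - by move=> x _; rewrite lee_fin ltW.
  - by apply: measurable_funTS; apply/measurable_EFinP; exact: measurable_onem_tilt.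
  - move=> y; rewrite /= in_itv/= andbT => sy.
    by rewrite lee_fin lerD2l lerN2 tilt_pos ?mul1r ?ler_expR ?lerN2 ltW// (lt_trans s0).
apply: ge0_subset_integral => //.
- by apply/measurable_EFinP; exact: measurable_onem_tilt.
- by move=> y _; rewrite lee_fin subr_ge0; exact: tilt_le1.
Qed.

Lemma killed_tail_ge0 s : 0 <= killed_tail s.
Proof.
by rewrite /killed_tail; case: ifPn => // s0; rewrite addr_ge0 ?fine_ge0// ltW.
Qed.

Lemma killed_tailE s : 0 < s ->
  ((killed_tail s)%:E = lambda%:E + nu0 `]s, +oo[%classic)%E.
Proof.
by move=> s0; rewrite /killed_tail s0 EFinD fineK// ge0_fin_numE// levy_tail_lty.
Qed.

Let lt_pos : set (measurableTypeR R * measurableTypeR R) :=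
  [set z | `]0, +oo[%classic z.1 /\ `]0, +oo[%classic (z.2 - z.1)].

Let measurable_lt_pos : measurable lt_pos.
Proof.
apply: measurableI.
- rewrite -[X in measurable X]setTI; apply: measurable_fst => //.
- rewrite -[X in measurable X]setTI.
  have m : measurable_fun setT (fun z : measurableTypeR R * measurableTypeR R => z.2 - z.1 : measurableTypeR R).
    exact: measurable_funB.
  exact: m.
Qed.

Let lt_posE s y : ((s, y) \in lt_pos) = (0 < s) && (s < y).
Proof.
apply/idP/idP; rewrite inE /lt_pos /= !in_itv/= !andbT subr_gt0.
  by move=> [-> ->].
by move/andP.
Qed.

(** Set up for Tonelli: integrating over y first produces the tail, over s first produces (1 - e^(-r
    y)) / r. The case r = 0 serves for the measurability of the tail. *)
Let F r (z : measurableTypeR R * measurableTypeR R) : \bar R :=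
  ((expR (- (r * z.1)))%:E * (\1_lt_pos z)%:E)%E.

Let F_ge0 r z : (0 <= F r z)%E.
Proof. by rewrite /F mule_ge0// lee_fin expR_ge0. Qed.

Let measurable_F r : measurable_fun setT (F r).
Proof.
apply: emeasurable_funM; last by apply/measurable_EFinP; exact: measurable_indic.
apply: (@measurableT_comp _ _ _ _ _ _ (fun x : measurableTypeR R => (expR (- (r * x)))%:E)) => //.
exact: measurable_EFin_expRNM.
Qed.

Let int_F1 r s : (\int[nu0]_y F r (s, y) =
  if (0 < s)%R then (expR (- (r * s)))%:E * nu0 `]s, +oo[%classic else 0)%E.
Proof.
case: ifPn => s0; last first.
  apply: integral0_eq => y _; rewrite /F indicE lt_posE (negbTE s0)/=.
  by rewrite mule0.
rewrite /F/= ge0_integralZl_EFin//; last first.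
  by apply/measurable_EFinP; apply: measurableT_comp; [exact: measurable_indic|exact: measurable_pair1].
congr (_ * _)%E; rewrite -integral_indicE//; apply: eq_integral => y _.
by rewrite !indicE lt_posE s0/= mem_setE in_itv/= andbT.
Qed.

Let int_F2 r y : 0 < r -> (\int[lebesgue_measure]_s F r (s, y) =
  (r^-1)%:E * (1 - tilt r y)%:E)%E.
Proof.
move=> r0; have [y0|y0] := ltP 0 y; last first.
  rewrite integral0_eq; first by rewrite /tilt max_r// mulr0 oppr0 expR0 subrr mule0.
  move=> s _; rewrite /F indicE lt_posE.
  case: (ltP 0 s) => //= s0; last by rewrite mule0.
  by rewrite ltNge (le_trans y0 (ltW s0)) mule0.
rewrite tilt_pos ?(ltW y0)// -EFinM mulrC -integral_expRNM_itv0o//.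
rewrite [RHS]integral_mkcond; apply: eq_integral => s _.
rewrite patchE /F indicE lt_posE mem_setE in_itv/=.
by case: ifPn => _; rewrite ?mule1 ?mule0.
Qed.

Lemma measurable_killed_tail :
  measurable_fun setT (killed_tail : measurableTypeR R -> R).
Proof.
have m : measurable_fun setT (fun s => \int[nu0]_y F 0 (s, y))%E.
  exact: (@measurable_fun_integral_pair _ nu0 (F 0)).
rewrite (_ : killed_tail = fun s : measurableTypeR R =>
  lambda * \1_(`]0, +oo[%classic : set R) s + fine (\int[nu0]_y F 0 (s, y))%E).
  apply: measurable_funD.
    by apply: measurable_funM => //; exact: measurable_indic.
  exact: (measurableT_comp (fine_measurable measurableT) m).
apply/funext => s; rewrite int_F1 /killed_tail indicE mem_setE in_itv/= andbT.
by case: ifPn => s0; rewrite ?mulr1 ?mulr0 ?addr0// mul0r oppr0 expR0 mul1e.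
Qed.

Lemma laplace_killed_tail r : 0 < r ->
  (\int[lebesgue_measure]_s ((expR (- (r * s)))%:E * (killed_tail s)%:E) =
   ((lambda + f r) / r)%:E)%E.
Proof.
move=> r0.
rewrite (_ : (fun s => _) = (fun s : measurableTypeR R =>
  lambda%:E * ((expR (- (r * s)))%:E * (\1_(`]0, +oo[%classic : set R) s)%:E) +
  \int[nu0]_y F r (s, y))%E); last first.
  apply/funext => s; rewrite int_F1 indicE mem_setE in_itv/= andbT.
  have [s0|s0] := ltP 0 s; last first.
    by rewrite /killed_tail ltNge s0/= !mule0 adde0.
  by rewrite killed_tailE// mule1 muleDr// muleC.
have m1 : measurable_fun setT (fun s : measurableTypeR R =>
    (expR (- (r * s)))%:E * (\1_(`]0, +oo[%classic : set R) s)%:E)%E.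
  apply: emeasurable_funM; first exact: measurable_EFin_expRNM.
  by apply/measurable_EFinP; exact: measurable_indic.
have p1 s : (0 <= (expR (- (r * s)))%:E * (\1_(`]0%R, +oo[%classic : set R) s)%:E)%E.
  by rewrite mule_ge0// lee_fin expR_ge0.
rewrite ge0_integralD//; last 4 first.
- by move=> s _; rewrite mule_ge0// lee_fin ltW.
- by apply: emeasurable_funM.
- by move=> s _; apply: integral_ge0.
- exact: (@measurable_fun_integral_pair _ nu0 (F r)).
rewrite ge0_integralZl_EFin// ?(ltW lambda_gt0)//.
rewrite (_ : \int[lebesgue_measure]_s _ = (r^-1)%:E)%E; last first.
  rewrite -(integral_expRNM_itv0y r0) [RHS]integral_mkcond.
  apply: eq_integral => s _; rewrite patchE indicE.
  by case: ifPn => _; rewrite ?mule1 ?mule0.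
rewrite (@fubini_tonelli _ _ (measurableTypeR R) (measurableTypeR R) R
  lebesgue_measure nu0 (F r))//.
under eq_integral do rewrite int_F2//.
rewrite ge0_integralZl_EFin//; last 3 first.
- by move=> s _; rewrite lee_fin subr_ge0; apply: tilt_le1; exact: ltW.
- by apply/measurable_EFinP; exact: measurable_onem_tilt.
- by rewrite invr_ge0 ltW.
by rewrite fE// -!EFinM -EFinD mulrDl [X in _ + X]mulrC.
Qed.

(** The transform 1 / (lambda + f(r)) of [V] times (lambda + f(r)) / r is 1 / r, that of Lebesgue
    measure on the positive axis. This is the renewal identity as an equality of measures, hence
    only almost everywhere in t; both measures are infinite. *)
Lemma lebesgue_killed_tail (phi : R -> \bar R) : measurable_fun setT phi ->
  (forall x, 0 <= phi x)%E ->
  (\int[V]_y \int[lebesgue_measure]_s (phi (y + s)%R * (killed_tail s)%:E) =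
   \int[lebesgue_measure]_(z in `]0%R, +oo[) phi z)%E.
Proof.
pose w (z : measurableTypeR R * measurableTypeR R) := killed_tail z.2.
have mw : measurable_fun setT w.
  by apply: measurableT_comp; [exact: measurable_killed_tail|exact: measurable_snd].
have w0 z : 0 <= w z by exact: killed_tail_ge0.
have mT : measurable_fun setT
    (fun z : measurableTypeR R * measurableTypeR R => z.1 + z.2 : measurableTypeR R).
  exact: measurable_funD.
pose A := weighted_image (V \x @lebesgue_measure R)%E mw w0 mT.
have mi : measurable_fun setT (\1_(`]0, +oo[%classic : set (measurableTypeR R)) : _ -> R).
  exact: measurable_indic.
have i0 x : 0 <= (\1_(`]0, +oo[%classic : set (measurableTypeR R)) x : R) by [].
pose B := weighted_image (@lebesgue_measure R) mi i0 (@measurable_id _ _ _).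
have AE (psi : R -> \bar R) : measurable_fun setT psi -> (forall x, 0 <= psi x)%E ->
    (\int[A]_x psi x = \int[V]_y \int[lebesgue_measure]_s (psi (y + s)%R * (killed_tail s)%:E))%E.
  move=> mpsi psi0; rewrite /A ge0_integral_weighted_image//.
  rewrite (@fubini_tonelli1 _ _ (measurableTypeR R) (measurableTypeR R) R V
    lebesgue_measure (fun z => psi (z.1 + z.2)%R * (w z)%:E)%E)//.
  - apply: emeasurable_funM; first exact: measurableT_comp.
    exact/measurable_EFinP.
  - by move=> z; rewrite mule_ge0// lee_fin.
have BE (psi : R -> \bar R) : measurable_fun setT psi -> (forall x, 0 <= psi x)%E ->
    (\int[B]_x psi x = \int[lebesgue_measure]_(z in `]0%R, +oo[) psi z)%E.
  move=> mpsi psi0; rewrite /B ge0_integral_weighted_image//.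
  rewrite [RHS]integral_mkcond; apply: eq_integral => s _.
  by rewrite patchE indicE; case: ifPn => _; rewrite ?mule1 ?mule0.
have Alap r : 0 < r -> laplace A r = (r^-1)%:E.
  move=> r0; rewrite /laplace AE//; last exact: measurable_EFin_expRNM.
  under eq_integral => y _.
    under eq_integral do rewrite mulrDr opprD expRD EFinM -muleA.
    rewrite ge0_integralZl_EFin ?expR_ge0//; last 2 first.
    - by move=> s _; rewrite mule_ge0 ?lee_fin ?expR_ge0 ?killed_tail_ge0.
    - apply: emeasurable_funM; first exact: measurable_EFin_expRNM.
      by apply/measurable_EFinP; exact: measurable_killed_tail.
    rewrite laplace_killed_tail//.
    over.
  have k0 := killed_exponent_gt0 r0.
  rewrite ge0_integralZr//; last 2 first.
  - exact: measurable_EFin_expRNM.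
  - by rewrite lee_fin divr_ge0// ltW.
  by rewrite -/(laplace V r) VE// -EFinM mulrA mulVf ?gt_eqF// mul1r.
have Blap r : 0 < r -> laplace B r = (r^-1)%:E.
  move=> r0; rewrite /laplace BE ?integral_expRNM_itv0y//.
  exact: measurable_EFin_expRNM.
have mneg : measurable_fun setT (fun x : measurableTypeR R =>
    (\1_(`]-oo, 0%R[%classic : set R) x : R)%:E).
  exact: measurable_indic_EFin.
have AB : forall E, measurable E -> A E = B E.
  apply: laplace_inj.
  - rewrite -integral_indicE// (AE (fun x => (\1_(`]-oo, 0%R[%classic : set R) x)%:E))//.
    rewrite (integral_itv0y V_pos); last 2 first.
    + apply: (@measurable_fun_integral_pair _ lebesgue_measure
        (fun z => (\1_(`]-oo, 0%R[%classic : set R) (z.1 + z.2)%R)%:E * (w z)%:E)%E).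
        apply: emeasurable_funM; last exact/measurable_EFinP.
        exact: (measurableT_comp mneg mT).
      by move=> z; rewrite mule_ge0// lee_fin.
    + move=> y; apply: integral_ge0 => s _.
      by rewrite mule_ge0 ?lee_fin ?killed_tail_ge0.
    rewrite integral0_eq// => y; rewrite /= in_itv/= andbT => y0.
    rewrite integral0_eq// => s _; have [s0|s0] := ltP 0 s; last first.
      by rewrite /killed_tail ltNge s0/= mule0.
    by rewrite indicE memNset ?mul0e//= in_itv/= ltNge addr_ge0// ltW.
  - rewrite -integral_indicE// (BE (fun x => (\1_(`]-oo, 0%R[%classic : set R) x)%:E))//.
    rewrite integral0_eq// => y; rewrite /= in_itv/= andbT => y0.
    by rewrite indicE memNset//= in_itv/= ltNge ltW.
  - by move=> r r0; rewrite Alap// ltry.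
  - by move=> r r0; rewrite Alap// Blap.
by move=> mphi phi0; rewrite -BE// -AE// (measure_eq_integral AB).
Qed.

Lemma killed_tail_nonincreasing a b : 0 < a -> a <= b -> killed_tail b <= killed_tail a.
Proof.
move=> a0 ab; rewrite -lee_fin !killed_tailE ?(lt_le_trans a0)//.
rewrite leeD2l// le_measure ?inE//.
by apply: subset_itvr; rewrite bnd_simp.
Qed.

(** Right-continuity, because the half-lines starting at s + 1 / (n + 1) increase to the open
    half-line starting at s. *)
Lemma cvg_killed_tail s : 0 < s ->
  (killed_tail (s + n.+1%:R^-1))%:E @[n --> \oo] --> (killed_tail s)%:E.
Proof.
move=> s0; rewrite killed_tailE//.
have sn0 n : 0 < s + n.+1%:R^-1 by rewrite addr_gt0.
rewrite (_ : (fun n => _) = (fun n => lambda%:E + nu0 `](s + n.+1%:R^-1)%R, +oo[%classic)%E); last first.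
  by apply/funext => n; rewrite killed_tailE.
apply: cvgeD.
- by rewrite fin_num_adde_defr.
- exact: cvg_cst.
have -> : `]s, +oo[%classic = \bigcup_n `](s + n.+1%:R^-1)%R, +oo[%classic.
  apply/seteqP; split => y /=.
    rewrite in_itv/= andbT -subr_gt0 => sy.
    have [n yn] : exists n, n.+1%:R^-1 < y - s.
      have [n _ /(_ n (leqnn n))/=] := near_infty_natSinv_lt (PosNum sy).
      by exists n.
    by exists n => //=; rewrite in_itv/= andbT -ltrBrDl.
  move=> [n _ /=]; rewrite !in_itv/= !andbT; apply: lt_trans.
  by rewrite ltrDl.
apply: nondecreasing_cvg_mu => //.
  by apply: bigcupT_measurable => n.
move=> m n mn; apply/subsetPset; apply: subset_itvr.
by rewrite bnd_simp lerD2l lef_pV2 ?posrE// ler_nat ltnS.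
Qed.

Let mkt c : measurable_fun setT (fun y : measurableTypeR R => (killed_tail (c - y))%:E).
Proof.
apply: (@measurableT_comp _ _ _ _ _ _ (fun s : measurableTypeR R => (killed_tail s)%:E)).
  by apply/measurable_EFinP; exact: measurable_killed_tail.
exact: measurable_funB.
Qed.

Let kt0 s : (0 <= (killed_tail s)%:E)%E.
Proof. by rewrite lee_fin killed_tail_ge0. Qed.

(* By [lebesgue_killed_tail] the level ]t, t + h] has mass h, and it is at least h times
   this integral since the tail is nonincreasing. *)
Lemma killed_renewal_shift t h : 0 < t -> 0 < h ->
  (\int[V]_(y in `]-oo, t[) (killed_tail (t + h - y))%:E <= 1)%E.
Proof.
move=> t0 h0.
have mi : measurable_fun setT (fun x : measurableTypeR R => (\1_(`]t, (t + h)%R]%classic : set R) x : R)%:E).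
  exact: measurable_indic_EFin.
have i0 x : (0 <= (\1_(`]t, (t + h)%R]%classic : set R) x : R)%:E)%E by [].
have := lebesgue_killed_tail mi i0.
rewrite (_ : \int[lebesgue_measure]_(z in _) _ = h%:E)%E; last first.
  rewrite integral_indic//= setIidl.
    by rewrite lebesgue_measure_itv/= lte_fin ltrDl h0 -EFinB addrAC subrr add0r.
  by apply: subset_itv; rewrite bnd_simp// ltW.
move=> H.
suff : (h%:E * \int[V]_(y in `]-oo, t[) (killed_tail (t + h - y))%:E <= h%:E * 1)%E.
  by rewrite lee_pmul2l// fin_numE.
rewrite mule1 -[leRHS]H -ge0_integralZl_EFin//; last 2 first.
- exact: measurable_funTS.
- exact: ltW.
rewrite integral_mkcond; apply: ge0_le_integral => //.
- by move=> y _; apply: erestrict_ge0 => z _; rewrite mule_ge0// lee_fin ltW.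
- apply/(measurable_restrictT _ _).1 => //; apply: measurable_funTS.
  exact: emeasurable_funM.
- apply: (@measurable_fun_integral_pair _ lebesgue_measure (fun z =>
    (\1_(`]t, (t + h)%R]%classic : set R) (z.1 + z.2)%R : R)%:E * (killed_tail z.2)%:E)%E).
    apply: emeasurable_funM.
      by apply: (measurableT_comp mi); exact: measurable_funD.
    apply: (@measurableT_comp _ _ _ _ _ _ (fun s : measurableTypeR R => (killed_tail s)%:E)) => //.
    by apply/measurable_EFinP; exact: measurable_killed_tail.
  by move=> z; rewrite mule_ge0.
move=> y _; rewrite patchE; case: ifPn => [|_]; last first.
  by apply: integral_ge0 => s _; rewrite mule_ge0.
rewrite inE/= in_itv/= => yt.
have ty0 : 0 < t - y by rewrite subr_gt0.
apply: (@le_trans _ _ (\int[lebesgue_measure]_(s in `](t - y)%R, (t + h - y)%R])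
    (killed_tail (t + h - y))%:E)%E).
  have L : lebesgue_measure `](t - y)%R, (t + h - y)%R]%classic = h%:E.
    rewrite lebesgue_measure_itv/= lte_fin ltrD2r ltrDl h0 -EFinB.
    by congr EFin; ring.
  by rewrite integral_cst// [X in (_ <= _ * X)%E](_ : _ = h%:E)%E// muleC.
rewrite integral_mkcond; apply: ge0_le_integral => //.
- by move=> s _; apply: erestrict_ge0.
- by apply/(measurable_restrictT _ _).1.
- apply: emeasurable_funM; last by apply/measurable_EFinP; exact: measurable_killed_tail.
  by apply: (measurableT_comp mi); exact: measurable_funD.
move=> s _; rewrite patchE; case: ifPn => [|_]; last by rewrite mule_ge0.
rewrite inE/= in_itv/= => /andP[s1 s2].
rewrite indicE mem_set/=; last by rewrite in_itv/=; apply/andP; split; lra.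
by rewrite mul1e lee_fin; apply: killed_tail_nonincreasing => //; lra.
Qed.

(** Take h = 1 / (n + 1) in [killed_renewal_shift]; the shifted tails increase to the tail itself,
    so monotone convergence preserves the bound at every t. *)
Lemma killed_renewal_le1 t : 0 < t -> (\int[V]_y (killed_tail (t - y))%:E <= 1)%E.
Proof.
move=> t0.
rewrite (_ : \int[V]_y _ = \int[V]_(y in `]-oo, t[)
    limn (fun n => (killed_tail (t + n.+1%:R^-1 - y))%:E))%E; last first.
  rewrite [RHS]integral_mkcond; apply: eq_integral => y _.
  rewrite patchE; case: ifPn; rewrite mem_setE in_itv/=.
    rewrite -subr_gt0 => yt; apply/esym/cvg_lim => //.
    under eq_fun do rewrite addrAC.
    exact: cvg_killed_tail.
  by rewrite -subr_gt0 /killed_tail => /negbTE ->.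
rewrite monotone_convergence//; last 2 first.
- by move=> n; exact: measurable_funTS.
- move=> y; rewrite /= in_itv/= => yt m n mn; rewrite lee_fin.
  have n0 : 0 < n.+1%:R^-1 :> R by rewrite invr_gt0.
  have mn' : n.+1%:R^-1 <= m.+1%:R^-1 :> R by rewrite lef_pV2 ?posrE// ler_nat ltnS.
  move: n.+1%:R^-1 m.+1%:R^-1 n0 mn' => a b a0 ab.
    apply: killed_tail_nonincreasing; last by rewrite lerD2r lerD2l.
    by rewrite subr_gt0 (lt_le_trans yt)// lerDl ltW.
apply: lime_le.
  apply: ereal_nondecreasing_is_cvgn => m n mn; apply: ge0_le_integral => //.
  - exact: measurable_funTS.
  - exact: measurable_funTS.
  - move=> y; rewrite /= in_itv/= => yt; rewrite lee_fin.
    have n0 : 0 < n.+1%:R^-1 :> R by rewrite invr_gt0.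
    have mn' : n.+1%:R^-1 <= m.+1%:R^-1 :> R by rewrite lef_pV2 ?posrE// ler_nat ltnS.
    move: n.+1%:R^-1 m.+1%:R^-1 n0 mn' => a b a0 ab.
    apply: killed_tail_nonincreasing; last by rewrite lerD2r lerD2l.
    by rewrite subr_gt0 (lt_le_trans yt)// lerDl ltW.
by apply: nearW => n; apply: killed_renewal_shift => //; rewrite invr_gt0.
Qed.

(** With b the density of [beta], reflecting s turns the left side into the integral of b(c - (y +
    s)) against the tail and [V], and [lebesgue_killed_tail] applied to b(c - z) evaluates it. No
    exceptional null set of c appears. *)
Lemma killed_renewal_density (beta : {finite_measure set (measurableTypeR R) -> \bar R}) c :
  (forall E, measurable E -> lebesgue_measure E = 0 -> beta E = 0)%E ->
  (\int[V]_y \int[beta]_s (killed_tail (c - (y + s)))%:E = beta `]-oo, c[%classic)%E.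
Proof.
move=> beta_ac.
have dom : beta `<< @lebesgue_measure R.
  by apply/null_content_dominatesP => E mE; exact: beta_ac.
pose b := Radon_Nikodym_SigmaFinite.f beta (@lebesgue_measure R).
have b0 x : (0 <= b x)%E by exact: Radon_Nikodym_SigmaFinite.f_ge0.
have mb : measurable_fun setT (b : measurableTypeR R -> _).
  exact: measurable_int (Radon_Nikodym_SigmaFinite.f_integrable dom).
have bE (phi : measurableTypeR R -> \bar R) : measurable_fun setT phi -> (forall x, 0 <= phi x)%E ->
    (\int[beta]_s phi s = \int[lebesgue_measure]_s (phi s * b s))%E.
  by move=> mphi phi0; rewrite -(Radon_Nikodym_SigmaFinite.change_of_variables dom).
have mbc : measurable_fun setT (fun z : measurableTypeR R => b (c - z)).
  by apply: (measurableT_comp mb); exact: measurable_funB.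
transitivity (\int[V]_y \int[lebesgue_measure]_s (b (c - (y + s))%R * (killed_tail s)%:E))%E.
  apply: eq_integral => y _; rewrite bE; last 2 first.
  - under eq_fun do rewrite opprD addrA.
    exact: mkt.
  - by move=> s; exact: kt0.
  rewrite -(@ge0_integral_lebesgue_reflect _ (c - y)
      (fun s => b (c - (y + s))%R * (killed_tail s)%:E)%E); last 2 first.
  - apply: emeasurable_funM; last by apply/measurable_EFinP; exact: measurable_killed_tail.
    by apply: (measurableT_comp mbc); exact: measurable_funD.
  - by move=> x; rewrite mule_ge0.
  apply: eq_integral => s _; rewrite muleC; congr (b _ * (killed_tail _)%:E)%E; ring.
rewrite (lebesgue_killed_tail mbc)//.
rewrite integral_mkcond -(@ge0_integral_lebesgue_reflect _ c); last 2 first.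
- by apply/(measurable_restrictT _ _).1 => //; exact: measurable_funTS.
- by move=> x; apply: erestrict_ge0.
rewrite -integral_indicE// bE//; last exact: measurable_indic_EFin.
apply: eq_integral => s _; rewrite patchE indicE !mem_setE !in_itv/= andbT subr_gt0.
by case: ifPn => _; rewrite ?mul1e ?mul0e// subKr.
Qed.

(* Decompose V by the tilt at r, and let r go to infinity afterwards. *)
Lemma killed_renewal_ge t r : 0 < t -> 0 < r ->
  (1 <= \int[V]_y (killed_tail (t - y))%:E +
       (lambda + f r)%:E * ((expR (- (r * t)))%:E * V setT))%E.
Proof.
move=> t0 r0; have [U [beta [UE betaE decomp]]] := tilted_decomposition r0.
have beta_ac E : measurable E -> lebesgue_measure E = 0%E -> beta E = 0%E.
  move=> mE E0; rewrite -integral_indicE// betaE//; last exact: measurable_indic_EFin.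
  rewrite integral_indicM; apply: null_set_integral => //; last exact: nu0_ac.
  by apply: measurable_funTS; apply/measurable_EFinP; exact: measurable_onem_tilt.
have betaT : beta setT = (f r)%:E.
  rewrite -fE// -integral_indicE// betaE//; last exact: measurable_indic_EFin.
  by apply: eq_integral => s _; rewrite indicT mul1e.
have UT : ((lambda + f r)%:E * U setT = 1)%E.
  have UTE : U setT = laplace V r.
    rewrite -integral_indicE// UE//; last exact: measurable_indic_EFin.
    by apply: eq_integral => s _; rewrite indicT mul1e.
  by rewrite UTE VE// -EFinM divff// gt_eqF// killed_exponent_gt0.
have nu0_closed s : nu0 `[s, +oo[%classic = nu0 `]s, +oo[%classic.
  have -> : `[s, +oo[%classic = [set s] `|` `]s, +oo[%classic.
    apply/seteqP; split => z /=; rewrite !in_itv/= !andbT le_eqVlt.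
      by move=> /orP[/eqP ->|sz]; [left|right].
    by move=> [->|->]; rewrite ?eqxx ?orbT.
  rewrite measureU//; last first.
    by apply/seteqP; split => // z [/= ->]; rewrite in_itv/= ltxx.
  by rewrite [X in (X + _)%E]nu0_ac ?add0e// lebesgue_measure_set1.
(* The tail at t - x dominates the mass of [beta] on [t - x, +oo[, because 1 - e^(-r s) <= 1;
   [nu0_closed] takes care of the endpoint. Adding the rest of [beta] gives its total mass f(r). *)
have lower x : x < t -> ((lambda + f r)%:E <=
    (killed_tail (t - x))%:E + beta `]-oo, (t - x)%R[%classic)%E.
  rewrite -subr_gt0 => xt; rewrite EFinD -betaT killed_tailE// -addeA leeD2l//.
  rewrite -(setUv `]-oo, (t - x)%R[%classic) measureU//; last 2 first.
  - exact: measurableC.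
  - by rewrite setICr.
  rewrite [leRHS]addeC; apply: leeD => //.
  rewrite setCitvl -nu0_closed -[leLHS]integral_indicE// betaE//; last first.
    exact: measurable_indic_EFin.
  rewrite -[leRHS]integral_indicE//; apply: ge0_le_integral => //.
  - by move=> s _; rewrite mule_ge0// lee_fin subr_ge0 tilt_le1// ltW.
  - apply: emeasurable_funM; first exact: measurable_indic_EFin.
    by apply/measurable_EFinP; exact: measurable_onem_tilt.
  - exact: measurable_indic_EFin.
  - move=> s _; rewrite -EFinM lee_fin ler_piMr//.
    by rewrite gerBl tilt_ge0.
have Uge : (U `[t, +oo[%classic <= (expR (- (r * t)))%:E * V setT)%E.
  rewrite -[leLHS]integral_indicE// UE//; last exact: measurable_indic_EFin.
  rewrite integral_indicM -integral_cst//.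
  apply: (@le_trans _ _ (\int[V]_(x in `[t, +oo[) (expR (- (r * t)))%:E)%E).
    apply: ge0_le_integral => //.
    - by apply: measurable_funTS; exact: measurable_EFin_expRNM.
    - move=> x; rewrite /= in_itv/= andbT => tx.
      by rewrite lee_fin ler_expR lerN2 ler_wpM2l// ltW.
  exact: ge0_subset_integral.
have mbeta : measurable_fun setT (fun x : measurableTypeR R => beta `]-oo, (t - x)%R[%classic).
  rewrite (_ : (fun x => _) = (fun x : measurableTypeR R =>
      \int[beta]_s (\1_(`]-oo, t[%classic : set R) (x + s)%R)%:E)%E).
    apply: (@measurable_fun_integral_pair _ beta (fun z : measurableTypeR R * measurableTypeR R =>
      (\1_(`]-oo, t[%classic : set R) (z.1 + z.2)%R)%:E)) => //.
    have mi : measurable_fun setT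
        (fun z : measurableTypeR R => (\1_(`]-oo, t[%classic : set R) z : R)%:E).
      exact: measurable_indic_EFin.
    by apply: (measurableT_comp mi); exact: measurable_funD.
  apply/funext => x; rewrite -integral_indicE//; apply: eq_integral => s _.
  by rewrite !indicE !mem_setE !in_itv/= ltrBrDl.
(* The term of the decomposition that involves U, V and [beta] is evaluated by
   [killed_renewal_density] at c = t - x. *)
have -> : (\int[V]_y (killed_tail (t - y))%:E = \int[U]_x
    ((killed_tail (t - x))%:E + beta `]-oo, (t - x)%R[%classic))%E.
  rewrite (decomp (fun y => (killed_tail (t - y))%:E))//; last exact: mkt.
  rewrite [RHS](@ge0_integralD _ _ _ U setT measurableT
    (fun x : measurableTypeR R => (killed_tail (t - x))%:E)
    (fun x : measurableTypeR R => beta `]-oo, (t - x)%R[%classic))//.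
  congr (_ + _)%E; apply: eq_integral => x _.
  rewrite -(killed_renewal_density _ beta_ac); apply: eq_integral => y _.
  by apply: eq_integral => s _; rewrite opprD addrA.
have c0 : (0 <= (lambda + f r)%:E)%E by rewrite lee_fin ltW// killed_exponent_gt0.
have UTE : U setT = (U `]-oo, t[%classic + U `[t, +oo[%classic)%E.
  rewrite -(setUv `]-oo, t[%classic) measureU//; last 2 first.
  - exact: measurableC.
  - by rewrite setICr.
  by rewrite setCitvl.
(* The total 1 = (lambda + f(r)) U(R) is split at t: below t the factor is bounded by [lower],
   beyond t the tilt leaves at most e^(-r t) V(R). *)
rewrite -[leLHS]UT UTE ge0_muleDr//; apply: leeD; last exact: lee_wpmul2l.
rewrite -integral_cst//.
apply: (@le_trans _ _ (\int[U]_(x in `]-oo, t[)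
    ((killed_tail (t - x))%:E + beta `]-oo, (t - x)%R[%classic))%E).
  apply: ge0_le_integral => //.
  - by apply: measurable_funTS; exact: emeasurable_funD.
apply: ge0_subset_integral => //; first exact: emeasurable_funD.
by move=> x _; rewrite adde_ge0.
Qed.

Lemma killed_renewal_eq1 t : 0 < t -> (\int[V]_y (killed_tail (t - y))%:E = 1)%E.
Proof.
move=> t0; apply/eqP; rewrite eq_le killed_renewal_le1//=.
have mfin : (\int[V]_y (killed_tail (t - y))%:E)%E \is a fin_num.
  by rewrite ge0_fin_numE ?integral_ge0// (le_lt_trans (killed_renewal_le1 t0))// ltry.
have Vfin : V setT \is a fin_num by exact: fin_num_measure.
have V0 : 0 <= fine (V setT) by rewrite fine_ge0.
have f10 : 0 <= f 1 by exact: (levy_exponent_ge0 fE).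
(* With N = n + 1, f(N) <= N f(1) and e^(-N t) <= 2 / (N t)^2 bound the error term of
   [killed_renewal_ge] at r = N by K / N. *)
pose K : R := (lambda + f 1) * fine (V setT) * (2 / t ^+ 2).
have mge n : 1 - K * n.+1%:R^-1 <= fine (\int[V]_y (killed_tail (t - y))%:E)%E.
  have := killed_renewal_ge t0 (ltr0Sn R n).
  rewrite -(fineK mfin) -(fineK Vfin) -!EFinM -EFinD lee_fin => /le_trans.
  rewrite lerBlDr; apply; rewrite lerD2l.
  have n0 : 0 < n.+1%:R :> R by rewrite ltr0n.
  have n1 : 1 <= n.+1%:R :> R by rewrite ler1n.
  have fn := levy_exponent_nat fE n.
  have en : expR (- (n.+1%:R * t)) <= (n.+1%:R * (n.+1%:R * t ^+ 2 / 2))^-1.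
    rewrite expRN lef_pV2 ?posrE ?expR_gt0//; last first.
      by rewrite mulr_gt0// divr_gt0// mulr_gt0// exprn_gt0.
    have /(expR_ge1Dxn 1) : 0 <= n.+1%:R * t by rewrite mulr_ge0// ltW.
    apply: le_trans; rewrite (_ : 2`! = 2%N)// exprMn expr2 -!mulrA.
    by rewrite lerDr.
  have e0 : 0 <= expR (- (n.+1%:R * t)) by exact: expR_ge0.
  rewrite mulrA [leRHS](_ : _ = (lambda + f 1) * n.+1%:R *
      (n.+1%:R * (n.+1%:R * t ^+ 2 / 2))^-1 * fine (V setT)); last first.
    by rewrite /K; field; rewrite addrC natr1 !gt_eqF.
  apply: ler_wpM2r => //; apply: ler_pM => //.
    by rewrite addr_ge0 ?(ltW lambda_gt0)// (levy_exponent_ge0 fE).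
  rewrite mulrDl; apply: lerD; last by rewrite mulrC.
  by rewrite ler_peMr// ltW.
rewrite -(fineK mfin) lee_fin.
have : (1 - K * n.+1%:R^-1) @[n --> \oo] --> 1 - K * 0.
  by apply: cvgB; [exact: cvg_cst|apply: cvgMl_tmp; exact: cvg_harmonic].
rewrite mulr0 subr0 => c1; rewrite -(cvg_lim _ c1)//.
apply: limr_le; first by apply/cvg_ex; exists 1.
exact: nearW.
Qed.

End potential.

(** * Potentials weighted by Poisson probabilities: recursion, renewal identities, densities *)

Section poisson_potentials.
Context {R : realType}.
Variables (nu0 : {sigma_finite_measure set (measurableTypeR R) -> \bar R}).
Variables (f : R -> R) (lambda : R).
Hypothesis nu0_pos : nu0 `]-oo, 0%R]%classic = 0%E.
Hypothesis fE : forall r, 0 < r ->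
  (\int[nu0]_s (1 - expR (- (r * Num.max s 0)))%:E = (f r)%:E)%E.
Hypothesis nu0_infty : nu0 setT = +oo%E.
Hypothesis nu0_ac : forall E : set (measurableTypeR R), measurable E ->
  lebesgue_measure E = 0%E -> nu0 E = 0%E.
Hypothesis lambda_gt0 : 0 < lambda.
Variable W : nat -> {finite_measure set (measurableTypeR R) -> \bar R}.
Hypothesis W_pos : forall n, W n `]-oo, 0%R[%classic = 0%E.
Hypothesis WE : forall n r, 0 < r ->
  laplace (W n) r = (lambda ^+ n / (lambda + f r) ^+ n.+1)%:E.

Let W0E r : 0 < r -> laplace (W 0) r = ((lambda + f r)^-1)%:E.
Proof. by move=> r0; rewrite WE// expr0 expr1 div1r. Qed.

Let kt := killed_tail nu0 lambda.

Let mkt c : measurable_fun setT (fun y : measurableTypeR R => (kt (c - y))%:E).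
Proof.
apply: (@measurableT_comp _ _ _ _ _ _ (fun s : measurableTypeR R => (kt s)%:E)).
  by apply/measurable_EFinP; exact: measurable_killed_tail.
exact: measurable_funB.
Qed.

Let kt0 s : (0 <= (kt s)%:E)%E.
Proof. by rewrite lee_fin; exact: killed_tail_ge0. Qed.

(** Each step gains a factor lambda / (lambda + f(r)), and 1 / (lambda + f(r)) is the transform of
    [W 0]; [D] below is lambda times the convolution [C]. *)
Lemma poisson_potentialS n (phi : R -> \bar R) : measurable_fun setT phi ->
  (forall x, 0 <= phi x)%E ->
  (\int[W n.+1]_x phi x = lambda%:E * \int[W n]_x \int[W 0]_y phi (x + y)%R)%E.
Proof.
have [C CE] := finite_convolution (W n) (W 0).
have [|D DE] := @finite_weighted_image _ _ _ (measurableTypeR R) R C (cst lambda) idfun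
  (measurable_cst _) (fun=> ltW lambda_gt0) (@measurable_id _ _ _).
  rewrite [X in (X < _)%E](integral_cst C measurableT lambda%:E).
  by rewrite lte_mul_pinfty// ?lee_fin ?(ltW lambda_gt0)// ltey_eq fin_num_measure.
have DE' psi : measurable_fun setT psi -> (forall x, 0 <= psi x)%E ->
    (\int[D]_x psi x = lambda%:E * \int[C]_x psi x)%E.
  move=> mpsi psi0; rewrite DE// -ge0_integralZl_EFin// ?(ltW lambda_gt0)//.
  by apply: eq_integral => x _; rewrite muleC.
have CN : C `]-oo, 0%R[%classic = 0%E by exact: (conv_null CE (W_pos n) (W_pos 0)).
have DN : D `]-oo, 0%R[%classic = 0%E.
  rewrite -integral_indicE// (DE' (fun x => (\1_(`]-oo, 0%R[%classic : set R) x)%:E))//.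
    by rewrite [X in (_ * X)%E](_ : _ = 0%E) ?mule0// -[RHS]CN integral_indicE.
  exact: measurable_indic_EFin.
have WD E : measurable E -> W n.+1 E = D E.
  apply: laplace_inj => [||r r0|r r0]; [exact: W_pos|exact: DN|by rewrite WE// ltry|].
  rewrite [RHS]DE'//; last exact: measurable_EFin_expRNM.
  rewrite -/(laplace C r) (laplace_conv CE); last by rewrite W0E// ltry.
  rewrite !WE// -!EFinM; congr EFin.
  have := killed_exponent_gt0 fE lambda_gt0 r0; move: (lambda + f r) => c c0.
  by rewrite expr0 expr1 (exprS _ n.+1) exprS; field; rewrite expf_neq0 !gt_eqF.
by move=> mphi phi0; rewrite (measure_eq_integral WD) DE'// CE.
Qed.

Lemma poisson_renewal0 t : 0 < t -> (\int[W 0]_y (kt (t - y))%:E = 1)%E.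
Proof. exact: (killed_renewal_eq1 nu0_pos fE nu0_ac lambda_gt0 (W_pos 0) W0E). Qed.

(** By the recursion the inner integral over [W 0] is [poisson_renewal0] at t - x, hence 1 for x <
    t; it is 0 for x >= t since [W 0] lives on the nonnegative axis. *)
Lemma poisson_renewalS n t : 0 < t ->
  (\int[W n.+1]_y (kt (t - y))%:E = lambda%:E * W n `]-oo, t[%classic)%E.
Proof.
move=> t0; rewrite (poisson_potentialS n (mkt t))//; congr (_ * _)%E.
rewrite -integral_indicE//; apply: eq_integral => x _.
under eq_integral do rewrite opprD addrA.
rewrite indicE mem_setE in_itv/= -subr_gt0; case: (ltP 0 (t - x)) => xt.
  exact: poisson_renewal0.
rewrite (integral_itv0y (W_pos 0)) ?integral0_eq//; last exact: mkt.
move=> y; rewrite /= in_itv/= andbT => y0.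
rewrite /kt /killed_tail ifF//; apply/negP; rewrite subr_gt0.
by move=> /(le_lt_trans y0); rewrite ltNge xt.
Qed.

Lemma poisson_potential_ac n (E : set (measurableTypeR R)) : measurable E ->
  lebesgue_measure E = 0%E -> W n E = 0%E.
Proof.
have W0ac E' : measurable E' -> lebesgue_measure E' = 0%E -> W 0 E' = 0%E.
  exact: (potential_ac nu0_pos fE nu0_infty nu0_ac lambda_gt0 (W_pos 0) W0E).
case: n => [|n] mE E0; first exact: W0ac.
rewrite -integral_indicE// (poisson_potentialS n (measurable_indic_EFin mE))//.
rewrite integral0_eq ?mule0// => x _.
have mx : measurable_fun setT (fun s : measurableTypeR R => x + s : measurableTypeR R).
  exact: measurable_funD.
pose E' : set (measurableTypeR R) := [set s | E (x + s)].
have mE' : measurable E' by rewrite -[X in measurable X]setTI; exact: mx.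
transitivity (W 0 E'); last by apply: W0ac => //; exact: lebesgue_translate0.
by rewrite -integral_indicE//; apply: eq_integral => s _; rewrite !indicE.
Qed.

Lemma poisson_potential_density n : exists w : R -> R,
  [/\ forall x, 0 <= w x, (@lebesgue_measure R).-integrable setT (EFin \o w) &
      forall phi : R -> \bar R, measurable_fun setT phi -> (forall x, 0 <= phi x)%E ->
      (\int[W n]_x phi x = \int[lebesgue_measure]_x (phi x * (w x)%:E))%E].
Proof.
have dom : W n `<< @lebesgue_measure R.
  by apply/null_content_dominatesP => E mE; exact: poisson_potential_ac.
pose b := Radon_Nikodym_SigmaFinite.f (W n) (@lebesgue_measure R).
have b0 x : (0 <= b x)%E by exact: Radon_Nikodym_SigmaFinite.f_ge0.
have bfin x : b x \is a fin_num by exact: Radon_Nikodym_SigmaFinite.f_fin_num.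
exists (fine \o b); split.
- by move=> x; rewrite /= fine_ge0.
- rewrite (_ : EFin \o _ = b); first exact: Radon_Nikodym_SigmaFinite.f_integrable.
  by apply/funext => x /=; rewrite fineK.
- move=> phi mphi phi0.
  rewrite -(Radon_Nikodym_SigmaFinite.change_of_variables dom)//.
  by apply: eq_integral => x _ /=; rewrite fineK.
Qed.

End poisson_potentials.

(** * The Lévy measure *)

Lemma exists_grid_cell {R : realType} (a h y : R) n :
  a < y -> y <= a + h * n%:R ->
  exists2 i, (i < n)%N & a + h * i%:R < y <= a + h * i.+1%:R.
Proof.
move=> ay; elim: n => [|n IH]; first by rewrite mulr0 addr0 leNgt ay.
have [yn _|ny yn] := leP y (a + h * n%:R).
  by have [i ni] := IH yn; exists i => //; exact: ltnW.
by exists n => //; rewrite ny.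
Qed.

(* Cover E by an open U of small Lebesgue measure and bound M on the grid cells contained
   in U, which exhaust U as the mesh goes to 0. *)
Lemma abs_cont_null {R : realType} (M : {measure set (measurableTypeR R) -> \bar R})
    (g : R -> R) (a b : R) : a < b ->
  (forall u v, a <= u -> u <= v -> v <= b -> M `]u, v]%classic = (g u - g v)%:E) ->
  abs_cont a b g -> forall E : set (measurableTypeR R), measurable E ->
  lebesgue_measure E = 0%E -> M (E `&` `]a, b]%classic) = 0%E.
Proof.
move=> ab Mg gac E mE E0.
have mA : measurable (E `&` `]a, b]%classic) by exact: measurableI.
apply/eqP; rewrite eq_le measure_ge0 andbT; apply/lee_addgt0Pr => e e0.
rewrite add0e; have [delta delta0 Hdelta] := gac _ e0.
have EltY : (lebesgue_measure E < +oo)%E by rewrite E0 ltry.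
have [U [oU EU Udelta]] := lebesgue_regularity_outer mE EltY delta0.
have mU : measurable U by exact: open_measurable.
have {}Udelta : (lebesgue_measure U < delta%:E)%E.
  rewrite -(setDUK EU) (le_lt_trans (measureU2 _ _ _))//; first exact: measurableD.
  by rewrite [X in (X + _)%E](_ : _ = 0%E) ?add0e//; exact: E0.
pose h N : R := (b - a) / N.+1%:R.
have h0 N : 0 < h N by rewrite divr_gt0// subr_gt0.
pose x N i := a + h N * i%:R.
have x_nd N i j : (i <= j)%N -> x N i <= x N j.
  by move=> ij; rewrite lerD2l (ler_wpM2l (ltW (h0 N)))// ler_nat.
(* A cell that is not inside [U] is collapsed to a point, so that all N + 1 cells can be fed to
   [abs_cont] at once. *)
pose v N i := if `[< `]x N i, x N i.+1]%classic `<=` U >] then x N i.+1 else x N i.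
have xv N i : x N i <= v N i by rewrite /v; case: ifPn => _ //; exact: x_nd.
have vx N i : v N i <= x N i.+1 by rewrite /v; case: ifPn => _ //; exact: x_nd.
pose F N i : set (measurableTypeR R) := `]x N i, v N i]%classic.
have mF N i : measurable (F N i) by exact: measurable_itv.
have FU N i : F N i `<=` U.
  rewrite /F /v; case: ifPn => [/asboolP//|_] z /=.
  by rewrite in_itv/= => /andP[/lt_le_trans/[apply]]; rewrite ltxx.
have tF N : trivIset setT (F N).
  apply/trivIsetP => i j _ _ ij; apply/seteqP; split => // z [].
  rewrite /F/= !in_itv/= => /andP[xiz zvi] /andP[xjz zvj].
  have {ij} [ij|ji] : (i < j)%N \/ (j < i)%N by apply/orP; rewrite -neq_ltn.
    have := le_lt_trans (le_trans zvi (le_trans (vx N i) (x_nd N _ _ ij))) xjz.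
    by rewrite ltxx.
  have := le_lt_trans (le_trans zvj (le_trans (vx N j) (x_nd N _ _ ji))) xiz.
  by rewrite ltxx.
have x0 N : x N 0 = a by rewrite /x mulr0 addr0.
have xN N : x N N.+1 = b by rewrite /x /h divfK ?pnatr_eq0// subrKC.
pose D N := \big[setU/set0]_(i < N.+1) F N i.
have mD N : measurable (D N) by exact: bigsetU_measurable.
have DU N : D N `<=` U.
  by rewrite /D -bigcup_mkord; apply: bigcup_sub => i _; exact: FU.
have MD N : (M (D N) <= e%:E)%E.
  rewrite /D measure_bigsetU//.
  have bounds (i : 'I_N.+1) : a <= x N i /\ x N i <= v N i /\ v N i <= b.
    split; first by rewrite -(x0 N); exact: x_nd.
    by split => //; rewrite (le_trans (vx N i))// -(xN N); apply: x_nd.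
  rewrite (eq_bigr (fun i : 'I_N.+1 => (g (x N i) - g (v N i))%:E)); last first.
    by move=> i _; have [? [? ?]] := bounds i; exact: Mg.
  rewrite sumEFin lee_fin; apply: ltW.
  apply: le_lt_trans (Hdelta N.+1 (fun i => x N i) (fun i => v N i) bounds _ _).
  - by apply: ler_sum => i _; rewrite distrC ler_norm.
  - apply/trivIsetP => i j _ _ ij; apply/seteqP; split => // z [zi zj].
    have /trivIsetP/(_ i j I I ij) := tF N; rewrite -subset0; apply.
    by split; apply: subset_itv_oo_oc; [exact: zi|exact: zj].
  - rewrite -lte_fin -sumEFin; apply: le_lt_trans Udelta.
    rewrite (_ : \sum_(i < N.+1) _ = lebesgue_measure (D N))%E; last first.
      rewrite /D measure_bigsetU//; apply: eq_bigr => i _.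
      transitivity (lebesgue_measure `]x N i, v N i]%classic) => //.
      rewrite lebesgue_measure_itv/= lte_fin; case: ltP => // vxi.
      by congr EFin; apply/eqP; rewrite subr_eq0 eq_le xv vxi.
    by apply: le_measure; rewrite ?inE.
(* The unions [D N] are not monotone in N; their lower limit is the increasing union of the [G n],
   each of mass at most e. *)
pose G n := \bigcap_(m in [set m | (n <= m)%N]) D m.
have mG n : measurable (G n) by apply: bigcap_measurable => //; exists n => /=.
have GD n : (M (G n) <= e%:E)%E.
  apply: le_trans (MD n); apply: le_measure; rewrite ?inE//.
  by apply: bigcap_inf => /=.
apply: (@le_trans _ _ (M (\bigcup_n G n))).
  apply: le_measure; rewrite ?inE//; first exact: bigcupT_measurable.
  move=> y [Ey]; rewrite /= in_itv/= => /andP[ay yb].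
  (* A ball of radius r around y lies in [U]; once the mesh is below r, so does the cell that
     contains y. *)
  have [r /= r0 rU] : nbhs_ball (y : R) U.
    by apply/nbhs_ballP; exact: (open_nbhs_nbhs (conj oU (EU _ Ey))).
  have ba0 : 0 < r / (b - a) by rewrite divr_gt0// subr_gt0.
  have [n0 _ Hn0] := near_infty_natSinv_lt (PosNum ba0).
  exists n0 => // m n0m.
  have hr : h m < r.
    have := Hn0 m n0m; rewrite /= ltr_pdivlMr ?subr_gt0// mulrC; exact.
  have [i im /andP[xiy yxi]] : exists2 i, (i < m.+1)%N & x m i < y <= x m i.+1.
    by apply: exists_grid_cell => //; rewrite -/(x m m.+1) xN.
  rewrite /D -bigcup_mkord; exists i => //.
  rewrite /F /v; case: ifPn => [_|/asboolPn]; first by rewrite /= in_itv/= xiy.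
  case=> z; rewrite /= in_itv/= => /andP[xiz zxi]; apply: rU.
  rewrite /ball/=; apply: le_lt_trans hr.
  have xS : x m i.+1 = x m i + h m by rewrite /x -natr1 mulrDr mulr1 addrA.
  rewrite ler_norml; rewrite xS in yxi zxi.
  by apply/andP; split; lra.
have cG : (M \o G) n @[n --> \oo] --> M (\bigcup_n G n).
  apply: nondecreasing_cvg_mu => //; first exact: bigcupT_measurable.
  move=> n m nm; apply/subsetPset; apply: sub_bigcap => k mk.
  by apply: bigcap_inf => /=; exact: leq_trans mk.
rewrite -(cvg_lim _ cG)//; apply: lime_le; first by apply/cvg_ex; eexists; exact: cG.
by apply: nearW => n; exact: GD.
Qed.

Section levy_measure_restriction.
Context {R : realType}.
Variables (nubar : {measure set (measurableTypeR R) -> \bar R}) (f : R -> R).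
Hypothesis nubar_levy : is_levy_measure nubar.
Hypothesis f_bernstein : forall x, 0 < x -> f x = bernstein_fun nubar x.
Hypothesis nubar_infinite : nubar `]0%R, +oo[%classic = +oo%E.
Hypothesis tail_ac : forall a b, 0 < a -> a <= b -> abs_cont a b (levy_tail nubar).

Let measurable_min1 : measurable_fun setT (fun s : measurableTypeR R => Num.min s 1).
Proof. exact: measurable_minr. Qed.

Lemma levy_measure_tail_lty s : 0 < s -> (nubar `]s, +oo[%classic < +oo)%E.
Proof.
move=> s0; have c0 : 0 < Num.min s 1 by rewrite lt_min s0/=.
have : ((Num.min s 1)%:E * nubar `]s, +oo[%classic < +oo)%E.
  apply: le_lt_trans nubar_levy.
  rewrite -integral_cst//; apply: (@le_trans _ _
    (\int[nubar]_(y in `]s, +oo[) (Num.min y 1)%:E)%E).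
    apply: ge0_le_integral => //.
    - by move=> x _; rewrite lee_fin ltW.
    - by apply: measurable_funTS; apply/measurable_EFinP; exact: measurable_min1.
    - move=> y; rewrite /= in_itv/= andbT => sy.
      by rewrite lee_fin le_min2// ltW.
  apply: ge0_subset_integral => //.
  - by apply: measurable_funTS; apply/measurable_EFinP; exact: measurable_min1.
  - by move=> y; rewrite /= in_itv/= andbT => y0; rewrite lee_fin le_min ler01 ltW.
  - by apply: subset_itvr; rewrite bnd_simp ltW.
apply: contraTT; rewrite -!leNgt !leye_eq => /eqP ->.
by rewrite gt0_muley// lte_fin.
Qed.

Let mpos : measurable_fun setT
  (\1_(`]0%R, +oo[%classic : set (measurableTypeR R)) : measurableTypeR R -> R).
Proof. exact: measurable_indic. Qed.

Let pos_ge0 x : 0 <= (\1_(`]0%R, +oo[%classic : set (measurableTypeR R)) x : R).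
Proof. by []. Qed.

Local Notation nu := (weighted_image nubar mpos pos_ge0 (@measurable_id _ _ _)).

Let nuE (E : set (measurableTypeR R)) : measurable E ->
  nu E = nubar (E `&` `]0%R, +oo[%classic).
Proof.
move=> mE; rewrite /weighted_image preimage_id integral_indic//.
by rewrite setIC.
Qed.

(** [nubar] itself is not assumed sigma-finite. Its restriction gives no mass to ]-oo, 0] and finite
    mass to each ]1 / (n + 1), +oo[. *)
Let nu_sigma_finite : sigma_finite setT nu.
Proof.
exists (fun n => `]-oo, 0%R]%classic `|` `]n.+1%:R^-1%R, +oo[%classic).
  apply/esym/seteqP; split => // x _; have [x0|x0] := leP x 0.
    by exists 0%N => //; left; rewrite /= in_itv.
  have [n _ /(_ n (leqnn n))/= nx] := near_infty_natSinv_lt (PosNum x0).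
  by exists n => //; right; rewrite /= in_itv/= nx.
move=> n; have mF : measurable (`]-oo, 0%R]%classic `|` `]n.+1%:R^-1%R, +oo[%classic
   : set (measurableTypeR R)) by apply: measurableU.
split => //; rewrite nuE//.
have n0 : 0 < n.+1%:R^-1 :> R by rewrite invr_gt0.
apply: le_lt_trans (levy_measure_tail_lty n0); apply: le_measure; rewrite ?inE//.
  exact: measurableI.
move=> x [[]] //=; rewrite !in_itv/= andbT => x0.
by rewrite ltNge x0.
Qed.

(** Restricting to the positive axis yields the sigma-finiteness that Tonelli's theorem requires.
    Null sets are handled piece by piece with [abs_cont_null], since the tail is absolutely
    continuous only on compact subintervals. *)
Lemma levy_measure_restriction :
  exists nu0 : {sigma_finite_measure set (measurableTypeR R) -> \bar R},
  [/\ nu0 `]-oo, 0%R]%classic = 0%E,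
      forall r, 0 < r ->
        (\int[nu0]_s (1 - expR (- (r * Num.max s 0)))%:E = (f r)%:E)%E,
      nu0 setT = +oo%E,
      forall E : set (measurableTypeR R), measurable E ->
        lebesgue_measure E = 0%E -> nu0 E = 0%E &
      forall s, 0 < s -> nu0 `]s, +oo[%classic = nubar `]s, +oo[%classic].
Proof.
pose sf := Measure_isSigmaFinite.Build _ _ _ nu nu_sigma_finite.
pose nu0 : {sigma_finite_measure set (measurableTypeR R) -> \bar R} := HB.pack nu sf.
exists nu0; split.
- rewrite [LHS]nuE// (_ : _ `&` _ = set0) ?measure0//.
  by apply/seteqP; split => // x []/=; rewrite !in_itv/= andbT leNgt => /negP.
- move=> r r0; rewrite f_bernstein// /bernstein_fun /Rintegral.
  have mphi : measurable_fun setT (fun s : measurableTypeR R => (1 - tilt r s)%:E).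
    by apply/measurable_EFinP; exact: measurable_onem_tilt.
  have phi0 s : (0 <= (1 - tilt r s)%:E)%E.
    by rewrite lee_fin subr_ge0; apply: tilt_le1; exact: ltW.
  have -> : (\int[nubar]_(s in `]0%R, +oo[) (1 - expR (- (r * s)))%:E =
      \int[nubar]_(s in `]0%R, +oo[) (1 - tilt r s)%:E)%E.
    apply: eq_integral => s; rewrite inE/= in_itv/= andbT => s0.
    by rewrite tilt_pos// ltW.
  rewrite fineK.
    rewrite [LHS](ge0_integral_weighted_image nubar mpos pos_ge0 (@measurable_id _ _ _) mphi phi0).
    by rewrite -[RHS]integral_indicM; apply: eq_integral => s _; rewrite muleC.
  rewrite ge0_fin_numE; last by apply: integral_ge0 => s _; exact: phi0.
  (* Finiteness from 1 - e^(-r s) <= (1 + r) min(s, 1): the left side is at most r s for s < 1 and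
     at most 1 otherwise. *)
  apply: (@le_lt_trans _ _ ((1 + r)%:E *
      \int[nubar]_(s in `]0%R, +oo[) (Num.min s 1)%:E)%E); last first.
    by rewrite lte_mul_pinfty// lee_fin addr_ge0// ltW.
  have min0 s : `]0%R, +oo[%classic s -> (0 <= (Num.min s 1)%:E :> \bar R)%E.
    by rewrite /= in_itv/= andbT => s0; rewrite lee_fin le_min ler01 ltW.
  have mmin : measurable_fun (`]0%R, +oo[%classic : set (measurableTypeR R))
      (fun s : measurableTypeR R => (Num.min s 1)%:E).
    by apply: measurable_funTS; apply/measurable_EFinP; exact: measurable_min1.
  rewrite -ge0_integralZl_EFin//; last by rewrite addr_ge0// ltW.
  apply: ge0_le_integral => //.
  - exact: measurable_funTS.
  - exact: emeasurable_funM.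
  move=> s; rewrite /= in_itv/= andbT => s0; rewrite -EFinM lee_fin tilt_pos ?(ltW s0)//.
  have e0 := expR_ge0 (- (r * s)); have e1 := expR_ge1Dx (- (r * s)).
  rewrite /Num.min; case: ifPn => s1.
    by rewrite mulrDl mul1r lerBlDr -lerBlDl; nra.
  by rewrite mulr1; lra.
- by rewrite [LHS]nuE// setTI.
- move=> E mE E0; rewrite [LHS]nuE//.
  (* The upper end n + 2, not n + 1, keeps the interval nondegenerate at n = 0, as [abs_cont_null]
     requires. *)
  pose A n : set (measurableTypeR R) := E `&` `]n.+1%:R^-1, n.+2%:R]%classic.
  have mA n : measurable (A n) by exact: measurableI.
  have An n : nubar (A n) = 0%E.
    have n0 : 0 < n.+1%:R^-1 :> R by rewrite invr_gt0.
    have n12 : n.+1%:R^-1 < n.+2%:R :> R.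
      by rewrite (@le_lt_trans _ _ 1) ?invf_le1 ?ler1n ?ltr1n.
    apply: (abs_cont_null (g := levy_tail nubar) n12) => //; last first.
      by apply: tail_ac => //; exact: ltW.
    move=> u v u1 uv _; have u0 : 0 < u by exact: lt_le_trans u1.
    have v0 : 0 < v by exact: lt_le_trans uv.
    rewrite /levy_tail EFinB !fineK ?ge0_fin_numE ?levy_measure_tail_lty//.
    have -> : `]u, +oo[%classic = `]u, v]%classic `|` `]v, +oo[%classic.
      by rewrite -itv_bndbnd_setU// bnd_simp.
    rewrite measureU//; last first.
      by apply/seteqP; split => // z []/=; rewrite !in_itv/= andbT => /andP[_ /le_lt_trans /[apply]]; rewrite ltxx.
    by rewrite addeK// ge0_fin_numE// levy_measure_tail_lty.
  apply: (@measure_negligible _ _ _ nubar); first exact: measurableI.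
  rewrite (_ : _ `&` _ = \bigcup_n A n); last first.
    apply/seteqP; split => x /=.
      rewrite in_itv/= andbT => -[Ex x0].
      have [n1 _ Hn1] := near_infty_natSinv_lt (PosNum x0).
      exists (n1 + Num.truncn x)%N => //; split => //=; rewrite in_itv/=.
      rewrite (Hn1 _ (leq_addr _ _))/= (le_trans (ltW (truncnS_gt _)))// ler_nat.
      by rewrite ltnS (leq_trans (leq_addl n1 _)).
    move=> [n _ [Ex]]; rewrite /= !in_itv/= andbT => /andP[nx _]; split => //.
    by rewrite (lt_trans _ nx)// invr_gt0.
  by apply: negligible_bigcup => n; apply/negligibleP; [exact: mA|exact: An].
- move=> s s0; rewrite [LHS]nuE// setIidl//.
  by apply: subset_itvr; rewrite bnd_simp ltW.
Qed.

End levy_measure_restriction.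

(** * Caputo-Djrbashian derivatives *)

Section measurable_derivative.
Context {R : realType}.
Variable F : R -> R.
Hypothesis cF : continuous F.

Let dq (h x : R) : R := h^-1 *: (F (h + x) - F x).

Let continuous_dq h : continuous (dq h).
Proof.
move=> x; apply: cvgZr; apply: cvgB; last exact: cF.
apply: (@continuous_comp _ _ _ (fun y : R => h + y) F); last exact: cF.
by apply: cvgD; [exact: cvg_cst|exact: cvg_id].
Qed.

Let measurable_dq h : measurable_fun setT (dq h : measurableTypeR R -> measurableTypeR R).
Proof. exact: continuous_measurable_fun. Qed.

(** The Cauchy criterion at precision 1 / (k + 1) for all increments below 1 / (n + 1). For fixed
    increments it is a closed condition on x, since [F] is continuous, so the intersection over
    uncountably many increments is still closed, hence Borel. *)
Let C k n : set R := [set x | forall h h', 0 < `|h| < n.+1%:R^-1 ->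
  0 < `|h'| < n.+1%:R^-1 -> `|dq h x - dq h' x| <= k.+1%:R^-1].

Let measurable_C k n : measurable (C k n : set (measurableTypeR R)).
Proof.
suff : closed (C k n) by exact: closed_measurable.
have -> : C k n = \bigcap_(z in [set z : R * R | 0 < `|z.1| < n.+1%:R^-1 /\
    0 < `|z.2| < n.+1%:R^-1]) [set x | `|dq z.1 x - dq z.2 x| <= k.+1%:R^-1].
  apply/seteqP; split => [x Cx [h h'] [] /=|x Cx h h' hn h'n]; first exact: Cx.
  exact: (Cx (h, h')).
apply: closed_bigI => z _.
apply: (closed_comp (f := fun x => `|dq z.1 x - dq z.2 x|) _ (@closed_le R _)).
move=> x _; apply: (@continuous_comp _ _ _ (fun x => dq z.1 x - dq z.2 x) Num.norm).
  by apply: cvgB; exact: continuous_dq.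
exact: norm_continuous.
Qed.

Let D : set R := \bigcap_k \bigcup_n C k n.

Let DP x : D x <-> cvg (dq h x @[h --> 0^']).
Proof.
split.
- move=> Dx; apply/cauchy_cvgP/cauchy_ballP => e e0.
  have [k _ /(_ k (leqnn k))/= ke] := near_infty_natSinv_lt (PosNum e0).
  have [n _ Cx] := Dx k I.
  pose A := [set y | exists2 h, 0 < `|h| < n.+1%:R^-1 & y = dq h x].
  have FA : (dq h x @[h --> 0^']) A.
    have n0 : 0 < n.+1%:R^-1 :> R by rewrite invr_gt0.
    exists n.+1%:R^-1 => //= h; rewrite /ball/= sub0r normrN => hn h0.
    by exists h => //; rewrite hn normr_gt0 h0.
  exists (A, A) => //= -[y z] [[h hn /= ->] [h' h'n ->]].
  by rewrite /ball/=; apply: le_lt_trans ke; exact: Cx.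
- move=> /cvg_ex[l /cvgrPdist_lt cl] k _.
  have k0 : 0 < k.+1%:R^-1 / 2 :> R by rewrite divr_gt0// invr_gt0.
  have [d /= d0 dl] := cl _ k0.
  have [n _ /(_ n (leqnn n))/= nd] := near_infty_natSinv_lt (PosNum d0).
  exists n => // h h' /andP[h0 hn] /andP[h'0 h'n].
  have H u : 0 < `|u| -> `|u| < n.+1%:R^-1 -> `|l - dq u x| < k.+1%:R^-1 / 2.
    move=> u0 un; apply: dl; last by rewrite -normr_gt0.
    by rewrite /ball/= sub0r normrN (lt_trans un).
  rewrite -(subrKA l) (le_trans (ler_normD _ _))// [leRHS]splitr lerD//.
    by rewrite distrC ltW// H.
  by rewrite ltW// H.
Qed.

(* Off the set D of convergence [derive1] is the constant [point]. *)
Lemma measurable_derive1 :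
  measurable_fun setT (derive1 F : measurableTypeR R -> measurableTypeR R).
Proof.
have mD : measurable (D : set (measurableTypeR R)).
  apply: bigcapT_measurable => k; apply: bigcupT_measurable => n.
  exact: measurable_C.
pose p0 : R := point.
pose g n (x : R) : R := dq n.+1%:R^-1 x * \1_D x + p0 * (1 - \1_D x).
apply: (@measurable_fun_cvg _ (measurableTypeR R) R setT g).
- move=> n; apply: measurable_funD.
    by apply: measurable_funM; [exact: measurable_dq|exact: measurable_indic].
  by apply: measurable_funM => //; apply: measurable_funB.
- move=> x _; rewrite /g indicE; have [/set_mem Dx|/negP Dx] := boolP (x \in D).
    under eq_fun do rewrite subrr mulr0 addr0 mulr1.
    have /DP cx := Dx.
    have hn : n.+1%:R^-1 @[n --> \oo] --> (0 : R)^'.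
      move=> A [e /= e0 eA]; have [N _ HN] := near_infty_natSinv_lt (PosNum e0).
      exists N => // n Nn; apply: eA; last by rewrite /= gt_eqF// invr_gt0.
      by rewrite /ball/= sub0r normrN gtr0_norm ?invr_gt0//; exact: HN.
    exact: (cvg_comp _ _ hn cx).
  under eq_fun do rewrite mulr0 add0r subr0 mulr1.
  rewrite /derive1 dvgP; first exact: cvg_cst.
  by move=> /DP xD; apply: Dx; exact: mem_set.
Qed.

End measurable_derivative.

(** * Caputo-Djrbashian derivative of a function with an integrable density *)

Section caputo_of_density.
Context {R : realType}.
Variables (q w nu : R -> R) (c : R).
Notation mu := (@lebesgue_measure R).
Hypothesis iq : mu.-integrable setT (EFin \o q).
Hypothesis wE : forall t, 0 <= t -> w t = c + \int[mu]_(x in `]-oo, t]) q x.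

Let F (x : R) : R := \int[mu]_(y in `]-oo, x]) q y.

Let iqS (A : set (measurableTypeR R)) : measurable A -> mu.-integrable A (EFin \o q).
Proof. by move=> mA; exact: integrableS iq. Qed.

Let Fdiff x y : x <= y -> F y - F x = \int[mu]_(z in `]x, y]) q z.
Proof.
move=> xy; rewrite /F (@Rintegral_itvB _ q -oo%O (BRight y) x)//.
exact: iqS.
Qed.

Let Fdiff_le x y : x <= y -> `|F y - F x| <= \int[mu]_(z in `]x, y]) `|q z|.
Proof. by move=> xy; rewrite Fdiff// le_normr_Rintegral//; exact: iqS. Qed.

Let mu_itv (x y : R) b1 b2 : x <= y ->
  mu [set` Interval (BSide b1 x) (BSide b2 y)] = (y - x)%:E.
Proof.
move=> xy; rewrite lebesgue_measure_itv/= lte_fin; case: ltP => // yx.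
by congr EFin; apply/esym/eqP; rewrite subr_eq0 eq_le xy yx.
Qed.

Let continuous_F : continuous F.
Proof.
move=> x; apply/cvgrPdist_lt => e e0.
have [d [d0 Hd]] := integral_normr_continuous iq e0.
near=> y.
have xyd : `|x - y| < d by near: y; exact: cvgr_dist_lt.
have [xy|yx] := leP x y.
  rewrite distrC (le_lt_trans (Fdiff_le xy))// Hd//= mu_itv// lte_fin.
  by move: xyd; rewrite distrC ger0_norm// subr_ge0.
rewrite (le_lt_trans (Fdiff_le (ltW yx)))// Hd//= mu_itv ?lte_fin; last exact: ltW.
by move: xyd; rewrite gtr0_norm// subr_gt0.
Unshelve. all: by end_near. Qed.

(** Absolute continuity of the integral of [|q|], applied to the union of the intervals, whose
    measure is the sum of their lengths. *)
Lemma abs_cont_of_density T : 0 < T -> abs_cont 0 T w.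
Proof.
move=> T0 e e0; have [d [d0 Hd]] := integral_normr_continuous iq e0.
exists d => // n u v uv tuv uvd.
pose G i : set (measurableTypeR R) := `]u i, v i[%classic.
have mG i : measurable (G i) by exact: measurable_itv.
pose D := \big[setU/set0]_(i <- index_enum 'I_n) G i.
have mD : measurable D by exact: bigsetU_measurable.
have tG : trivIset [set` index_enum 'I_n] G.
  by apply: sub_trivIset tuv.
have muD : (mu D < d%:E)%E.
  rewrite -(mul1e (mu D)) -integral_cst//.
  rewrite ge0_integral_bigsetU//; last exact: index_enum_uniq.
  rewrite (eq_bigr (fun i => (v i - u i)%:E)) ?sumEFin// => i _.
  have [_ [? _]] := uv i.
  by rewrite integral_cst// mul1e [LHS]mu_itv.
apply: le_lt_trans (Hd _ mD muD).
have mq : measurable_fun setT (fun z => `|q z|%:E).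
  apply/measurable_EFinP; apply: measurableT_comp => //.
  by apply/measurable_EFinP; exact: measurable_int iq.
rewrite [leRHS]/Rintegral ge0_integral_bigsetU//; last 2 first.
- exact: index_enum_uniq.
- exact: measurable_funTS.
have fin i : (\int[mu]_(x in G i) `|q x|%:E)%E \is a fin_num.
  apply: integrable_fin_num => //.
  rewrite (_ : (fun x => _) = abse \o (EFin \o q))//.
  by apply: integrable_abse; exact: iqS.
rewrite -sum_fine//; apply: ler_sum => i _.
have [u0 [uvi vT]] := uv i.
rewrite !wE ?(le_trans u0)// opprD addrACA subrr add0r.
rewrite (le_trans (Fdiff_le uvi))//.
rewrite le_eqVlt; apply/orP; left; apply/eqP.
rewrite /Rintegral; congr fine.
rewrite -integral_itv_bndo_bndc//; exact: measurable_funTS.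
Qed.

(** [w] is prescribed on nonnegative times only, but for s < t the difference quotients coincide for
    small increments. The two derivatives then choose a limit from the same predicate, so they agree
    even where no derivative exists. *)
Lemma derive1_shift_density t s : s < t ->
  derive1 (fun u => w (u - s)) t = derive1 F (t - s).
Proof.
rewrite -subr_gt0 => ts.
have E : \forall h \near (0 : R)^',
    h^-1 *: (w (h + t - s) - w (t - s)) = h^-1 *: (F (h + (t - s)) - F (t - s)).
  near=> h; congr (_ *: _).
  have hts : `|h| < t - s by near: h; exact: dnbhs0_lt.
  have h0 : 0 <= h + t - s.
    by move: hts; rewrite ltr_norml => /andP[? _]; lra.
  by rewrite (wE h0) (wE (ltW ts)) -/(F _) -/(F _) addrA opprD addrACA subrr add0r.
rewrite /derive1; congr (get _); apply/funext => l; apply/propext; split => H.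
- by apply: cvg_trans H; apply: near_eq_cvg; apply: filterS E => h /esym.
- by apply: cvg_trans H; apply: near_eq_cvg; apply: filterS E => h ->.
Unshelve. all: by end_near. Qed.

Hypothesis mnu : forall t, 0 < t -> measurable_fun (`]0, t[%classic : set (measurableTypeR R)) nu.

(** By Lebesgue differentiation the derivative of [F] is [q] off a null set, and the reflection of
    that set by t - s is null too. *)
Lemma ae_caputo_density t : 0 < t ->
  ae_eq mu `]0, t[%classic (EFin \o caputo_djrbashian_integrand nu w t)
    (fun s => (q (t - s) * nu s)%:E).
Proof.
move=> t0.
have loc : locally_integrable setT q by apply: open_integrable_locally => //; exact: openT.
have := FTC1Ny (fun y => iqS (measurable_itv _)) loc.
move=> [N [mN N0 HN]].
pose N' : set (measurableTypeR R) := [set s | N (t - s)].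
have mr : measurable_fun setT (fun s : measurableTypeR R => t - s : measurableTypeR R).
  exact: measurable_funB.
have mN' : measurable N' by rewrite -[X in measurable X]setTI; exact: mr.
exists N'; split => //.
  rewrite -integral_indicE//.
  rewrite (_ : (fun x => _) = (fun s => (\1_N (t - s) : R)%:E)); last first.
    by apply/funext => s; rewrite !indicE.
  rewrite (ge0_integral_lebesgue_reflect t (f := fun s => (\1_N s : R)%:E))//.
    by rewrite integral_indicE.
  exact: measurable_indic_EFin.
move=> s /= Hs; apply: HN => /= -[_ Fq]; apply: Hs.
rewrite in_itv/= => /andP[s0 st].
by rewrite /caputo_djrbashian_integrand derive1_shift_density// -/F Fq.
Qed.

(** Equality almost everywhere with a measurable function does not give Borel measurability, so the
    measurability of the actual derivative of [F] is used. *)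
Lemma measurable_caputo_integrand t : 0 < t ->
  measurable_fun (`]0, t[%classic : set (measurableTypeR R)) (caputo_djrbashian_integrand nu w t).
Proof.
move=> t0; apply: (eq_measurable_fun (fun s : measurableTypeR R => derive1 F (t - s) * nu s)).
  move=> s; rewrite inE/= in_itv/= => /andP[_ st].
  by rewrite /caputo_djrbashian_integrand derive1_shift_density.
apply: measurable_funM; last exact: mnu.
apply: measurable_funTS; apply: (measurableT_comp (measurable_derive1 continuous_F)).
exact: measurable_funB.
Qed.

Hypothesis iG : forall t, 0 < t ->
  mu.-integrable `]0, t[ (fun s => (q (t - s) * nu s)%:E).

Lemma caputo_djrbashian_dom_of_density : caputo_djrbashian_dom nu w.
Proof.
split => [T T0|t t0]; first exact: abs_cont_of_density.
apply/integrableP; split; first by apply/measurable_EFinP; exact: measurable_caputo_integrand.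
have /integrableP[mG] := iG t0; apply: le_lt_trans.
rewrite le_eqVlt; apply/orP; left; apply/eqP.
apply: ae_eq_integral => //.
- apply: measurableT_comp => //.
  by apply/measurable_EFinP; exact: measurable_caputo_integrand.
- exact: measurableT_comp.
- have [N [mN N0 HN]] := ae_caputo_density t0.
  exists N; split => //; apply: subset_trans HN => s /= Hs Hs'.
  by apply: Hs => /Hs' [->].
Qed.

Lemma caputo_djrbashian_of_density t : 0 < t ->
  caputo_djrbashian nu w t = \int[mu]_(s in `]0, t[) (q (t - s) * nu s).
Proof.
move=> t0; rewrite /caputo_djrbashian /Rintegral; congr fine.
apply: ae_eq_integral => //.
- by apply/measurable_EFinP; exact: measurable_caputo_integrand.
- by have /integrableP[] := iG t0.
- exact: ae_caputo_density.
Qed.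

End caputo_of_density.

(** * Poisson process at an independent time *)

Section poisson_weights.
Context {R : realType}.
Implicit Types (c u : R) (n : nat).
Notation mu := (@lebesgue_measure R).

(** For c u > 0 this is [poisson_pmf (c * u) n], which is defined by a case on the positivity of the
    rate; the plain formula is differentiable in u everywhere and has the right value at u = 0. *)
Definition poisson_weight c n u : R := (c * u) ^+ n / n`!%:R * expR (- (c * u)).

Lemma poisson_weight_ge0 c n u : 0 <= c -> 0 <= u -> 0 <= poisson_weight c n u.
Proof.
by move=> c0 u0; rewrite /poisson_weight mulr_ge0 ?expR_ge0// divr_ge0// exprn_ge0// mulr_ge0.
Qed.

Lemma poisson_weight_at0 c n : poisson_weight c n 0 = (n == 0%N)%:R.
Proof.
rewrite /poisson_weight mulr0 oppr0 expR0 mulr1 expr0n.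
by case: n => [|n]; rewrite ?divr1 ?mul0r.
Qed.

Lemma poisson_weight_pmf c n u : 0 < c * u -> poisson_pmf (c * u) n = poisson_weight c n u.
Proof. by move=> cu0; rewrite /poisson_pmf cu0. Qed.

Lemma poisson_weight_le1 c n u : 0 <= c -> 0 <= u -> poisson_weight c n u <= 1.
Proof.
move=> c0 u0; rewrite /poisson_weight expRN ler_pdivrMr ?expR_gt0// mul1r.
have cu0 : 0 <= c * u by rewrite mulr_ge0.
case: n => [|n]; first by rewrite expr0 divr1 -expR0 ler_expR.
by apply: le_trans (expR_ge1Dxn n cu0); rewrite lerDr.
Qed.

(** Exponential tilting changes the rate from c to c + c'. With c' = f(r) it absorbs the factor E
    e^(-r H(u)) in the Laplace transform of the potentials. *)
Lemma poisson_weight_rate c c' n u : c + c' != 0 ->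
  poisson_weight c n u * expR (- (u * c')) =
  (c / (c + c')) ^+ n * poisson_weight (c + c') n u.
Proof.
move=> cc0; rewrite /poisson_weight -mulrA -expRD -opprD (mulrC u) -mulrDl mulrA.
congr (_ * _); rewrite mulrA -exprMn; congr (_ ^+ _ / _).
by rewrite mulrA divfK.
Qed.

Lemma is_derive_poisson_weight c n u :
  is_derive u 1 (poisson_weight c n)
    (c * (if n is m.+1 then poisson_weight c m u - poisson_weight c n u
          else - poisson_weight c n u)).
Proof.
have dl : is_derive u 1 (fun v : R => c * v) c.
  by apply: is_derive_eq; rewrite /GRing.scale/= mulr1.
have de : is_derive u 1 (fun v : R => expR (- (c * v))) (- c * expR (- (c * u))).
  have dN : is_derive u 1 (fun v : R => - (c * v)) (- c) by exact: is_deriveN.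
  by apply: is_derive_eq; rewrite /GRing.scale/= mulrC.
case: n => [|n].
  rewrite (_ : poisson_weight c 0 = fun v => expR (- (c * v))).
    by rewrite mulrN -mulNr.
  by apply/funext => v; rewrite /poisson_weight expr0 divr1 mul1r.
have dx : is_derive u 1 ((fun v : R => c * v) ^+ n.+1) (n.+1%:R * (c * u) ^+ n *: c).
  exact: is_deriveX.
have dM := is_deriveM (is_deriveM dx (is_derive_cst (n.+1`!%:R^-1 : R) u 1)) de.
rewrite (_ : poisson_weight c n.+1 =
  ((fun v : R => c * v) ^+ n.+1 * cst (n.+1`!%:R^-1)) * (fun v => expR (- (c * v)))).
  apply: is_derive_eq dM _.
  rewrite /poisson_weight /GRing.scale/= factS natrM.
  rewrite !(mulrfctE, exprfctE)/= exprS.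
  have n0 : n.+1%:R != 0 :> R by rewrite pnatr_eq0.
  have f0 : n`!%:R != 0 :> R by rewrite pnatr_eq0 -lt0n fact_gt0.
  move: (n.+1%:R : R) n0 => m m0.
  by field; rewrite m0 f0.
by apply/funext => v; rewrite !(mulrfctE, exprfctE).
Qed.


(** An antiderivative of c times [poisson_weight c n], since the derivatives of the weights
    telescope. For c > 0 the sign makes it grow from -1 at 0 to 0 at infinity. *)
Definition poisson_weight_sum c n u : R := - \sum_(k < n.+1) poisson_weight c k u.

Lemma is_derive_poisson_weight_sum c n u :
  is_derive u 1 (poisson_weight_sum c n) (c * poisson_weight c n u).
Proof.
elim: n => [|n IH].
  rewrite (_ : poisson_weight_sum c 0 = - poisson_weight c 0).
    have := is_deriveN (is_derive_poisson_weight c 0 u).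
    by rewrite mulrN opprK.
  by apply/funext => v; rewrite /poisson_weight_sum big_ord1.
rewrite (_ : poisson_weight_sum c n.+1 = poisson_weight_sum c n - poisson_weight c n.+1).
  apply: is_derive_eq (is_deriveB IH (is_derive_poisson_weight c n.+1 u)) _.
  by rewrite mulrBr opprB addrC subrK.
by apply/funext => v; rewrite /poisson_weight_sum big_ord_recr/= opprD.
Qed.

Lemma continuous_poisson_weight c n : continuous (poisson_weight c n).
Proof.
move=> u; apply: differentiable_continuous; apply/derivable1_diffP.
by have [] := is_derive_poisson_weight c n u.
Qed.

Lemma measurable_poisson_weight c n :
  measurable_fun setT (poisson_weight c n : measurableTypeR R -> measurableTypeR R).
Proof. by apply: continuous_measurable_fun; exact: continuous_poisson_weight. Qed.

Lemma cvg_poisson_weight c n : 0 < c -> poisson_weight c n u @[u --> +oo] --> 0.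
Proof.
move=> c0.
(* The inequality e^x >= x^(n + 1) / (n + 1)! at x = c u bounds the weight by (n + 1) / (c u). *)
apply: (@squeeze_cvgr _ _ _ _ (cst 0) (fun u => n.+1%:R / c * u^-1)).
- near=> u; have u0 : 0 < u by near: u; exact: nbhs_pinfty_gt.
  have cu0 : 0 < c * u by rewrite mulr_gt0.
  rewrite poisson_weight_ge0 ?(ltW c0) ?(ltW u0)//=.
  have := expR_ge1Dxn n (ltW cu0).
  have n0 : 0 < n.+1%:R :> R by [].
  have f0 : 0 < n`!%:R :> R by rewrite ltr0n fact_gt0.
  rewrite /poisson_weight expRN ler_pdivrMr ?expR_gt0// => e1.
  have -> : (c * u) ^+ n / n`!%:R = n.+1%:R / c / u * ((c * u) ^+ n.+1 / n.+1`!%:R).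
    
      by rewrite exprS factS natrM; move: (n.+1%:R : R) n0 => m m0; field; rewrite !gt_eqF.
  rewrite ler_wpM2l ?divr_ge0 ?(ltW c0) ?(ltW u0)//.
  by apply: le_trans e1; rewrite lerDr.
- exact: cvg_cst.
- rewrite -[X in _ --> X](mulr0 (n.+1%:R / c)); apply: cvgMr.
  by apply/(gtr0_cvgV0 (f := idfun)) => //; exact: nbhs_pinfty_gt.
Unshelve. all: by end_near. Qed.

Lemma cvg_poisson_weight_sum c n : 0 < c -> poisson_weight_sum c n u @[u --> +oo] --> 0.
Proof.
move=> c0; rewrite /poisson_weight_sum -[X in _ --> X]oppr0; apply: cvgN.
elim: n => [|n IH].
  by under eq_fun do rewrite big_ord1; apply: cvg_poisson_weight.
have -> : (fun u => \sum_(k < n.+2) poisson_weight c k u) =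
    (fun u => \sum_(k < n.+1) poisson_weight c k u) \+ poisson_weight c n.+1.
  by apply/funext => u; rewrite big_ord_recr.
by rewrite -[X in _ --> X](addr0 0); apply: cvgD => //; exact: cvg_poisson_weight.
Qed.

Lemma poisson_weight_sum_at0 c n : poisson_weight_sum c n 0 = -1.
Proof.
rewrite /poisson_weight_sum; congr (- _).
rewrite big_ord_recl/= poisson_weight_at0 big1 ?addr0// => k _.
by rewrite poisson_weight_at0.
Qed.

Lemma integral_poisson_weight c n : 0 < c ->
  (\int[mu]_(u in `]0%R, +oo[) (poisson_weight c n u)%:E = (c^-1)%:E)%E.
Proof.
move=> c0; rewrite integral_itv_obnd_cbnd; last first.
  by apply: measurable_funTS; apply/measurable_EFinP; exact: measurable_poisson_weight.
have E := @ge0_continuous_FTC2y R (fun u => c * poisson_weight c n u)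
  (poisson_weight_sum c n) 0 0.
have H : (\int[mu]_(u in `[0%R, +oo[) (c * poisson_weight c n u)%:E = 1)%E.
  rewrite E.
  - by rewrite poisson_weight_sum_at0 EFinN oppeK add0e.
  - by move=> u u0; rewrite mulr_ge0 ?(ltW c0)// poisson_weight_ge0// ltW.
  - apply: continuous_subspaceT => u; apply: cvgMr; exact: continuous_poisson_weight.
  - exact: cvg_poisson_weight_sum.
  - by move=> u _; have [] := is_derive_poisson_weight_sum c n u.
  - apply: cvg_at_right_filter; apply: differentiable_continuous; apply/derivable1_diffP.
    by have [] := is_derive_poisson_weight_sum c n 0.
  - by move=> u _; rewrite derive1E; have [] := is_derive_poisson_weight_sum c n u.
have : (c%:E * \int[mu]_(u in `[0%R, +oo[) (poisson_weight c n u)%:E = 1)%E.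
  rewrite -H -ge0_integralZl_EFin// ?(ltW c0)//.
  - by move=> u; rewrite /= in_itv/= andbT => u0; rewrite lee_fin poisson_weight_ge0// ltW.
  - by apply: measurable_funTS; apply/measurable_EFinP; exact: measurable_poisson_weight.
by move=> {}H; rewrite -[RHS]mule1 -H muleA -EFinM mulVf ?gt_eqF// mul1e.
Qed.

(** The waiting time for event n + 1 has density c times the weight, and it is at most y when more
    than n events occur by time y. Analytically this is the fundamental theorem of calculus for
    [poisson_weight_sum]. *)
Lemma integral_poisson_weight_itv c n y : 0 < c -> 0 <= y ->
  (\int[mu]_(u in `]0%R, y[) (c * poisson_weight c n u)%:E =
   (1 - \sum_(k < n.+1) poisson_weight c k y)%:E)%E.
Proof.
move=> c0; rewrite le_eqVlt => /predU1P[<-|y0].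
  rewrite set_itvoo0 integral_set0 big_ord_recl/= poisson_weight_at0 big1 ?addr0 ?subrr// => k _.
  by rewrite poisson_weight_at0.
have m D : measurable_fun (D : set (measurableTypeR R)) (fun u => (c * poisson_weight c n u)%:E).
  apply: measurable_funTS; apply/measurable_EFinP; apply: measurable_funM => //.
  exact: measurable_poisson_weight.
rewrite -(@integral_itv_bndoo _ _ _ _ true false); last exact: m.
rewrite (@continuous_FTC2 R _ (poisson_weight_sum c n))//.
- by rewrite poisson_weight_sum_at0 -EFinB opprK addrC.
- apply: continuous_subspaceT => u; apply: cvgMr; exact: continuous_poisson_weight.
- split.
  + by move=> u _; have [] := is_derive_poisson_weight_sum c n u.
  + apply: cvg_at_right_filter; apply: differentiable_continuous; apply/derivable1_diffP.
    by have [] := is_derive_poisson_weight_sum c n 0.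
  + apply: cvg_at_left_filter; apply: differentiable_continuous; apply/derivable1_diffP.
    by have [] := is_derive_poisson_weight_sum c n y.
- by move=> u _; rewrite derive1E; have [] := is_derive_poisson_weight_sum c n u.
Qed.

End poisson_weights.

(** * Evaluation of a right-continuous process at a random time *)

Section random_times.
Context {R : realType}.

Lemma measurable_truncn :
  measurable_fun setT (Num.truncn : measurableTypeR R -> nat).
Proof.
move=> _ B _; rewrite setTI.
(* [Num.truncn] is also 0 at negative reals, so the lower bound j <= y is imposed for j > 0 only. *)
rewrite (_ : _ @^-1` B = \bigcup_(j in B)
  ([set y : measurableTypeR R | y < j.+1%:R] `\` [set y : measurableTypeR R | (0 < j)%N /\ y < j%:R])).
  apply: bigcup_measurable => j _; apply: measurableD.
    by rewrite -set_itvNyo; exact: measurable_itv.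
  case: (ltnP 0 j) => j0.
    rewrite (_ : [set y | _] = `]-oo, j%:R[%classic); first exact: measurable_itv.
    by apply/seteqP; split => y /=; rewrite in_itv//= => -[].
  by rewrite (_ : [set y | _] = set0)//; apply/seteqP; split => y //= [].
apply/seteqP; split => y /=.
  move=> By; exists (Num.truncn y) => //; split => /=; first exact: truncnS_gt.
  by move=> []; case E : (Num.truncn y) => [//|j] _; rewrite -truncn_le_nat E ltnn.
move=> [j Bj [/= yj jy]]; suff -> : Num.truncn y = j by [].
apply/eqP; rewrite eqn_leq truncn_le_nat yj/=; case: j {Bj yj} jy => // j jy.
by rewrite ltnNge truncn_le_nat; apply/negP => yj; exact: jy.
Qed.

(** For t >= 0, the first multiple of 1 / (m + 1) strictly above t. It takes countably many values,
    so a process evaluated at it stays measurable; it is strictly above because right limits ignore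
    the value at t itself. *)
Definition grid_above (m : nat) (t : R) : R := (Num.truncn (m.+1%:R * t)).+1%:R / m.+1%:R.

Lemma grid_above_gt0 m t : 0 < grid_above m t.
Proof. by rewrite divr_gt0. Qed.

Lemma grid_above_gt m t : t < grid_above m t.
Proof. by rewrite /grid_above ltr_pdivlMr// mulrC truncnS_gt. Qed.

Lemma grid_above_le m t : 0 <= t -> grid_above m t <= t + m.+1%:R^-1.
Proof.
move=> t0; rewrite /grid_above ler_pdivrMr// mulrDl mulVf// -natr1 lerD2r mulrC truncn_le.
by rewrite mulr_ge0.
Qed.

Lemma cvg_grid_above (x : R -> R) t : 0 <= t -> x u @[u --> t^'+] --> x t ->
  x (grid_above m t) @[m --> \oo] --> x t.
Proof.
move=> t0; apply: cvg_comp => A [e /= e0 eA].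
have [n _ Hn] := near_infty_natSinv_lt (PosNum e0).
exists n => // m nm; apply: eA => /=; last exact: grid_above_gt.
rewrite /ball/= distrC gtr0_norm ?subr_gt0 ?grid_above_gt// ltrBlDl.
by rewrite (le_lt_trans (grid_above_le _ t0))// ltrD2l; exact: Hn.
Qed.

Lemma measurable_fun_switch {d1 d2} {T1 : measurableType d1} {T2 : measurableType d2}
    (k : T1 -> nat) (G : nat -> T1 -> T2) :
  measurable_fun setT k -> (forall j, measurable_fun setT (G j)) ->
  measurable_fun setT (fun z => G (k z) z).
Proof.
move=> mk mG _ B mB; rewrite setTI.
rewrite (_ : _ @^-1` B = \bigcup_j ((k @^-1` [set j]) `&` (G j @^-1` B))).
  apply: bigcup_measurable => j _; apply: measurableI.
    by rewrite -[X in measurable X]setTI; exact: mk.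
  by rewrite -[X in measurable X]setTI; exact: mG.
by apply/seteqP; split => z /=; [exists (k z)|move=> [j _ [/= ->]]].
Qed.

Context {d : measure_display} {Omega : measurableType d}.

Lemma measurable_right_continuous (X : R -> Omega -> R) :
  (forall t, 0 <= t -> measurable_fun setT (X t)) ->
  (forall w t, 0 <= t -> X u w @[u --> t^'+] --> X t w) ->
  measurable_fun setT (fun z : measurableTypeR R * Omega => X (Num.max z.1 0) z.2).
Proof.
move=> mX cX.
apply: (@measurable_fun_cvg _ (measurableTypeR R * Omega)%type R setT
  (fun m z => X (grid_above m (Num.max z.1 0)) z.2)).
- move=> m; apply: (measurable_fun_switch
    (k := fun z : measurableTypeR R * Omega => Num.truncn (m.+1%:R * Num.max z.1 0))
    (G := fun j z => X (j.+1%:R / m.+1%:R) z.2)).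
    apply: (measurableT_comp measurable_truncn).
    by apply: measurable_funM => //; exact: measurable_maxr.
  by move=> j; apply: measurableT_comp => //; exact: mX.
- move=> z _; have z0 : 0 <= Num.max z.1 0 by rewrite le_max lexx orbT.
  exact: (cvg_grid_above (x := fun u => X u z.2) z0 (cX z.2 _ z0)).
Qed.

End random_times.

Section poisson_random_time.
Context {R : realType} {d : measure_display} {Omega : measurableType d}.
Variables (P : probability Omega R) (lambda : R) (N : R -> Omega -> nat).
Variable Y : R -> Omega -> R.
Hypothesis lambda_gt0 : 0 < lambda.
Hypothesis N_poisson : is_poisson_process P lambda N.
Hypothesis mY : forall t, 0 <= t -> measurable_fun setT (Y t : Omega -> measurableTypeR R).
Hypothesis Y_ge0 : forall t w, 0 <= t -> 0 <= Y t w.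
Hypothesis NY_indep : independent_processes P N Y.

Let mN s k : 0 <= s -> measurable (N s @^-1` [set k]).
Proof.
by move=> s0; rewrite -[X in measurable X]setTI; apply: (poisson_measurable N_poisson).
Qed.

Let mNR s : 0 <= s -> measurable_fun setT (fun w => (N s w)%:R : R).
Proof.
move=> s0; apply: (@measurableT_comp _ _ _ _ _ _ (fun n : nat => n%:R : R)) => //.
exact: (poisson_measurable N_poisson).
Qed.

Lemma poisson_process_law s k : 0 < s ->
  P (N s @^-1` [set k]) = (poisson_weight lambda k s)%:E.
Proof.
move=> s0; have := poisson_law N_poisson k (lexx 0) s0.
rewrite subr0 poisson_weight_pmf ?mulr_gt0// => <-; congr (P _).
apply/seteqP; split => w /=;
  have [/eqP + _ _] := poisson_paths N_poisson w;
  by rewrite pnatr_eq0 => /eqP ->; rewrite subn0.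
Qed.

(** Omega is cut according to the grid cell of [Y t]. On each piece the time is fixed, so
    independence applies to the value of [N] at that time and the event that [Y t] lies in the cell;
    the countably many terms are summed. *)
Lemma poisson_grid_time t m k : 0 <= t ->
  P [set w | N (grid_above m (Y t w)) w = k] =
  (\int[P]_w (poisson_weight lambda k (grid_above m (Y t w)))%:E)%E.
Proof.
move=> t0; pose c j : R := j.+1%:R / m.+1%:R.
have c0 j : 0 < c j by rewrite divr_gt0.
pose tr (y : measurableTypeR R) := Num.truncn (m.+1%:R * y).
have mtr : measurable_fun setT tr.
  by apply: (measurableT_comp measurable_truncn); exact: measurable_funM.
pose B j := Y t @^-1` (tr @^-1` [set j]).
have mtrj j : measurable (tr @^-1` [set j]) by rewrite -[X in measurable X]setTI; exact: mtr.
have mB j : measurable (B j) by rewrite -[X in measurable X]setTI; exact: mY.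
have tB : trivIset setT B by move=> i j _ _ [w [/= <- <-]].
have UB : \bigcup_j B j = setT.
  by apply/seteqP; split => // w _; exists (tr (Y t w)).
have mA j : measurable (N (c j) @^-1` [set k]) by apply: mN; exact: ltW.
rewrite (_ : [set w | _] = \bigcup_j ((N (c j) @^-1` [set k]) `&` B j)); last first.
  apply/seteqP; split => w /=; first by exists (tr (Y t w)).
  by move=> [j _ [/= <- <-]].
rewrite measure_semi_bigcup//; last 3 first.
- by move=> j; exact: measurableI.
- by apply: trivIset_setIl.
- by apply: bigcup_measurable => j _; exact: measurableI.
rewrite -UB ge0_integral_bigcup//; last 2 first.
- rewrite UB; apply/measurable_EFinP; apply: (measurableT_comp (measurable_poisson_weight _ _)).
  rewrite /grid_above; apply: measurable_funM => //.
  apply: (@measurableT_comp _ _ _ _ _ _ (fun n : nat => n.+1%:R : R)) => //.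
  apply: (measurableT_comp mtr); exact: mY.
- by move=> w _; rewrite lee_fin poisson_weight_ge0 ?ltW// grid_above_gt0.
apply: eq_eseriesr => j _.
rewrite (eq_integral (cst (poisson_weight lambda k (c j))%:E)); last first.
  by move=> w; rewrite inE => <-.
rewrite integral_cst// -poisson_process_law//; apply: NY_indep.
- by apply: sub_gen_smallest; exists (c j); [exact: ltW|exists [set k]].
- by apply: sub_gen_smallest; exists t => //; exists (tr @^-1` [set j]); [exact: mtrj|].
Qed.

(** A continuous tent that is the indicator of k on the integers: right-continuity of the paths is
    known for [N] as a real-valued process, and a continuous function carries it over to the event
    that [N] equals k. *)
Let bump (k : nat) (x : R) : R := Num.max 0 (1 - `|x - k%:R|).

Let bump_nat k n : bump k n%:R = (n == k)%:R.
Proof.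
rewrite /bump; have [->|nk] := eqVneq n k.
  by rewrite subrr normr0 subr0 max_r.
rewrite max_l// subr_le0; case: (ltngtP n k) nk => // nk _.
  by rewrite distrC ger0_norm ?subr_ge0 ?ler_nat ?(ltnW nk)// lerBrDr nat1r ler_nat.
by rewrite ger0_norm ?subr_ge0 ?ler_nat ?(ltnW nk)// lerBrDr nat1r ler_nat.
Qed.

Let continuous_bump k : continuous (bump k).
Proof.
move=> x; apply: (@continuous_max R R (fun=> 0) (fun x => 1 - `|x - k%:R|)).
  exact: cvg_cst.
apply: cvgB; first exact: cvg_cst.
by apply: cvg_norm; apply: cvgB; [exact: cvg_id|exact: cvg_cst].
Qed.

Lemma measurable_poisson_random_time t k : 0 <= t ->
  measurable [set w | N (Y t w) w = k].
Proof.
move=> t0.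
have m := measurable_right_continuous (X := fun s w => (N s w)%:R : R) mNR
  (fun w s s0 => let: And3 _ _ c := poisson_paths N_poisson w in c s s0).
have mY' : measurable_fun setT (fun w => (Y t w, w) : measurableTypeR R * Omega).
  by apply: measurable_fun_pair => //; exact: mY.
have := measurableT_comp m mY'; move=> /(_ measurableT [set k%:R] (measurable_set1 _)).
rewrite setTI; congr (measurable _); apply/seteqP.
split => w /=; rewrite max_l ?Y_ge0//; last by move=> ->.
by move=> /eqP; rewrite eqr_nat => /eqP.
Qed.

(** Both sides of [poisson_grid_time] converge as m grows, by dominated convergence: the left one
    through [bump] and right-continuity of the paths of [N], the right one by continuity of the
    weight. *)
Lemma poisson_random_time t k : 0 <= t ->
  P [set w | N (Y t w) w = k] = (\int[P]_w (poisson_weight lambda k (Y t w))%:E)%E.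
Proof.
move=> t0.
have ione : P.-integrable setT (cst 1%E).
  by apply: finite_measure_integrable_cst.
have mg m : measurable_fun setT (fun w => grid_above m (Y t w) : measurableTypeR R).
  rewrite /grid_above; apply: measurable_funM => //.
  apply: (@measurableT_comp _ _ _ _ _ _ (fun n : nat => n.+1%:R : R)) => //.
  apply: (measurableT_comp measurable_truncn); apply: measurable_funM => //; exact: mY.
have mNg m : measurable_fun setT (fun w => N (grid_above m (Y t w)) w).
  apply: (measurable_fun_switch (k := fun w => Num.truncn (m.+1%:R * Y t w))
    (G := fun j => N (j.+1%:R / m.+1%:R))).
    apply: (measurableT_comp measurable_truncn); apply: measurable_funM => //; exact: mY.
  by move=> j; exact: (poisson_measurable N_poisson).
have L : (\int[P]_w (poisson_weight lambda k (grid_above m (Y t w)))%:E)%E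
    @[m --> \oo] --> (\int[P]_w (poisson_weight lambda k (Y t w))%:E)%E.
  apply: (dominated_cvg measurableT _ _ _ ione) => //.
  - move=> m; apply/measurable_EFinP.
    by apply: (measurableT_comp (measurable_poisson_weight _ _)).
  - move=> w _; apply: cvg_EFin; first exact: nearW.
    apply: cvg_grid_above; first exact: Y_ge0.
    by apply: cvg_at_right_filter; exact: continuous_poisson_weight.
  - move=> m w _; rewrite abse_EFin lee_fin ger0_norm.
      by rewrite poisson_weight_le1 ?ltW// grid_above_gt0.
    by rewrite poisson_weight_ge0 ?ltW// grid_above_gt0.
have bE (s : Omega -> R) w : bump k (N (s w) w)%:R = \1_[set w | N (s w) w = k] w.
  rewrite bump_nat indicE; case: eqVneq => E; first by rewrite mem_set.
  by rewrite memNset//= => /eqP; exact: negP.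
have L' : (\int[P]_w (bump k (N (grid_above m (Y t w)) w)%:R)%:E)%E
    @[m --> \oo] --> (\int[P]_w (bump k (N (Y t w) w)%:R)%:E)%E.
  apply: (dominated_cvg measurableT _ _ _ ione) => //.
  - move=> m; apply/measurable_EFinP.
    apply: (@measurableT_comp _ _ _ _ _ _ (bump k)).
      by apply: continuous_measurable_fun; exact: continuous_bump.
    exact: (@measurableT_comp _ _ _ _ _ _ (fun n : nat => n%:R : R)).
  - move=> w _; apply: cvg_EFin; first exact: nearW.
    apply: (continuous_cvg _ (@continuous_bump k _)).
    apply: (cvg_grid_above (x := fun s => (N s w)%:R)); first exact: Y_ge0.
    by have [_ _ c] := poisson_paths N_poisson w; apply: c; exact: Y_ge0.
  - move=> m w _; rewrite abse_EFin lee_fin bump_nat ger0_norm//.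
    by case: eqP.
apply: cvg_unique L => //.
have -> : P [set w | N (Y t w) w = k] = (\int[P]_w (bump k (N (Y t w) w)%:R)%:E)%E.
  under eq_integral do rewrite bE.
  by rewrite integral_indicE//; exact: measurable_poisson_random_time.
apply: cvg_trans L'; apply: near_eq_cvg; apply: nearW => m.
rewrite -poisson_grid_time//.
under eq_integral do rewrite (bE (fun w => grid_above m (Y t w))).
by rewrite integral_indicE// -[X in measurable X]setTI; exact: (mNg m measurableT [set k]).
Qed.

End poisson_random_time.

(** * Inverse subordinator *)

Section inverse_subordinator.
Context {R : realType} {d : measure_display} {Omega : measurableType d}.
Variables (P : probability Omega R) (f : R -> R) (H : R -> Omega -> R).
Hypothesis H_subordinator : is_subordinator P f H.
Notation mu := (@lebesgue_measure R).
Notation Y := (inverse_process H).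

Lemma subordinator_ge0 u w : 0 <= u -> 0 <= H u w.
Proof.
by move=> u0; have [H0 Hle _] := subordinator_paths H_subordinator w; rewrite -[leLHS]H0 Hle.
Qed.

Lemma measurable_subordinator_pair :
  measurable_fun setT (fun z : measurableTypeR R * Omega => H (Num.max z.1 0) z.2).
Proof.
apply: measurable_right_continuous; first exact: (subordinator_measurable H_subordinator).
by move=> w t t0; have [_ _ c] := subordinator_paths H_subordinator w; exact: c.
Qed.

Lemma inverse_process_ge0 t w : 0 <= Y t w.
Proof.
rewrite /inverse_process; have [->|/set0P S0] := eqVneq [set s | 0 <= s /\ t < H s w] set0.
  by rewrite inf0.
by apply: lb_le_inf => // s [].
Qed.

Lemma le_inverse_process t w u : 0 <= u -> u < Y t w -> H u w <= t.
Proof.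
move=> u0; apply: contraTT; rewrite -ltNge -leNgt => tH.
by apply: ge_inf; [exists 0 => s []|].
Qed.

Lemma inverse_process_lt t w u : (exists2 s, 0 <= s & t < H s w) -> Y t w < u -> t < H u w.
Proof.
move=> [s s0 ts] Yu.
have [|s' [s'0 ts'] s'u] := @inf_lt _ [set s | 0 <= s /\ t < H s w] _ _ Yu.
  by exists s.
have [_ Hle _] := subordinator_paths H_subordinator w.
by apply: lt_le_trans ts' _; apply: Hle => //; exact: ltW.
Qed.



(** u < Y(t) forces H(u) <= t and u > Y(t) forces H(u) > t, so the integrands can differ only at the
    single point Y(t). The first hypothesis excludes the empty set, whose infimum would be 0. *)
Lemma integral_below_level t w (phi : R -> \bar R) :
  (exists2 s, 0 <= s & t < H s w) ->
  measurable_fun setT (phi : measurableTypeR R -> _) ->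
  (\int[mu]_(u in `]0%R, +oo[) ((\1_(`]-oo, t]%classic : set R) (H u w))%:E * phi u) =
   \int[mu]_(u in `]0%R, Y t w[) phi u)%E.
Proof.
move=> ex mphi.
have mH : measurable_fun setT (fun u : measurableTypeR R => H (Num.max u 0) w).
  have mp : measurable_fun setT (fun u : measurableTypeR R => (u, w)).
    exact: measurable_fun_pair.
  exact: (measurableT_comp measurable_subordinator_pair mp).
have mI : measurable (`]-oo, t]%classic : set (measurableTypeR R)) by [].
transitivity (\int[mu]_(u in `]0%R, +oo[)
  ((\1_(`]0%R, Y t w[%classic : set R) u)%:E * phi u))%E; last first.
  rewrite integral_mkcond [RHS]integral_mkcond; apply: eq_integral => u _.
  rewrite !patchE indicE; case: ifPn => [/set_mem/=|/negP u0].
    by move=> _; case: ifPn; rewrite ?mul1e ?mul0e.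
  rewrite memNset// => /=; rewrite in_itv/= => /andP[u0' _]; apply: u0.
  by rewrite inE/= in_itv/= u0'.
transitivity (\int[mu]_(u in `]0%R, +oo[)
  ((\1_(`]-oo, t]%classic : set R) (H (Num.max u 0) w))%:E * phi u))%E.
  by apply: eq_integral => u; rewrite inE/= in_itv/= andbT => u0; rewrite max_l// ltW.
apply: ae_eq_integral => //.
- apply: measurable_funTS; apply: emeasurable_funM => //.
  by apply: (measurableT_comp (measurable_indic_EFin mI)).
- apply: measurable_funTS; apply: emeasurable_funM => //.
  exact: measurable_indic_EFin.
exists [set Y t w]; split; [exact: measurable_set1|exact: lebesgue_measure_set1|].
move=> u /= /not_implyP[]; rewrite in_itv/= andbT => u0 /eqP E.
apply/eqP; apply: contraTT isT => uY; exfalso; apply: (negP E).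
rewrite max_l ?ltW// !indicE; apply/eqP; congr (_%:R%:E * _)%E; congr nat_of_bool.
rewrite !mem_setE !in_itv/= u0/=; case: (ltgtP u (Y t w)) uY => // uY _.
  by rewrite (le_inverse_process (ltW u0)).
by rewrite leNgt (inverse_process_lt ex uY).
Qed.

(* If H never exceeds t, both sides are 0: the left one as the infimum of the empty set,
   the right one as [fine +oo]. *)
Lemma inverse_process_integral t w : Y t w =
  fine (\int[mu]_(u in `]0%R, +oo[) (\1_(`]-oo, t]%classic : set R) (H (Num.max u 0) w))%:E)%E.
Proof.
rewrite (_ : (\int[mu]_(u in _) _)%E = (\int[mu]_(u in `]0%R, +oo[)
    ((\1_(`]-oo, t]%classic : set R) (H u w))%:E * 1))%E); last first.
  by apply: eq_integral => u; rewrite inE/= in_itv/= andbT => u0; rewrite mule1 max_l// ltW.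
have [ex|nex] := pselect (exists2 s, 0 <= s & t < H s w).
  rewrite integral_below_level// integral_cst// mul1e.
  rewrite [X in fine X](lebesgue_measure_itv `]0, Y t w[)/= lte_fin.
  case: ltP => [_|]; first by rewrite oppr0 adde0.
  by move=> Y0; apply/eqP; rewrite eq_le Y0 inverse_process_ge0.
have Hle u : 0 <= u -> H u w <= t.
  by move=> u0; rewrite leNgt; apply/negP => tH; apply: nex; exists u.
rewrite (eq_integral (cst 1%E)); last first.
  move=> u; rewrite inE/= in_itv/= andbT => u0.
  by rewrite indicE mem_set ?mul1e//= in_itv/= Hle// ltW.
rewrite integral_cst// mul1e [X in fine X](lebesgue_measure_itv `]0, +oo[)/= ltry/=.
rewrite /inverse_process (_ : [set s | _] = set0) ?inf0//.
by apply/seteqP; split => // s [s0]; rewrite ltNge Hle.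
Qed.

(** An infimum over uncountably many times is not visibly measurable; the integral representation
    is, by Tonelli. *)
Lemma measurable_inverse_process t :
  measurable_fun setT (Y t : Omega -> measurableTypeR R).
Proof.
have mI : measurable (`]-oo, t]%classic : set (measurableTypeR R)) by [].
have mP : measurable (`]0, +oo[%classic : set (measurableTypeR R)) by [].
rewrite (_ : Y t = fine \o (fun w => (\int[mu]_u
    ((\1_(`]0, +oo[%classic : set R) u)%:E *
     (\1_(`]-oo, t]%classic : set R) (H (Num.max u 0)%R w))%:E))%E)); last first.
  apply/funext => w; rewrite inverse_process_integral /=; congr fine.
  by rewrite integral_indicM.
apply: (measurableT_comp (fine_measurable measurableT)).
apply: (@measurable_fun_fubini_tonelli_G _ _ (measurableTypeR R) Omega R mu
  (fun z => (\1_(`]0, +oo[%classic : set R) z.1)%:E *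
     (\1_(`]-oo, t]%classic : set R) (H (Num.max z.1 0)%R z.2))%:E)%E).
- apply: emeasurable_funM.
    exact: (measurableT_comp (measurable_indic_EFin mP)).
  exact: (measurableT_comp (measurable_indic_EFin mI) measurable_subordinator_pair).
- by move=> z; rewrite -EFinM lee_fin.
Qed.

Hypothesis f_gt0 : forall r, 0 < r -> 0 < f r.

Lemma subordinator_expectation r u : 0 < r -> 0 <= u ->
  (\int[P]_w (expR (- (r * H u w)))%:E = (expR (- (u * f r)))%:E)%E.
Proof.
move=> r0 u0; rewrite -(subordinator_laplace H_subordinator u0 r0).
by rewrite unlock.
Qed.

(** Markov's inequality gives e^(-t) P(H(n) <= t) <= E e^(-H(n)) = e^(-n f(1)), which tends to 0.
    Hence the set in [inverse_process] is almost surely nonempty. *)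
Lemma subordinator_unbounded t :
  {ae P, forall w, exists2 s, 0 <= s & t < H s w}.
Proof.
have mHn n : measurable_fun setT (H n%:R : Omega -> measurableTypeR R).
  exact: (subordinator_measurable H_subordinator).
have mI : measurable (`]-oo, t]%classic : set (measurableTypeR R)) by [].
pose B n : set Omega := H n%:R @^-1` `]-oo, t]%classic.
have mB n : measurable (B n) by rewrite -[X in measurable X]setTI; exact: mHn.
pose A := \bigcap_n B n.
have mA : measurable A by exact: bigcapT_measurable.
have PB n : ((expR (- t))%:E * P (B n) <= (expR (- (n%:R * f 1)))%:E)%E.
  have mI1 : measurable_fun setT (fun x => (\1_(B n) x : R)%:E).
    by apply/measurable_EFinP; exact: measurable_indic.
  rewrite -(subordinator_expectation ltr01 (ler0n R n)) -(integral_indicE P (mB n)).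
  rewrite -ge0_integralZl_EFin//.
  apply: ge0_le_integral => //.
  - exact: emeasurable_funM.
  - exact: (measurableT_comp (measurable_EFin_expRNM 1) (mHn n)).
  move=> w _; rewrite indicE -EFinM lee_fin.
  case: (boolP (w \in B n)) => [/set_mem|_]; last by rewrite mulr0 expR_ge0.
  by rewrite /B /= in_itv/= mulr1 ler_expR lerN2 mul1r.
exists A; split => //; last first.
  move=> w /= nex n _; rewrite /B /= in_itv/= leNgt; apply/negP => tH.
  by apply: nex; exists n%:R.
apply/eqP; rewrite eq_le measure_ge0 andbT.
have PAfin : P A \is a fin_num by exact: fin_num_measure.
rewrite -(fineK PAfin) lee_fin leNgt; apply/negP => a0.
set a := fine (P A) in a0.
have f1 := f_gt0 ltr01.
(* A positive mass a of [A] would give e^(-t) a <= e^(-n f(1)) for all n, so by 1 + x <= e^x the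
   multiples n f(1) would stay below e^t / a. *)
have K n : n%:R * f 1 <= expR t / a.
  have : expR (- t) * a <= expR (- (n%:R * f 1)).
    rewrite -lee_fin; apply: le_trans (PB n); rewrite EFinM fineK//.
    rewrite lee_wpmul2l ?lee_fin ?expR_ge0// le_measure ?inE//.
    exact: bigcap_inf.
  rewrite !expRN ler_pdivrMl ?expR_gt0// => h.
  have := expR_ge1Dx (n%:R * f 1); move: h.
  rewrite ler_pdivlMr ?expR_gt0// mulrC -ler_pdivlMr// => h1 h2.
  by apply: le_trans h1; apply: le_trans h2; rewrite lerDr.
have := K (Num.truncn (expR t / a / f 1)).+1.
rewrite -ler_pdivlMr//; apply/negP; rewrite -ltNge; exact: truncnS_gt.
Qed.

Variable lambda : R.
Hypothesis lambda_gt0 : 0 < lambda.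

Let wt n (z : measurableTypeR R * Omega) : R :=
  \1_(`]0, +oo[%classic : set R) z.1 * poisson_weight lambda n (Num.max z.1 0).

Let wt_ge0 n z : 0 <= wt n z.
Proof.
by rewrite mulr_ge0// poisson_weight_ge0 ?(ltW lambda_gt0)// le_max lexx orbT.
Qed.

Let mwt n : measurable_fun setT (wt n).
Proof.
have m1 : measurable_fun setT (\1_(`]0, +oo[%classic : set R) : measurableTypeR R -> R).
  by apply: measurable_indic.
have mm : measurable_fun setT (fun z : measurableTypeR R * Omega => Num.max z.1 0).
  exact: measurable_maxr.
apply: measurable_funM; first exact: (measurableT_comp m1 (@measurable_fst _ _ _ _)).
exact: (measurableT_comp (measurable_poisson_weight lambda n) mm).
Qed.

(** The image of the product of the weighted time axis and [P] under the evaluation of H. Both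
    orders of integration are recorded: P inside for the Laplace transform, u inside for the
    distribution function. *)
Lemma subordinator_potential n : exists W : {finite_measure set (measurableTypeR R) -> \bar R},
  forall psi : R -> \bar R, measurable_fun setT psi -> (forall x, 0 <= psi x)%E ->
    (\int[W]_x psi x = \int[mu]_(u in `]0%R, +oo[)
       ((poisson_weight lambda n u)%:E * \int[P]_w psi (H u w)))%E /\
    (\int[W]_x psi x = \int[P]_w \int[mu]_(u in `]0%R, +oo[)
       (psi (H u w) * (poisson_weight lambda n u)%:E))%E.
Proof.
have [|W WE] := @finite_weighted_image _ _ _ (measurableTypeR R) R (mu \x P)%E (wt n)
    (fun z => H (Num.max z.1 0) z.2) (mwt n) (@wt_ge0 n) measurable_subordinator_pair.
  rewrite (@fubini_tonelli1 _ _ (measurableTypeR R) Omega R mu P (EFin \o wt n))//; last 2 first.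
  - exact/measurable_EFinP.
  - by move=> z; rewrite lee_fin.
  have E u : fubini_F P (EFin \o wt n) u = ((\1_(`]0, +oo[%classic : set R) u)%:E *
      (poisson_weight lambda n (Num.max u 0))%:E)%E.
    rewrite /fubini_F/= (integral_cst P measurableT (wt n (u, point))%:E).
    by rewrite [X in (_ * X)%E]probability_setT mule1 EFinM.
  under eq_integral do rewrite E.
  rewrite integral_indicM//.
  under eq_integral.
    by move=> u; rewrite inE/= in_itv/= andbT => u0; rewrite max_l ?(ltW u0)//; over.
  by rewrite integral_poisson_weight// ltry.
exists W => psi mpsi psi0; rewrite WE//.
have mG : measurable_fun setT (fun z : measurableTypeR R * Omega =>
    psi (H (Num.max z.1 0)%R z.2) * (wt n z)%:E)%E.
  apply: emeasurable_funM; last exact/measurable_EFinP.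
  exact: (measurableT_comp mpsi measurable_subordinator_pair).
have G0 z : (0 <= psi (H (Num.max z.1 0)%R z.2) * (wt n z)%:E)%E.
  by apply: mule_ge0; [exact: psi0|rewrite lee_fin; exact: wt_ge0].
have pw0 u : 0 < u -> 0 <= poisson_weight lambda n u.
  by move=> u0; rewrite poisson_weight_ge0// ltW.
split.
- rewrite (@fubini_tonelli1 _ _ (measurableTypeR R) Omega R mu P _ mG G0).
  rewrite /fubini_F/= [RHS]integral_mkcond; apply: eq_integral => u _.
  rewrite patchE /wt/= indicE; case: ifPn => u0; last first.
    by rewrite integral0_eq// => w _; rewrite mul0r mule0.
  move: u0; rewrite inE/= in_itv/= andbT => u0.
  rewrite max_l ?(ltW u0)// mul1r -ge0_integralZl_EFin ?pw0//.
    by apply: eq_integral => w _; rewrite muleC.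
  apply: (measurableT_comp mpsi); exact: (subordinator_measurable H_subordinator (ltW u0)).
- rewrite (@fubini_tonelli2 _ _ (measurableTypeR R) Omega R mu P _ mG G0).
  rewrite /fubini_G/=; apply: eq_integral => w _.
  rewrite [RHS]integral_mkcond; apply: eq_integral => u _.
  rewrite patchE /wt/= indicE; case: ifPn => u0; last by rewrite mul0r mule0.
  by move: u0; rewrite inE/= in_itv/= andbT => u0; rewrite mul1r max_l// ltW.
Qed.

End inverse_subordinator.

(** * Laplace transform and distribution function of the weighted potentials *)

Section inverse_subordinator_law.
Context {R : realType} {d : measure_display} {Omega : measurableType d}.
Variables (P : probability Omega R) (f : R -> R) (H : R -> Omega -> R).
Hypothesis H_subordinator : is_subordinator P f H.
Hypothesis f_gt0 : forall r, 0 < r -> 0 < f r.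
Variables (lambda : R).
Hypothesis lambda_gt0 : 0 < lambda.
Variables (n : nat) (W : {finite_measure set (measurableTypeR R) -> \bar R}).
Notation mu := (@lebesgue_measure R).
Notation Y := (inverse_process H).
Hypothesis WE : forall psi : R -> \bar R, measurable_fun setT psi -> (forall x, 0 <= psi x)%E ->
    (\int[W]_x psi x = \int[mu]_(u in `]0%R, +oo[)
       ((poisson_weight lambda n u)%:E * \int[P]_w psi (H u w)))%E /\
    (\int[W]_x psi x = \int[P]_w \int[mu]_(u in `]0%R, +oo[)
       (psi (H u w) * (poisson_weight lambda n u)%:E))%E.

Lemma subordinator_potential_neg : W `]-oo, 0%R[%classic = 0%E.
Proof.
have mI : measurable (`]-oo, 0%R[%classic : set (measurableTypeR R)) by [].
rewrite -(integral_indicE W mI) (WE (measurable_indic_EFin mI) _).1 => [|x]; last first.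
  by rewrite lee_fin.
rewrite integral0_eq// => u; rewrite /= in_itv/= andbT => u0.
rewrite integral0_eq ?mule0// => w _.
by rewrite indicE memNset//= in_itv/= ltNge (subordinator_ge0 H_subordinator)// ltW.
Qed.

Lemma laplace_subordinator_potential r : 0 < r ->
  laplace W r = (lambda ^+ n / (lambda + f r) ^+ n.+1)%:E.
Proof.
move=> r0; have c0 : 0 < lambda + f r by rewrite addr_gt0// f_gt0.
rewrite /laplace (WE (measurable_EFin_expRNM r) _).1 => [|x]; last by rewrite lee_fin expR_ge0.
under eq_integral => u.
  rewrite inE/= in_itv/= andbT => u0.
  rewrite (subordinator_expectation H_subordinator r0 (ltW u0)) -EFinM.
  rewrite poisson_weight_rate ?gt_eqF// EFinM; over.
rewrite ge0_integralZl_EFin//; last 3 first.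
- by move=> u; rewrite /= in_itv/= andbT => u0; rewrite lee_fin poisson_weight_ge0// ltW.
- by apply: measurable_funTS; apply/measurable_EFinP; exact: measurable_poisson_weight.
- by rewrite exprn_ge0// divr_ge0 ?ltW.
rewrite integral_poisson_weight// -EFinM; congr EFin.
by rewrite expr_div_n exprSr invfM mulrA.
Qed.

(** Path by path, [integral_below_level] reduces to an integral of the weight up to Y(t), which
    [integral_poisson_weight_itv] evaluates; expectations are then taken. *)
Lemma subordinator_potential_cdf t : 0 <= t ->
  (lambda%:E * W `]-oo, t]%classic =
   1 - \sum_(k < n.+1) \int[P]_w (poisson_weight lambda k (Y t w))%:E)%E.
Proof.
move=> t0; have mI : measurable (`]-oo, t]%classic : set (measurableTypeR R)) by [].
have mpw k : measurable_fun setT (fun w => (poisson_weight lambda k (Y t w))%:E).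
  apply/measurable_EFinP; apply: (measurableT_comp (measurable_poisson_weight lambda k)).
  exact: (measurable_inverse_process H_subordinator).
have pw0 k w : 0 <= poisson_weight lambda k (Y t w).
  by rewrite poisson_weight_ge0 ?(ltW lambda_gt0)// inverse_process_ge0.
have ipw k : P.-integrable setT (fun w => (poisson_weight lambda k (Y t w))%:E).
  have ione : P.-integrable setT (cst 1%E) by apply: finite_measure_integrable_cst.
  apply: (le_integrable measurableT (mpw k) _ ione).
  move=> w _; rewrite !abse_EFin lee_fin normr1 ger0_norm//.
  by rewrite poisson_weight_le1 ?(ltW lambda_gt0)// inverse_process_ge0.
rewrite -(integral_indicE W mI) (WE (measurable_indic_EFin mI) _).2 => [|x]; last first.
  by rewrite lee_fin.
have mpw' D : measurable_fun (D : set (measurableTypeR R)) (EFin \o poisson_weight lambda n).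
  by apply: measurable_funTS; apply/measurable_EFinP; exact: measurable_poisson_weight.
have E w : (exists2 s, 0 <= s & t < H s w) ->
    (lambda%:E * \int[mu]_(u in `]0%R, +oo[)
      ((\1_(`]-oo, t]%classic : set R) (H u w))%:E * (poisson_weight lambda n u)%:E) =
    (1 - \sum_(k < n.+1) poisson_weight lambda k (Y t w))%:E)%E.
  move=> ex; rewrite (integral_below_level H_subordinator ex (mpw' setT)).
  rewrite -integral_poisson_weight_itv ?inverse_process_ge0//.
  rewrite -ge0_integralZl_EFin//; last by exact: ltW.
  by move=> u; rewrite /= in_itv/= => /andP[u0 _]; rewrite lee_fin poisson_weight_ge0// ltW.
pose G w := (\int[mu]_(u in `]0%R, +oo[)
      ((\1_(`]-oo, t]%classic : set R) (H u w))%:E * (poisson_weight lambda n u)%:E))%E.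
have G0 w : (0 <= G w)%E.
  apply: integral_ge0 => u; rewrite /= in_itv/= andbT => u0.
  by rewrite -EFinM lee_fin mulr_ge0// poisson_weight_ge0// ltW.
have mG : measurable_fun setT G.
  have mP : measurable (`]0, +oo[%classic : set (measurableTypeR R)) by [].
  pose F (z : measurableTypeR R * Omega) := ((\1_(`]0, +oo[%classic : set R) z.1)%:E *
    (\1_(`]-oo, t]%classic : set R) (H (Num.max z.1 0)%R z.2))%:E *
    (poisson_weight lambda n (Num.max z.1 0)%R)%:E)%E.
  rewrite (_ : G = fubini_G mu F); last first.
    apply/funext => w; rewrite /G /fubini_G /F [LHS]integral_mkcond; apply: eq_integral => u _.
    have I : \1_(`]0, +oo[%classic : set R) u = (u \in (`]0, +oo[%classic : set R))%:R :> R.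
      by rewrite indicE.
    rewrite patchE/= I; case: ifPn => u0; last by rewrite !mul0e.
    by move: u0; rewrite inE/= in_itv/= andbT => u0; rewrite mul1e max_l// ltW.
  apply: measurable_fun_fubini_tonelli_G => [|z].
    have mm : measurable_fun setT (fun z : measurableTypeR R * Omega => Num.max z.1 0).
      exact: measurable_maxr.
    apply: emeasurable_funM.
      apply: emeasurable_funM; first exact: (measurableT_comp (measurable_indic_EFin mP)).
      exact: (measurableT_comp (measurable_indic_EFin mI)
        (measurable_subordinator_pair H_subordinator)).
    exact: (measurableT_comp (mpw' setT) mm).
  rewrite /F; apply: mule_ge0; first by rewrite -EFinM lee_fin.
  by rewrite lee_fin poisson_weight_ge0 ?(ltW lambda_gt0)// le_max lexx orbT.
rewrite -/(G _) -ge0_integralZl_EFin ?(ltW lambda_gt0)//; last by move=> w _; exact: G0.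
transitivity (\int[P]_w (1 - \sum_(k < n.+1) poisson_weight lambda k (Y t w))%:E)%E.
  apply: ae_eq_integral => //.
  - exact: emeasurable_funM.
  - apply/measurable_EFinP; apply: measurable_funB => //.
    by apply: measurable_sum => k; apply/measurable_EFinP; exact: mpw.
  (* The pathwise identity [E] may fail where H never exceeds t, an event contained in the null set
     [N]. *)
  have [N [mN N0 HN]] := subordinator_unbounded H_subordinator f_gt0 t.
  exists N; split => //; apply: subset_trans HN => w /= nE ex.
  by apply: nE => _; exact: E.
under eq_integral do rewrite EFinB -sumEFin.
rewrite integralB//; last first.
- by apply: integrable_sum => // k _; exact: ipw.
- by apply: finite_measure_integrable_cst.
rewrite integral_cst// [X in (_ * X - _)%E]probability_setT mul1e integral_sum//.
Qed.

End inverse_subordinator_law.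

(** If f(r) = 0 then 1 - e^(-r s) vanishes almost everywhere, so [nu0] charges only ]-oo, 0], where
    it has mass 0; this contradicts its infinite total mass. *)
Lemma levy_exponent_gt0 {R : realType}
    (nu0 : {sigma_finite_measure set (measurableTypeR R) -> \bar R}) (f : R -> R) :
  nu0 `]-oo, 0%R]%classic = 0%E ->
  (forall r, 0 < r -> (\int[nu0]_s (1 - expR (- (r * Num.max s 0)))%:E = (f r)%:E)%E) ->
  nu0 setT = +oo%E -> forall r, 0 < r -> 0 < f r.
Proof.
move=> nu0_pos fE nu0y r r0; rewrite lt_neqAle (levy_exponent_ge0 fE r0) andbT.
apply/negP => /eqP fr0.
have m1 : measurable_fun setT (fun s : measurableTypeR R => (1 - tilt r s)%:E).
  by apply/measurable_EFinP; exact: measurable_onem_tilt.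
have : (\int[nu0]_s `|(1 - tilt r s)%:E| = 0)%E.
  under eq_integral => s _.
    rewrite gee0_abs; last by rewrite lee_fin subr_ge0; apply: tilt_le1; exact: ltW.
    over.
  by rewrite [LHS](fE r r0) -fr0.
move=> /(ae_eq_integral_abs nu0 measurableT m1) [N [mN N0 HN]].
have : (nu0 setT <= nu0 `]-oo, 0%R]%classic + nu0 N)%E.
  apply: (le_trans _ (measureU2 nu0 _ mN)) => //; apply: le_measure; rewrite ?inE//.
    exact: measurableU.
  move=> s _; have [s0|s0] := leP s 0; first by left; rewrite /= in_itv.
  right; apply: HN => /= /(_ I) [] /eqP; rewrite subr_eq0 eq_sym => /eqP.
  rewrite tilt_pos ?ltW// -expR0 => /expR_inj/eqP.
  by rewrite oppr_eq0 mulf_eq0 !gt_eqF.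
by rewrite nu0_pos N0 adde0 nu0y.
Qed.

(** * Convolution of the Lévy tail with the density of a potential *)

Section poisson_potential_tail.
Context {R : realType}.
Variables (nu0 : {sigma_finite_measure set (measurableTypeR R) -> \bar R}) (lambda : R).
Hypothesis lambda_gt0 : 0 < lambda.
Variable W : {finite_measure set (measurableTypeR R) -> \bar R}.
Hypothesis W_ac : forall E : set (measurableTypeR R), measurable E ->
  lebesgue_measure E = 0%E -> W E = 0%E.
Hypothesis W_pos : W `]-oo, 0%R[%classic = 0%E.
Variable w : R -> R.
Hypothesis w_ge0 : forall x, 0 <= w x.
Hypothesis mw : measurable_fun setT (w : measurableTypeR R -> measurableTypeR R).
Hypothesis Ww : forall phi : R -> \bar R, measurable_fun setT phi -> (forall x, 0 <= phi x)%E ->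
  (\int[W]_x phi x = \int[lebesgue_measure]_x (phi x * (w x)%:E))%E.
Hypothesis mk : measurable_fun setT (killed_tail nu0 lambda : measurableTypeR R -> R).

Lemma potential_itvNyc t : W `]-oo, t]%classic = W `]-oo, t[%classic.
Proof.
rewrite -(@setUitv1 _ _ -oo%O t true)// measureU//.
- by rewrite [X in (_ + X)%E]W_ac ?adde0//; exact: lebesgue_measure_set1.
- by apply/seteqP; split => // x []/= + xt; rewrite xt in_itv/= ltxx.
Qed.

(** Below t the killed tail is lambda plus the Lévy tail. The constant gives the mass; the rest,
    written with the density [w] and reflected, is the convolution that occurs in the
    Caputo-Djrbashian derivative. [psi] drops y <= 0, a null set for [W]. *)
Lemma potential_tail_integral t : 0 < t ->
  (\int[W]_y (killed_tail nu0 lambda (t - y))%:E =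
   lambda%:E * W `]-oo, t]%classic +
   \int[lebesgue_measure]_(s in `]0%R, t[) (w (t - s) * fine (nu0 `]s, +oo[%classic))%:E)%E.
Proof.
move=> t0; set kt := killed_tail nu0 lambda.
pose psi y : R := \1_(`]0, t[%classic : set R) y * (kt (t - y) - lambda).
have mI : measurable (`]0, t[%classic : set (measurableTypeR R)) by [].
have mJ : measurable (`]-oo, t[%classic : set (measurableTypeR R)) by [].
have mr : measurable_fun setT (fun y : measurableTypeR R => t - y : measurableTypeR R).
  exact: measurable_funB.
have mkt : measurable_fun setT (fun y : measurableTypeR R => kt (t - y))
  by exact: (measurableT_comp mk mr).
have ktE y : y < t -> kt (t - y) = lambda + fine (nu0 `](t - y)%R, +oo[%classic).
  by move=> yt; rewrite /kt /killed_tail subr_gt0 yt.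
have psi0 y : 0 <= psi y.
  rewrite /psi indicE; have [/set_mem|_] := boolP (y \in _); last by rewrite mul0r.
  by rewrite /= in_itv/= => /andP[_ yt]; rewrite mul1r ktE// addrC addKr fine_ge0.
have mpsi : measurable_fun setT (psi : measurableTypeR R -> R).
  by apply: measurable_funM; [exact: measurable_indic|exact: measurable_funB].
transitivity (\int[W]_y (lambda%:E * (\1_(`]-oo, t[%classic : set R) y)%:E + (psi y)%:E))%E.
  apply: ae_eq_integral => //.
  - exact/measurable_EFinP.
  - apply: emeasurable_funD; last exact/measurable_EFinP.
    by apply: emeasurable_funM => //; exact: measurable_indic_EFin.
  exists `]-oo, 0]%classic; split => //; first by rewrite [LHS]potential_itvNyc.
  move=> y /= /not_implyP[_ nE]; rewrite in_itv/= leNgt; apply/negP => y0; apply: nE.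
  rewrite /psi !indicE !mem_setE !in_itv/= y0/=; case: ltP => yt.
    by rewrite mulr1n -EFinM -EFinD; congr EFin; ring.
  by rewrite /kt /killed_tail subr_gt0 ltNge yt/= mul0r mule0 adde0.
rewrite ge0_integralD//; last 4 first.
- by move=> y _; rewrite -EFinM lee_fin mulr_ge0// ltW.
- by apply: emeasurable_funM => //; exact: measurable_indic_EFin.
- by move=> y _; rewrite lee_fin.
- exact/measurable_EFinP.
rewrite ge0_integralZl_EFin ?(ltW lambda_gt0)//; last exact: measurable_indic_EFin.
rewrite integral_indicE//; congr (_ + _)%E.
  by rewrite potential_itvNyc.
rewrite Ww//; last by exact/measurable_EFinP.
rewrite -(ge0_integral_lebesgue_reflect t (f := fun y => (psi y)%:E * (w y)%:E)%E).
- rewrite [RHS]integral_mkcond; apply: eq_integral => s _; rewrite patchE /psi indicE.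
  have -> : (t - s \in (`]0, t[%classic : set R)) = (s \in (`]0, t[%classic : set R)).
    by rewrite !mem_setE !in_itv/= subr_gt0 gtrBl andbC.
  case: ifPn => [/set_mem|_]; last by rewrite mul0r mul0e.
  rewrite /= in_itv/= => /andP[s0 st]; rewrite mul1r subKr /kt /killed_tail s0.
  by rewrite addrC addKr -EFinM mulrC.
- by apply: emeasurable_funM; exact/measurable_EFinP.
- by move=> y; rewrite -EFinM lee_fin mulr_ge0.
Qed.

End poisson_potential_tail.

Unset Implicit Arguments.

Theorem theorem3 (R : realType) (d : measure_display) (Omega : measurableType d)
    (P : probability Omega R)
    (nubar : {measure set (measurableTypeR R) -> \bar R})
    (f : R -> R) (H : R -> Omega -> R)
    (lambda : R) (N : R -> Omega -> nat)
    (nubar_levy : is_levy_measure nubar)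
    (f_bernstein : forall x, 0 < x -> f x = bernstein_fun nubar x)
    (nubar_infinite : nubar `]0%R, +oo[%classic = +oo%E)
    (tail_ac : forall a b, 0 < a -> a <= b -> abs_cont a b (levy_tail nubar))
    (H_subordinator : is_subordinator P f H)
    (lambda_gt0 : 0 < lambda)
    (N_poisson : is_poisson_process P lambda N)
    (NY_indep : independent_processes P N (inverse_process H)) :
  let p := state_prob P N (inverse_process H) in
  let nu := levy_tail nubar in
  forall x : nat,
    [/\ caputo_djrbashian_dom nu (p x),
        (forall t, 0 < t ->
           caputo_djrbashian nu (p x) t = - lambda * (p x t - p (x%:Z - 1) t)) &
        p x 0 = (if x == 0%N then 1 else 0)].
Proof.
move=> p nu.
have [nu0 [nu0_pos fE nu0y nu0_ac nu0_tail]] :=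
  levy_measure_restriction nubar_levy f_bernstein nubar_infinite tail_ac.
have f_gt0 := levy_exponent_gt0 nu0_pos fE nu0y.
have [W WE] := choice (fun n => subordinator_potential H_subordinator lambda_gt0 n).
have W_pos n := subordinator_potential_neg H_subordinator (WE n).
have WL n r r0 := laplace_subordinator_potential H_subordinator f_gt0 lambda_gt0 (WE n) (r := r) r0.
have W_ac n := poisson_potential_ac nu0_pos fE nu0y nu0_ac lambda_gt0 W_pos WL n.
have [w Hw] := choice (poisson_potential_density nu0_pos fE nu0y nu0_ac lambda_gt0 W_pos WL).
have w0 n x : 0 <= w n x by have [] := Hw n.
have iw n : (@lebesgue_measure R).-integrable setT (EFin \o w n) by have [] := Hw n.
have mw n : measurable_fun setT (w n : measurableTypeR R -> measurableTypeR R).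
  by apply/measurable_EFinP; exact: measurable_int (iw n).
have Ww n phi : measurable_fun setT phi -> (forall x, 0 <= phi x)%E ->
    (\int[W n]_x phi x = \int[lebesgue_measure]_x (phi x * (w n x)%:E))%E.
  by have [_ _] := Hw n; apply.
pose F n t := fine (W n `]-oo, t]%classic).
have FE n t : (F n t)%:E = W n `]-oo, t]%classic.
  by rewrite /F fineK// fin_num_measure.
have pE (k : nat) t : 0 <= t ->
    (p k t)%:E = (\int[P]_w (poisson_weight lambda k (inverse_process H t w))%:E)%E.
  move=> t0.
  rewrite -(poisson_random_time lambda_gt0 N_poisson
    (fun s _ => measurable_inverse_process H_subordinator s)
    (fun s w _ => inverse_process_ge0 H s w) NY_indep k t0).
  by rewrite /p/= fineK// fin_num_measure//; apply: (measurable_poisson_random_time N_poisson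
    (fun s _ => measurable_inverse_process H_subordinator s)
    (fun s w _ => inverse_process_ge0 H s w)).
have pF (n : nat) t : 0 <= t -> lambda * F n t = 1 - \sum_(k < n.+1) p k t.
  move=> t0; apply: EFin_inj; rewrite EFinM FE.
  rewrite (subordinator_potential_cdf H_subordinator f_gt0 lambda_gt0 (WE n) t0).
  by rewrite EFinB -sumEFin; congr (_ - _)%E; apply: eq_bigr => k _; rewrite pE.
(* Differences of consecutive instances of [pF] isolate the state probabilities. *)
have p0E t : 0 <= t -> p 0%N t = 1 - lambda * F 0%N t.
  by move=> t0; rewrite pF// big_ord1 subKr.
have pSE (n : nat) t : 0 <= t -> p n.+1 t = lambda * (F n t - F n.+1 t).
  by move=> t0; rewrite mulrBr !pF// (big_ord_recr n.+1)/=; ring.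
(* [W n] has no mass below 0 and, being absolutely continuous, no atom at 0; the initial condition
   follows from this. *)
have F0 n : F n 0 = 0.
  by rewrite /F potential_itvNyc ?W_pos//; exact: W_ac.
(* The density of index n - 1; the value 0 at n = 0 matches the vanishing probability of the state
   -1. *)
pose v n x := if n is m.+1 then w m x else 0.
have iv n : (@lebesgue_measure R).-integrable setT (EFin \o v n).
  by case: n => [|n]; [exact: integrable0|exact: iw].
pose q n x := lambda * (v n x - w n x).
have iq n : (@lebesgue_measure R).-integrable setT (EFin \o q n).
  exact: (integrableZl measurableT lambda (integrableB measurableT (iv n) (iw n))).
have Fw n t : F n t = \int[lebesgue_measure]_(x in `]-oo, t]) w n x.
  rewrite /F /Rintegral; congr fine.
  have mI : measurable (`]-oo, t]%classic : set (measurableTypeR R)) by [].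
  rewrite -(integral_indicE _ mI) Ww//; last exact: measurable_indic_EFin.
  by rewrite integral_indicM.
have R0 (D : set (measurableTypeR R)) : \int[lebesgue_measure]_(x in D) (0 : R) = 0.
  by rewrite /Rintegral integral0.
have pq (n : nat) t : 0 <= t -> p n t = (n == 0%N)%:R + \int[lebesgue_measure]_(x in `]-oo, t]) q n x.
  move=> t0.
  have iS u : (@lebesgue_measure R).-integrable setT (EFin \o u) ->
      (@lebesgue_measure R).-integrable `]-oo, t] (EFin \o u).
    by move=> iu; exact: integrableS iu.
  rewrite RintegralZl//; last first.
    exact: (integrableB _ (iS _ (iv n)) (iS _ (iw n))).
  rewrite RintegralB//; [|exact: iS (iv n)|exact: iS (iw n)].
  rewrite -Fw; case: n => [|n]; last by rewrite add0r pSE// Fw.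
  by rewrite p0E// /v R0 sub0r mulrN.
have nuE s : 0 < s -> nu s = fine (nu0 `]s, +oo[%classic).
  by move=> s0; rewrite /nu /levy_tail nu0_tail.
have mkt := measurable_killed_tail nu0 lambda.
have mnu t : 0 < t -> measurable_fun (`]0, t[%classic : set (measurableTypeR R)) nu.
  move=> t0; apply: (eq_measurable_fun
    (fun s : measurableTypeR R => killed_tail nu0 lambda s - lambda)).
    by move=> s; rewrite inE/= in_itv/= => /andP[s0 _]; rewrite /killed_tail s0 nuE// addrC addKr.
  by apply: measurable_funTS; exact: measurable_funB.
(* Subtract lambda F_n from the renewal integral of [W n]: for index 0 this leaves 1 - lambda F_0,
   and for index n + 1 it leaves lambda (F_n - F_(n+1)). *)
have kE (n : nat) t : 0 < t ->
    (\int[lebesgue_measure]_(s in `]0%R, t[) (w n (t - s) * nu s)%:E = (p n t)%:E)%E.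
  move=> t0.
  transitivity (\int[lebesgue_measure]_(s in `]0%R, t[)
      (w n (t - s) * fine (nu0 `]s, +oo[%classic))%:E)%E.
    by apply: eq_integral => s; rewrite inE/= in_itv/= => /andP[s0 _]; rewrite nuE.
  have := potential_tail_integral lambda_gt0 (W_ac n) (W_pos n) (w0 n) (mw n) (Ww n) mkt t0.
  set I := (X in (_ = _ + X)%E -> X = _); rewrite -FE -EFinM => K.
  have -> : I = ((\int[W n]_y (killed_tail nu0 lambda (t - y))%:E) - (lambda * F n t)%:E)%E.
    by rewrite K addeAC subee ?add0e.
  case: n @I K => [|n] I K.
    rewrite (poisson_renewal0 nu0_pos fE nu0_ac lambda_gt0 W_pos WL t0) -EFinB.
    by rewrite p0E// ltW.
  rewrite (poisson_renewalS nu0_pos fE nu0_ac lambda_gt0 W_pos WL n t0).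
  rewrite -(potential_itvNyc (W_ac n)) -FE -EFinM -EFinB -mulrBr pSE//; exact: ltW.
(* The integrand is nonnegative, so [kE] also yields integrability, although nu is unbounded near
   0. *)
have ik n t : 0 < t -> (@lebesgue_measure R).-integrable `]0, t[
    (fun s => (w n (t - s) * nu s)%:E).
  move=> t0; apply/integrableP; split.
    apply/measurable_EFinP; apply: measurable_funM; last exact: mnu.
    by apply: measurable_funTS; apply: (measurableT_comp (mw n)); exact: measurable_funB.
  under eq_integral => s.
    rewrite inE/= in_itv/= => /andP[s0 _].
    rewrite ger0_norm; last by rewrite mulr_ge0// nuE// fine_ge0.
    over.
  by rewrite kE// ltry.
have ikv n t : 0 < t -> (@lebesgue_measure R).-integrable `]0, t[
    (fun s => (v n (t - s) * nu s)%:E).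
  case: n => [|n] t0; last exact: ik.
  rewrite (_ : (fun s => _) = cst 0%E); first exact: integrable0.
  by apply/funext => s; rewrite mul0r.
have qE n t s : q n (t - s) * nu s = lambda * (v n (t - s) * nu s - w n (t - s) * nu s).
  by rewrite /q; ring.
have iG n t : 0 < t -> (@lebesgue_measure R).-integrable `]0, t[
    (fun s => (q n (t - s) * nu s)%:E).
  move=> t0; rewrite (_ : (fun s => _) =
    (fun s => (lambda * (v n (t - s) * nu s - w n (t - s) * nu s))%:E)); last first.
    by apply/funext => s; rewrite qE.
  exact: (integrableZl _ lambda (integrableB _ (ikv n _ t0) (ik n _ t0))).
move=> n; split.
- exact: (caputo_djrbashian_dom_of_density (iq n) (pq n) mnu (iG n)).
- move=> t t0; rewrite (caputo_djrbashian_of_density (iq n) (pq n) mnu (iG n) t0).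
  transitivity (\int[lebesgue_measure]_(s in `]0, t[)
      (lambda * (v n (t - s) * nu s - w n (t - s) * nu s))).
    by apply: eq_Rintegral => s _; exact: qE.
  rewrite RintegralZl//; last by exact: (integrableB _ (ikv n _ t0) (ik n _ t0)).
  rewrite RintegralB//; [|exact: ikv|exact: ik].
  have kR (m : nat) : \int[lebesgue_measure]_(s in `]0, t[) (w m (t - s) * nu s) = p m t.
    by rewrite /Rintegral kE.
  rewrite kR mulNr -mulrN opprB; congr (_ * (_ - _)).
  (* For n = 0 the state 0 - 1 computes to a [Negz], of probability 0 by definition, and [v 0]
     vanishes. *)
  case: n => [|n]; last by rewrite kR -addn1 PoszD addrK.
  by under eq_Rintegral do rewrite mul0r; rewrite R0.
- by case: n => [|n]; rewrite ?p0E ?pSE// !F0 ?subrr mulr0// subr0.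
Qed.
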